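(* (1) Let $T$ be a theory extending $\Sigma^1_1\text{-}\mathsf{AC}_0^{-}$ containing an axiom saying that a binary relation symbol $\preceq$ of the signature is a well-order of the domain. Suppose $T$ is true on all standard models whose first-order domain is countably infinite and in which $\preceq$ is interpreted as a well-order. Let $Q$ be a generalized quantifier, of type $(n_1,\ldots,n_\ell)$, which is Henkin domain independent relative to $T$. For each countably infinite set $A$, consider an associated standard model $\mathcal A$ of $T$ with first-order domain $A$ and with $\preceq$ interpreted as a well-order of $A$. For each $n\ge1$ regard $P(A^n)$ as a Polish space by identifying it with the countable product $\{0,1\}^{A^n}$, and similarly for finite products of these. Then $Q$ is Borel on these models under this identification, i.e. $\{\overline R\in P(A^{n_1})\times\cdots\times P(A^{n_\ell}) : \mathcal A\models Q(\overline R)\}$ is Borel. (2) Let $T$ be a theory extending $\Sigma^1_1\text{-}\mathsf{AC}_0^{-}$ containing an axiom saying that a binary relation symbol $\preceq$ of the signature is a well-order of the domain. Suppose $T$ is true on all standard models with finite first-order domain $\{0,\ldots,m\}$, $m\ge1$, in which $\preceq$ is interpreted as the usual order on the natural numbers. Let $Q$ be a generalized quantifier, of type $(n_1,\ldots,n_\ell)$, which is Henkin domain independent relative to $T$. For $m\ge1$ consider the finite standard models $\mathcal A_m$ of $T$ with domain $\{0,\ldots,m\}$ and with $\preceq$ interpreted as the usual order on the natural numbers. Then the problem of determining membership in $Q$ on these models, i.e. of determining for $\overline R\in P(\{0,\ldots,m\}^{n_1})\times\cdots\times P(\{0,\ldots,m\}^{n_\ell})$ whether $\mathcal A_m\models Q(\overline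 R)$, is in $\mathsf{NP}\cap\mathsf{co\text{-}NP}$.
   Context: Language: second-order logic with individual variables and, for each $n\ge1$, $n$-ary relation variables, identity, atomic formulas $R\overline x$, and a signature of extra-logical symbols, which may contain individual constant symbols $c$ and relation symbols $C$ (of various arities) on individuals. In the claim the signature contains the binary relation symbol $\preceq$ and possibly other symbols. A formula is first-order if it has no second-order quantifiers; it is $\Sigma^1_1$ if it is a block of existential second-order quantifiers followed by a first-order formula. Henkin model: $\mathcal A=(A,S_1[A],S_2[A],\ldots)$ with $A\neq\emptyset$ and $\emptyset\neq S_n[A]\subseteq P(A^n)$, together with interpretations $c^{\mathcal A}\in A$ and $C^{\mathcal A}\subseteq A^n$ of the individual constant symbols $c$ and $n$-ary relation symbols $C$ of the signature; $n$-ary relation variables range over $S_n[A]$; $R\overline a$ means $\overline a\in R$. It is standard if $S_n[A]=P(A^n)$ for all $n\ge1$. $\mathcal A$ is a substructure of $\mathcal B$ if $A\subseteq B$, $S_n[A]\subseteq S_n[B]$ for all $n\ge1$, $c^{\mathcal B}=c^{\mathcal A}$ for every individual constant symbol $c$, and $C^{\mathcal B}\cap A^n=C^{\mathcal A}$ for every $n$-ary relation symbol $C$. $\Sigma^1_1\text{-}\mathsf{AC}_0^{-}$ consists of: extensionality for each arity; comprehension $\exists R\,\forall\overline x\,(R\overline x\leftrightarrow\varphi(\overline x))$ for all first-order $\varphi$ of the signature (parameters allowed, $R$ not free in $\varphi$); and $\forall\overline x\,\exists R\,\varphi(\overline x,R)\rightarrow\exists R'\,\forall\overline x\,\varphi(\overline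 x,R'[\overline x])$ for $\Sigma^1_1$ formulas $\varphi$ (parameters allowed), where $R'[\overline x]=\{\overline y:R'\overline x\,\overline y\}$. The well-order axiom says that $\preceq$ is reflexive, antisymmetric, transitive, linear, and that every non-empty unary $X$ has a $\preceq$-least element. A generalized quantifier of type $(n_1,\ldots,n_\ell)$ is a formula $Q(R_1,\ldots,R_\ell)$ whose only free variables are the displayed second-order variables, $R_i$ being $n_i$-ary. $Q$ is Henkin domain independent relative to $T$ if for all Henkin models $\mathcal A,\mathcal B$ of $T$ with $\mathcal A$ a substructure of $\mathcal B$ and all $\overline R\in S_{n_1}[A]\times\cdots\times S_{n_\ell}[A]$: $\mathcal A\models Q(\overline R)$ iff $\mathcal B\models Q(\overline R)$. In (2), an instance is a model $\mathcal A_m$ together with $\overline R$, encoded in the standard way of finite model theory: $m$, the relations $\overline R$ as characteristic bit strings over $\{0,\ldots,m\}$, and, if symbols other than $\preceq$ occur in $Q$, their interpretations in $\mathcal A_m$. *)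

(* Defs.v *)
From mathcomp Require Import all_boot.
From mathcomp Require Import all_classical.
From mathcomp Require wochoice.
From mathcomp Require Import topology measurable_structure.

Set Implicit Arguments.
Unset Strict Implicit.
Unset Printing Implicit Defensive.

Local Open Scope classical_set_scope.

(** ** Second-order logic

    All arities are positive, and they are stored minus one: the natural number
    [n] stands for the arity [n.+1].  A pair [(n, X)] is the relation variable
    number [X] of arity [n.+1]. *)

(* [psym] holds the relation symbols other than the binary symbol for the
   order, which belongs to every signature (it is [None : rsym L]). *)
Record signature := Signature {
  csym : eqType;
  psym : eqType;
  par : psym -> nat
}.

Definition rsym (L : signature) : Type := option (psym L).

Definition rar (L : signature) (C : rsym L) : nat :=
  if C is Some D then par D else 1.

Inductive term (L : signature) :=
| TVar of nat
| TCst of csym L.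
Arguments TVar {L}.

(* [FVEq n X Y] is the identity of two relation variables of arity [n.+1]. *)
Inductive formula (L : signature) :=
| FEq of term L & term L
| FVEq (n X Y : nat)
| FVar (n X : nat) of n.+1.-tuple (term L)
| FSym (C : rsym L) of (rar C).+1.-tuple (term L)
| FNot of formula L
| FAnd of formula L & formula L
| FEx (x : nat) of formula L
| SEx (n X : nat) of formula L.

Arguments FVEq {L}.
Arguments FSym {L}.
Arguments FVar {L n}.

Section Syntax.
Variable L : signature.
Implicit Types p q : formula L.

Definition FOr p q := FNot (FAnd (FNot p) (FNot q)).
Definition FImp p q := FNot (FAnd p (FNot q)).
Definition FIff p q := FAnd (FImp p q) (FImp q p).
Definition FAll x p := FNot (FEx x (FNot p)).
Definition SAll n X p := FNot (SEx n X (FNot p)).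
Definition FAlls (xs : seq nat) p := foldr FAll p xs.

Definition FVarx n X (xs : n.+1.-tuple nat) : formula L :=
  FVar X (map_tuple TVar xs).

Definition FLe (x y : nat) : formula L := FSym None [tuple TVar x; TVar y].

Definition tvars (t : term L) : seq nat := if t is TVar x then [:: x] else [::].
Definition tcsyms (t : term L) : seq (csym L) :=
  if t is TCst c then [:: c] else [::].

Fixpoint fiv p : seq nat :=
  match p with
  | FEq s t => tvars s ++ tvars t
  | FVEq _ _ _ => [::]
  | FVar _ _ ts => flatten [seq tvars t | t <- ts]
  | FSym _ ts => flatten [seq tvars t | t <- ts]
  | FNot p => fiv p
  | FAnd p q => fiv p ++ fiv q
  | FEx x p => [seq y <- fiv p | y != x]
  | SEx _ _ p => fiv p
  end.

Fixpoint frv p : seq (nat * nat) :=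
  match p with
  | FEq _ _ => [::]
  | FVEq n X Y => [:: (n, X); (n, Y)]
  | FVar n X _ => [:: (n, X)]
  | FSym _ _ => [::]
  | FNot p => frv p
  | FAnd p q => frv p ++ frv q
  | FEx _ p => frv p
  | SEx n X p => [seq Y <- frv p | Y != (n, X)]
  end.

Fixpoint csyms p : seq (csym L) :=
  match p with
  | FEq s t => tcsyms s ++ tcsyms t
  | FVEq _ _ _ => [::]
  | FVar _ _ ts => flatten [seq tcsyms t | t <- ts]
  | FSym _ ts => flatten [seq tcsyms t | t <- ts]
  | FNot p => csyms p
  | FAnd p q => csyms p ++ csyms q
  | FEx _ p => csyms p
  | SEx _ _ p => csyms p
  end.

Fixpoint psyms p : seq (psym L) :=
  match p with
  | FSym (Some C) _ => [:: C]
  | FNot p => psyms p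
  | FAnd p q => psyms p ++ psyms q
  | FEx _ p => psyms p
  | SEx _ _ p => psyms p
  | _ => [::]
  end.

Fixpoint first_order p : bool :=
  match p with
  | FNot p => first_order p
  | FAnd p q => first_order p && first_order q
  | FEx _ p => first_order p
  | SEx _ _ _ => false
  | _ => true
  end.

Fixpoint sigma11 p : bool :=
  if p is SEx _ _ q then sigma11 q else first_order p.

End Syntax.

(** ** Henkin models *)

Record henkin (L : signature) (A : Type) := Henkin {
  hdom : inhabited A;
  hrel : forall n, set (set (n.+1.-tuple A));
  hrel_neq0 : forall n, @hrel n !=set0;
  cI : csym L -> A;
  rI : forall C : rsym L, set ((rar C).+1.-tuple A)
}.

Arguments hrel {L A} M n : rename.
Arguments cI {L A} M c : rename.
Arguments rI {L A} M C : rename.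

Section Semantics.
Variables (L : signature) (A : Type) (M : henkin L A).

Definition teval (iv : nat -> A) (t : term L) : A :=
  match t with TVar x => iv x | TCst c => cI M c end.

Definition rupd (rv : forall n, nat -> set (n.+1.-tuple A)) n (X : nat)
    (S : set (n.+1.-tuple A)) : forall n, nat -> set (n.+1.-tuple A) :=
  @eqtype.dfwith _ (fun n => nat -> set (n.+1.-tuple A)) rv n
    (fun Y => if Y == X then S else rv n Y).

Fixpoint sat (iv : nat -> A) (rv : forall n, nat -> set (n.+1.-tuple A))
    (p : formula L) : Prop :=
  match p with
  | FEq s t => teval iv s = teval iv t
  | FVEq n X Y => rv n X = rv n Y
  | FVar n X ts => rv n X (map_tuple (teval iv) ts)
  | FSym C ts => rI M C (map_tuple (teval iv) ts)
  | FNot p => ~ sat iv rv p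
  | FAnd p q => sat iv rv p /\ sat iv rv q
  | FEx x p => exists a : A, sat (fun y => if y == x then a else iv y) rv p
  | SEx n X p => exists2 S, hrel M n S & sat iv (rupd rv X S) p
  end.

Definition rvalid (rv : forall n, nat -> set (n.+1.-tuple A)) : Prop :=
  forall n X, hrel M n (rv n X).

(* A formula with free variables is read as its universal closure; this is how
   the parameters of the axiom schemes are handled. *)
Definition holds (p : formula L) : Prop :=
  forall iv rv, rvalid rv -> sat iv rv p.

Definition models (T : set (formula L)) : Prop := forall p, T p -> holds p.

Definition standard : Prop := forall n, hrel M n = setT.

Definition hle (x y : A) : Prop := rI M None [tuple x; y].

Definition well_ordered : Prop :=
  wochoice.well_order (fun x y => `[< hle x y >]).

(* The i-th displayed variable of a generalized quantifier of type [n] is the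
   relation variable [(n i, i)]. *)
Definition satQ l (n : 'I_l -> nat) (Q : formula L)
    (R : forall i, set ((n i).+1.-tuple A)) : Prop :=
  forall iv rv, rvalid rv -> (forall i, rv (n i) i = R i) -> sat iv rv Q.

End Semantics.

Definition gen_quantifier (L : signature) l (n : 'I_l -> nat) (Q : formula L) :=
  fiv Q = [::] /\ {in frv Q, forall X, exists i : 'I_l, X = (n i, val i)}.

Definition entails (L : signature) (T : set (formula L)) (p : formula L) :=
  forall (A : Type) (M : henkin L A), models M T -> holds M p.

(* Substructure: the inclusion of the domains is an injection [f]; a relation
   over the small domain is identified with its image, which has no new tuple. *)
Definition substructure (L : signature) (A B : Type)
    (M : henkin L A) (N : henkin L B) (f : A -> B) : Prop :=
  [/\ injective f,
      forall n S, hrel M n S -> hrel N n (map_tuple f @` S),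
      forall c, cI N c = f (cI M c)
    & forall C ts, rI N C (map_tuple f ts) <-> rI M C ts].

Definition domain_independent (L : signature) (T : set (formula L))
    l (n : 'I_l -> nat) (Q : formula L) : Prop :=
  forall (A B : Type) (M : henkin L A) (N : henkin L B) (f : A -> B),
    models M T -> models N T -> substructure M N f ->
  forall R : (forall i, set ((n i).+1.-tuple A)),
    (forall i, hrel M (n i) (R i)) ->
    (satQ M Q R <-> satQ N Q (fun i => map_tuple f @` R i)).

(** ** Axioms *)

(* In the choice scheme the instance of [p] at R := R'[xs] = {ys | R' xs ys} is
   rendered by eliminating the abstract: there is R such that
   forall ys, (R ys <-> R' xs ys), and [p]. *)
Variant sigma11_ac0 (L : signature) : set (formula L) :=
| ExtAx n X Y (xs : n.+1.-tuple nat) of X != Y & uniq xs :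
    sigma11_ac0
      (SAll n X (SAll n Y
        (FImp (FAlls xs (FIff (FVarx L X xs) (FVarx L Y xs))) (FVEq n X Y))))
| CompAx n X (xs : n.+1.-tuple nat) p of
    uniq xs & first_order p & (n, X) \notin frv p :
    sigma11_ac0 (SEx n X (FAlls xs (FIff (FVarx L X xs) p)))
| ChoiceAx m n X X' (xs : m.+1.-tuple nat) (ys : n.+1.-tuple nat) p of
    uniq (xs ++ ys) & sigma11 p & (m + n.+1, X') \notin frv p :
    sigma11_ac0
      (FImp (FAlls xs (SEx n X p))
        (SEx (m + n.+1) X' (FAlls xs (SEx n X
          (FAnd
            (FAlls ys
              (FIff (FVarx L X ys) (@FVarx L (m + n.+1) X' (cat_tuple xs ys))))
            p))))).

Definition wo_axiom (L : signature) : formula L :=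
  let X x := FVarx L 0 [tuple x] in
  foldr (@FAnd L)
    (SAll 0 0 (FImp (FEx 0 (X 0))
                    (FEx 0 (FAnd (X 0) (FAll 1 (FImp (X 1) (FLe L 0 1)))))))
    [:: FAll 0 (FLe L 0 0);
        FAll 0 (FAll 1 (FImp (FAnd (FLe L 0 1) (FLe L 1 0))
                             (FEq (TVar 0) (TVar 1))));
        FAll 0 (FAll 1 (FAll 2 (FImp (FAnd (FLe L 0 1) (FLe L 1 2))
                                     (FLe L 0 2))));
        FAll 0 (FAll 1 (FOr (FLe L 0 1) (FLe L 1 0)))].

(** ** Borel sets of tuples of relations *)

Definition relspace (A : Type) l (n : 'I_l -> nat) : topologicalType :=
  prod_topology (fun i : 'I_l =>
    prod_topology (fun _ : (n i).+1.-tuple A => bool)).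

Definition borel (X : topologicalType) (E : set X) : Prop := <<s @open X >> E.

Definition quantifier_set (L : signature) (A : Type) (M : henkin L A)
    l (n : 'I_l -> nat) (Q : formula L) : set (relspace A n) :=
  [set u | satQ M Q (fun i => [set t | u i t])].
Arguments quantifier_set {L A} M {l} n Q.

(** ** NP

    Nondeterministic Turing machines with several two-way infinite tapes. *)

Variant move := MoveL | MoveN | MoveR.

Record ntm := Ntm {
  ntapes : nat;  (* work tapes, besides the input tape *)
  state : finType;
  aux : finType;
  start : state;
  accept : state;
  trans : state -> ntapes.+1.-tuple (option (bool + aux)) ->
          state -> ntapes.+1.-tuple (option (bool + aux)) ->
          ntapes.+1.-tuple move -> bool
}.

Section Machines.
Variable N : ntm.

(* [None] is the blank. *)
Definition symbol : Type := option (bool + aux N).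

(* The head scans the first symbol of the second component; the first component
   is what lies to its left, read from right to left. *)
Definition tape : Type := (seq symbol * seq symbol)%type.

Definition tread (t : tape) : symbol := head None t.2.

Definition twrite (a : symbol) (t : tape) : tape := (t.1, a :: behead t.2).

Definition tmove (d : move) (t : tape) : tape :=
  match d with
  | MoveL => (behead t.1, head None t.1 :: t.2)
  | MoveN => t
  | MoveR => (head None t.2 :: t.1, behead t.2)
  end.

Definition config : Type := (state N * (ntapes N).+1.-tuple tape)%type.

Definition step (c c' : config) : Prop :=
  exists (ws : (ntapes N).+1.-tuple symbol) (ms : (ntapes N).+1.-tuple move),
    trans c.1 (map_tuple tread c.2) c'.1 ws ms /\
    c'.2 = [tuple tmove (tnth ms i) (twrite (tnth ws i) (tnth c.2 i))
            | i < (ntapes N).+1].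

Fixpoint steps (t : nat) (c c' : config) : Prop :=
  if t is t'.+1 then exists2 c1, step c c1 & steps t' c1 c' else c = c'.

Definition init (w : seq bool) : config :=
  (start N,
   [tuple if i == ord0 then ([::], [seq Some (inl b) | b <- w]) else ([::], [::])
   | i < (ntapes N).+1]).

Definition accepts_within (b : nat) (w : seq bool) : Prop :=
  exists t (c : config), [/\ t <= b, steps t (init w) c & c.1 = accept N].

End Machines.

(* Only accepting runs are timed, as usual for nondeterministic time: a clock
   can always stop the other runs. *)
Definition inNP (P : set (seq bool)) : Prop :=
  exists (N : ntm) (c d : nat),
    forall w, P w <-> accepts_within N (c * size w ^ d + c) w.

Definition incoNP (P : set (seq bool)) : Prop := inNP (~` P).

(** ** Finite instances *)

(* The tuples over {0, ..., m} are listed in lexicographic order. *)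
Definition char_string m k (R : set (k.+1.-tuple 'I_m.+1)) : seq bool :=
  mkseq (fun j => `[< R [tuple inord ((j %/ m.+1 ^ (k - i)) %% m.+1)
                         | i < k.+1] >]) (m.+1 ^ k.+1).

(* [m] in unary, the relations, then the interpretations of the symbols of [Q]
   other than the order; a constant is encoded as a singleton. *)
Definition encode (L : signature) m (M : henkin L 'I_m.+1)
    l (n : 'I_l -> nat) (Q : formula L)
    (R : forall i, set ((n i).+1.-tuple 'I_m.+1)) : seq bool :=
  nseq m true ++ [:: false]
  ++ flatten [seq char_string (R i) | i <- enum 'I_l]
  ++ flatten [seq char_string (rI M (Some C)) | C <- undup (psyms Q)]
  ++ flatten [seq char_string [set t : 1.-tuple 'I_m.+1 | thead t = cI M c]
             | c <- undup (csyms Q)].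

Definition usual_order (L : signature) m (M : henkin L 'I_m.+1) : Prop :=
  forall x y, hle M x y <-> x <= y.

Definition membership_problem (L : signature) (T : set (formula L))
    l (n : 'I_l -> nat) (Q : formula L) : set (seq bool) :=
  [set w | exists m (M : henkin L 'I_m.+1)
             (R : forall i, set ((n i).+1.-tuple 'I_m.+1)),
     [/\ 1 <= m, standard M, usual_order M, models M T
       & satQ M Q R /\ w = encode M Q R]].

(* Main.v *)
(** Domain independence makes both [Q] and its negation equivalent over [T] to
    formulas whose second-order quantifiers are existential and occur positively.
    This is an interpolation argument: if [Q] had no such equivalent, a Henkin
    construction carried out simultaneously for two theories that no such formula
    separates would give models [M], [N] of [T] with the same domain, such that
    every relation of [M] is one of [N], and parameters satisfying [Q] in [M] but
    not in [N].  It is done first for finitely many axioms in finitely many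
    symbols; ultraproducts of such pairs give all of [T].

    On a countable domain such a formula defines an analytic set, as choice
    functions for its quantifiers are coded by points of the Baire space; hence
    [Q] is Borel by Lusin separation.  On [{0, ..., m}] a nondeterministic machine
    guesses the relations while it evaluates the formula; this puts [Q] and its
    negation in NP. *)

Require Import Defs.
From mathcomp Require Import all_boot.
From mathcomp Require Import all_classical.
From mathcomp Require Import topology measurable_structure.
From mathcomp Require Import zify.
From Stdlib Require List.

Set Implicit Arguments.
Unset Strict Implicit.
Unset Printing Implicit Defensive.

Local Open Scope classical_set_scope.

(** What shapes the interpolation is an asymmetry: the two models share all individuals, and every
    relation of the small model must occur in the large one, which may have relations of its own. So
    the two theories share all individual constants, while relation constants are of two kinds:
    shared ones, which witness second-order quantifiers on the small side, and private ones for the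
    large side. A separating formula mentions shared ones only. Removing a fresh shared witness
    costs the separator an existential second-order quantifier, removing a private one costs
    nothing, and universal second-order quantifiers never arise.

    Formulas are decided one at a time in countably many steps, whereas the signature and [T] are
    arbitrary; hence the detour through finite parts of [T]. Consequence is semantic throughout: a
    stage implies what holds in all its models.

    No prenex form is taken. Second-order quantifiers may stay below first-order ones, and both
    applications are inductions on the formula with a polarity bit. *)

Section Coincidence.
Variables (L : signature) (A : Type).

Lemma rupd_same (rv : forall n, nat -> set (n.+1.-tuple A)) n X S :
  @rupd A rv n X S n X = S.
Proof. by rewrite /rupd dfwith_in eqxx. Qed.

Lemma rupd_other (rv : forall n, nat -> set (n.+1.-tuple A)) n X S m Y :
  (m, Y) != (n, X) -> @rupd A rv n X S m Y = rv m Y.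
Proof.
rewrite /rupd; case: (eqVneq n m) => [<-|nm _].
  by rewrite dfwith_in xpair_eqE eqxx /= => /negbTE ->.
by rewrite dfwith_out.
Qed.

Lemma rupd_valid (M : henkin L A) rv n X S :
  rvalid M rv -> hrel M n S -> rvalid M (rupd rv X S).
Proof.
move=> rvM SM m Y; case: (eqVneq (m, Y) (n, X)) => [[-> ->]|mY].
  by rewrite rupd_same.
by rewrite rupd_other.
Qed.

Lemma standard_valid (M : henkin L A) rv : standard M -> rvalid M rv.
Proof. by move=> stM m X; rewrite stM. Qed.

Lemma teval_agree (M M' : henkin L A) iv iv' (t : term L) :
  {in tcsyms t, cI M =1 cI M'} -> {in tvars t, iv =1 iv'} -> teval M iv t = teval M' iv' t.
Proof. by case: t => [x|c] /= hc hx; [apply: hx|apply: hc]; rewrite inE. Qed.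

Lemma teval_agree_tuple (M M' : henkin L A) iv iv' n (ts : n.-tuple (term L)) :
  {in flatten [seq tcsyms t | t <- ts], cI M =1 cI M'} ->
  {in flatten [seq tvars t | t <- ts], iv =1 iv'} ->
  map_tuple (teval M iv) ts = map_tuple (teval M' iv') ts.
Proof.
case: ts => s hs /= hc hx; apply: val_inj => /=.
elim: s hc hx {hs} => //= t s IH hc hx; rewrite IH; first last.
- by move=> x xs; apply: hx; rewrite mem_cat xs orbT.
- by move=> c cs; apply: hc; rewrite mem_cat cs orbT.
by rewrite (@teval_agree M M' iv iv') // => y ys; [apply: hc|apply: hx]; rewrite mem_cat ys.
Qed.

(** Two models are compared because, at the end, two finite models that encode the same word must be
    seen to agree on [Q]. *)
Lemma sat_agree (M M' : henkin L A) (p : formula L) iv iv' rv rv' :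
  (forall n, hrel M n = hrel M' n) -> rI M None = rI M' None ->
  {in csyms p, cI M =1 cI M'} -> {in psyms p, forall C, rI M (Some C) = rI M' (Some C)} ->
  {in fiv p, iv =1 iv'} ->
  (forall n X, (n, X) \in frv p -> rv n X = rv' n X) ->
  sat M iv rv p <-> sat M' iv' rv' p.
Proof.
move=> hM oM.
elim: p iv iv' rv rv' => [s t|n X Y|n X ts|[C|] ts|p IH|p IHp q IHq|x p IH|n X p IH]
    iv iv' rv rv' hc hp hi hr /=.
- by rewrite !(@teval_agree M M' iv iv') // => x xs; [apply: hc|apply: hi|apply: hc|apply: hi];
    rewrite /= mem_cat xs ?orbT.
- by rewrite !hr // !inE eqxx ?orbT.
- by rewrite hr ?inE //= (@teval_agree_tuple M M' iv iv').
- by rewrite (@teval_agree_tuple M M' iv iv') // hp ?inE.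
- by rewrite (@teval_agree_tuple M M' iv iv') // oM.
- by rewrite (IH iv iv' rv rv').
- have -> : sat M iv rv p <-> sat M' iv' rv' p.
    by apply: IHp => [y yp|y yp|y yp|m Y mY]; [apply: hc|apply: hp|apply: hi|apply: hr];
      rewrite /= mem_cat ?yp ?mY.
  have -> // : sat M iv rv q <-> sat M' iv' rv' q.
  by apply: IHq => [y yp|y yp|y yp|m Y mY]; [apply: hc|apply: hp|apply: hi|apply: hr];
    rewrite /= mem_cat ?yp ?mY orbT.
- have E a : sat M (fun y => if y == x then a else iv y) rv p <->
             sat M' (fun y => if y == x then a else iv' y) rv' p.
    apply: IH => // y yp; case: eqVneq => // yx; apply: hi.
    by rewrite /= mem_filter yx.
  by split=> -[a /E ?]; exists a.
- have E (S : set (n.+1.-tuple A)) : sat M iv (rupd rv X S) p <-> sat M' iv' (rupd rv' X S) p.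
    apply: IH => // m Y mY; case: (eqVneq (m, Y) (n, X)) => [[-> ->]|ne].
      by rewrite !rupd_same.
    by rewrite !rupd_other // hr //= mem_filter ne.
  by rewrite hM; split=> -[S ? /E ?]; exists S.
Qed.

Lemma sat_ext (M : henkin L A) (p : formula L) iv iv' rv rv' :
  {in fiv p, iv =1 iv'} ->
  (forall n X, (n, X) \in frv p -> rv n X = rv' n X) ->
  sat M iv rv p <-> sat M iv' rv' p.
Proof. exact: sat_agree. Qed.


Lemma sat_FExs (M : henkin L A) rv p xs iv :
  (exists2 iv', {in predC (mem xs), iv' =1 iv} & sat M iv' rv p) ->
  sat M iv rv (foldr (@FEx L) p xs).
Proof.
elim: xs iv => [|x xs IH] iv [iv' h hp] /=.
  by apply: (sat_ext _ _ _).1 hp => // y _; apply: h.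
exists (iv' x); apply: IH; exists iv' => // y; rewrite inE /= => yxs.
by case: eqVneq => [-> //|yx]; apply: h; rewrite !inE (negbTE yx).
Qed.

End Coincidence.

(** * Interpolation *)

(* [sigma true] is the closure of the first-order formulas under conjunction,
   disjunction, first-order quantification and existential second-order
   quantification. *)
Fixpoint sigma (L : signature) (b : bool) (p : formula L) : bool :=
  match p with
  | FNot p => sigma (~~ b) p
  | FAnd p q => sigma b p && sigma b q
  | FEx _ p => sigma b p
  | SEx _ _ p => b && sigma b p
  | _ => true
  end.

(** * Inseparable pairs of theories *)

Section Items.
Variable L : signature.

(* The closed formula obtained from [p] by reading the individual variable [x]
   as the constant number [nth 0 e x] and the relation variable [(n, X)] as the
   constant number [look E n X] of its arity is represented by [(p, e, E)]:
   this avoids substitution. *)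
Definition item : Type := (formula L * seq nat * seq (nat * nat * nat))%type.

(** An unbound variable denotes constant 0, as does an individual variable beyond the end of the
    list. So 0 has to be shared, and fresh constants have to be positive. *)
Definition look (E : seq (nat * nat * nat)) (n X : nat) : nat :=
  head 0 [seq a.2 | a <- E & a.1 == (n, X)].

Definition neg (a : item) : item := (FNot a.1.1, a.1.2, a.2).

Definition itsat (A : Type) (M : henkin L A) (iv : nat -> A)
    (rv : forall n, nat -> set (n.+1.-tuple A)) (a : item) : Prop :=
  sat M (fun x => iv (nth 0 a.1.2 x)) (fun n X => rv n (look a.2 n X)) a.1.1.

Lemma look_cons n X c E m Y :
  look ((n, X, c) :: E) m Y = if (m, Y) == (n, X) then c else look E m Y.
Proof. by rewrite /look /= eq_sym; case: eqP. Qed.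

Lemma look_cons_rv A (rv : forall n, nat -> set (n.+1.-tuple A)) n X c E :
  (fun m Y => rv m (look ((n, X, c) :: E) m Y)) =
  rupd (fun m Y => rv m (look E m Y)) X (rv n c).
Proof.
apply: functional_extensionality_dep => m; apply/funext => Y.
rewrite look_cons; case: eqVneq => [[-> ->]|ne]; first by rewrite rupd_same.
by rewrite rupd_other.
Qed.

Lemma look_in E n X : look E n X = 0 \/ exists2 a, a \in E & a.2 = look E n X.
Proof.
elim: E => [|[[m Y] c] E IH]; first by left.
rewrite look_cons; case: ifP => _; first by right; exists (m, Y, c); rewrite ?mem_head.
by case: IH => [->|[a aE <-]]; [left|right; exists a; rewrite // inE aE orbT].
Qed.

Lemma set_nth_iv A (iv : nat -> A) e x c :
  (fun y => iv (nth 0 (set_nth 0 e x c) y)) =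
  (fun y => if y == x then iv c else iv (nth 0 e y)).
Proof. by apply/funext => y; rewrite nth_set_nth /=; case: ifP. Qed.

Lemma itsat_set A (M : henkin L A) iv rv p e E x c :
  itsat M iv rv (p, set_nth 0 e x c, E) =
  sat M (fun y => if y == x then iv c else iv (nth 0 e y))
    (fun n X => rv n (look E n X)) p.
Proof. by rewrite /itsat /= set_nth_iv. Qed.

Lemma itsat_look A (M : henkin L A) iv rv p e E n X c :
  itsat M iv rv (p, e, (n, X, c) :: E) =
  sat M (fun y => iv (nth 0 e y))
    (rupd (fun m Y => rv m (look E m Y)) X (rv n c)) p.
Proof. by rewrite /itsat /= look_cons_rv. Qed.

(** [okc] will be [isN] on the side of the small model and [predT] on the side of the large one. *)
Definition wit (okc : nat -> bool) (a : item) (G : set item) : Prop :=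
  match a with
  | (FEx x p, e, E) => exists c, G (p, set_nth 0 e x c, E)
  | (SEx n X p, e, E) => exists2 c, okc c & G (p, e, (n, X, c) :: E)
  | _ => True
  end.

Definition decided okc (a : item) (G : set item) : Prop :=
  G (neg a) \/ (G a /\ wit okc a G).

Definition okit (okc : nat -> bool) (a : item) : bool := all (fun x => okc x.2) a.2.

Definition bnd (B : nat) (a : item) : bool :=
  all (fun x => x < B) a.1.2 && all (fun x => x.2 < B) a.2.

Variable T : set (formula L).

Definition model_of (G : set item) (A : Type) (M : henkin L A) iv rv : Prop :=
  [/\ models M T, rvalid M rv & forall a, G a -> itsat M iv rv a].

Variable isN : nat -> bool.
Hypothesis isN_unbounded : forall B, exists2 c, B <= c & isN c.
Hypothesis notN_unbounded : forall B, exists2 c, B <= c & ~~ isN c.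

(** In a separator the variables stand for the constants of the same number. Individual variables
    are unrestricted, as all individual constants are shared. *)
Definition shared (p : formula L) : bool :=
  sigma true p && all (fun Y => isN Y.2) (frv p).

Definition separates (G D : set item) (p : formula L) : Prop :=
  (forall A (M : henkin L A) iv rv, model_of G M iv rv -> sat M iv rv p) /\
  (forall A (M : henkin L A) iv rv, model_of D M iv rv -> ~ sat M iv rv p).

Definition inseparable (G D : set item) : Prop :=
  ~ exists2 p, shared p & separates G D p.

Lemma model_ofU G a A (M : henkin L A) iv rv :
  model_of (G `|` [set a]) M iv rv <-> model_of G M iv rv /\ itsat M iv rv a.
Proof.
split=> [[h1 h2 h3]|[[h1 h2 h3] h4]].
  by split; [split=> // b Gb; apply: h3; left|apply: h3; right].
by split=> // b [/h3 //|->].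
Qed.

Lemma itsat_neg A (M : henkin L A) iv rv a :
  itsat M iv rv (neg a) <-> ~ itsat M iv rv a.
Proof. by []. Qed.

(** If both extensions were separable from [D], the disjunction of the two separators would separate
    [G] from [D]. On the other side the conjunction does this. *)
Lemma decide_l G D a : inseparable G D ->
  inseparable (G `|` [set a]) D \/ inseparable (G `|` [set neg a]) D.
Proof.
move=> GD; apply: contrapT => /not_orP[/contrapT[p shp [p1 p2]] /contrapT[q shq [q1 q2]]].
apply: GD; exists (FOr p q).
  by move: shp shq; rewrite /shared /= all_cat => /andP[-> ->] /andP[-> ->].
split=> A M iv rv h.
  move=> /= [np nq]; apply: nq; apply: q1; apply/model_ofU; split=> //.
  by apply/itsat_neg => ha; apply: np; apply: p1; apply/model_ofU.
by move=> /= /not_andP[/contrapT|/contrapT]; [apply: p2|apply: q2].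
Qed.

Lemma decide_r G D a : inseparable G D ->
  inseparable G (D `|` [set a]) \/ inseparable G (D `|` [set neg a]).
Proof.
move=> GD; apply: contrapT => /not_orP[/contrapT[p shp [p1 p2]] /contrapT[q shq [q1 q2]]].
apply: GD; exists (FAnd p q).
  by move: shp shq; rewrite /shared /= all_cat => /andP[-> ->] /andP[-> ->].
split=> A M iv rv h; first by split; [apply: p1|apply: q1].
move=> /= [hp hq]; case: (EM (itsat M iv rv a)) => ha.
  by apply: p2 hp; apply/model_ofU.
by apply: q2 hq; apply/model_ofU; split=> //; apply/itsat_neg.
Qed.

Definition below (B : nat) (G : set item) : Prop := forall a, G a -> bnd B a.

Lemma itsat_fresh_iv B a A (M : henkin L A) iv iv' rv : 0 < B -> bnd B a ->
  (forall x, x < B -> iv x = iv' x) -> itsat M iv rv a -> itsat M iv' rv a.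
Proof.
move=> B0 /andP[/allP aB _] h; rewrite /itsat.
suff -> : (fun x => iv (nth 0 a.1.2 x)) = (fun x => iv' (nth 0 a.1.2 x)) by [].
apply/funext => x; apply: h; case: (ltnP x (size a.1.2)) => xs.
  by apply: aB; apply: mem_nth.
by rewrite nth_default.
Qed.

Lemma itsat_fresh_rv B a A (M : henkin L A) iv rv rv' : 0 < B -> bnd B a ->
  (forall n X, X < B -> rv n X = rv' n X) -> itsat M iv rv a -> itsat M iv rv' a.
Proof.
move=> B0 /andP[_ /allP aB] h; rewrite /itsat.
suff -> : (fun n X => rv n (look a.2 n X)) = (fun n X => rv' n (look a.2 n X)) by [].
apply: functional_extensionality_dep => n; apply/funext => X; apply: h.
by case: (look_in a.2 n X) => [-> //|[b ba <-]]; apply: aB.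
Qed.

Lemma model_of_fresh_iv B G A (M : henkin L A) iv rv c x : 0 < B -> below B G -> B <= c ->
  model_of G M iv rv -> model_of G M (fun y => if y == c then x else iv y) rv.
Proof.
move=> B0 GB Bc [h1 h2 h3]; split=> // a Ga.
apply: (itsat_fresh_iv B0 (GB _ Ga)) (h3 _ Ga) => y yB.
by rewrite ltn_eqF // (leq_trans yB).
Qed.

Lemma model_of_fresh_rv B G A (M : henkin L A) iv rv n c S : 0 < B -> below B G -> B <= c ->
  hrel M n S -> model_of G M iv rv -> model_of G M iv (rupd rv c S).
Proof.
move=> B0 GB Bc SM [h1 h2 h3]; split=> //; first exact: rupd_valid.
move=> a Ga; apply: (itsat_fresh_rv B0 (GB _ Ga)) (h3 _ Ga) => m y yB.
by rewrite rupd_other // xpair_eqE (ltn_eqF (leq_trans yB Bc)) andbF.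
Qed.

(** A separator of the extended pair may mention the witness. Quantified existentially over it, the
    separator still follows from [G] and is still refuted by [D], because the constant is fresh for
    both. *)
Lemma witness_l B G D a : 0 < B -> below B G -> below B D -> okit isN a ->
  inseparable G D -> G a ->
  exists2 G', inseparable G' D /\ G `<=` G' &
    [/\ exists B', below B' G', forall b, G' b -> G b \/ okit isN b & wit isN a G'].
Proof.
move=> B0 GB DB; case: a => [[[s t|n X Y|n X ts|C ts|p|p q|x p|n X p] e] E] /= okE GD Ga;
  try by exists G; split=> //; [exists B|left].
- set a := (p, set_nth 0 e x B, E).
  exists (G `|` [set a]); first split.
  + move=> [q shq [q1 q2]]; apply: GD; exists (FEx B q); first exact: shq.
    split=> A M iv rv h /=.
      have /= [v hv] : itsat M iv rv (FEx x p, e, E) by case: h => _ _; apply.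
      exists v; apply: q1; apply/model_ofU; split.
        by apply: (model_of_fresh_iv (B := B)).
      rewrite itsat_set eqxx.
      apply: (sat_ext _ _ _).1 hv => // y _; case: eqVneq => //= _.
      (* No other variable is read as the constant [B]: listed constants are below [B], and the
         default 0 differs from it. *)
      case: eqVneq => // E2; have := GB _ Ga => /andP[/allP /= eB _].
      case: (ltnP y (size e)) => ys; last by move: E2 B0; rewrite nth_default // => <-.
      by have := eB _ (mem_nth 0 ys); rewrite E2 ltnn.
    by move=> [v]; apply: q2; apply: (model_of_fresh_iv (B := B)).
  + by left.
  split; last by exists B; right.
    exists B.+1 => b [Gb|->].
      have /andP[h1 h2] := GB _ Gb.
      by apply/andP; split; [apply: sub_all h1|apply: sub_all h2] => y /ltnW.
    have /andP[/= h1 h2] := GB _ Ga.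
    apply/andP; split => /=; last by apply: sub_all h2 => y /ltnW.
    apply/(all_nthP 0) => i _; rewrite nth_set_nth /=; case: eqP => // _.
    case: (ltnP i (size e)) => ie; last by rewrite nth_default.
    by rewrite ltnS ltnW //; move/(all_nthP 0): h1; apply.
  by move=> b [Gb|->]; [left|right].
- have [c Bc Nc] := isN_unbounded B.
  set a := (p, e, (n, X, c) :: E).
  exists (G `|` [set a]); first split.
  + move=> [q shq [q1 q2]]; apply: GD; exists (SEx n c q).
      move: shq; rewrite /shared /= => /andP[-> /allP h]; apply/allP => y.
      by rewrite mem_filter => /andP[_ /h].
    split=> A M iv rv h /=.
      have /= [S SM hS] : itsat M iv rv (SEx n X p, e, E) by case: h => _ _; apply.
      exists S => //; apply: q1; apply/model_ofU; split.
        by apply: (model_of_fresh_rv (B := B)).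
      rewrite itsat_look rupd_same.
      apply: (sat_ext _ _ _).1 hS => // m Y _.
      case: (eqVneq (m, Y) (n, X)) => [[-> ->]|mY]; first by rewrite !rupd_same.
      rewrite !(rupd_other _ _ mY) rupd_other // xpair_eqE negb_and.
      case: eqVneq => //= _; have := GB _ Ga => /andP[_ /allP /= eB].
      case: (look_in E m Y) => [->|[b bE <-]].
        by rewrite (ltn_eqF (leq_trans B0 Bc)).
      by rewrite (ltn_eqF (leq_trans (eB _ bE) Bc)).
    by move=> [S SM]; apply: q2; apply: (model_of_fresh_rv (B := B)).
  + by left.
  split; last by exists c; [|right].
    exists c.+1 => b [Gb|->].
      have /andP[h1 h2] := GB _ Gb.
      by apply/andP; split; [apply: sub_all h1|apply: sub_all h2] => y yB;
        rewrite ltnS ltnW // (leq_trans yB).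
    have /andP[/= h1 h2] := GB _ Ga.
    by apply/andP; split => /=; rewrite ?leqnn; [apply: sub_all h1|apply: sub_all h2] => y yB;
        rewrite ltnS ltnW // (leq_trans yB).
  by move=> b [Gb|->]; [left|right; rewrite /okit /= Nc].
Qed.

(** For an individual witness the separator is quantified universally, which stays in [sigma true].
    A relation witness is a private constant, which the separator cannot mention, so the same
    separator works. *)
Lemma witness_r B G D a : 0 < B -> below B G -> below B D ->
  inseparable G D -> D a ->
  exists2 D', inseparable G D' /\ D `<=` D' & (exists B', below B' D') /\ wit predT a D'.
Proof.
move=> B0 GB DB; case: a => [[[s t|n X Y|n X ts|C ts|p|p q|x p|n X p] e] E] /= GD Da;
  try by exists D; split=> //; exists B.
- set a := (p, set_nth 0 e x B, E).
  exists (D `|` [set a]); first split.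
  + move=> [q shq [q1 q2]]; apply: GD; exists (FAll B q); first exact: shq.
    split=> A M iv rv h /=.
      by move=> [v]; apply; apply: q1; apply: (model_of_fresh_iv (B := B)).
    apply; have /= [v hv] : itsat M iv rv (FEx x p, e, E) by case: h => _ _; apply.
    exists v; apply: q2; apply/model_ofU; split.
      by apply: (model_of_fresh_iv (B := B)).
    rewrite itsat_set eqxx.
    apply: (sat_ext _ _ _).1 hv => // y _; case: eqVneq => //= _.
    case: eqVneq => // E2; have := DB _ Da => /andP[/allP /= eB _].
    case: (ltnP y (size e)) => ys; last by move: E2 B0; rewrite nth_default // => <-.
    by have := eB _ (mem_nth 0 ys); rewrite E2 ltnn.
  + by left.
  split; last by exists B; right.
  exists B.+1 => b [Gb|->].
    have /andP[h1 h2] := DB _ Gb.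
    by apply/andP; split; [apply: sub_all h1|apply: sub_all h2] => y /ltnW.
  have /andP[/= h1 h2] := DB _ Da.
  apply/andP; split => /=; last by apply: sub_all h2 => y /ltnW.
  apply/(all_nthP 0) => i _; rewrite nth_set_nth /=; case: eqP => // _.
  case: (ltnP i (size e)) => ie; last by rewrite nth_default.
  by rewrite ltnS ltnW //; move/(all_nthP 0): h1; apply.
- have [c Bc Nc] := notN_unbounded B.
  set a := (p, e, (n, X, c) :: E).
  exists (D `|` [set a]); first split.
  + move=> [q shq [q1 q2]]; apply: GD; exists q => //.
    split=> // A M iv rv h hq.
    have /= [S SM hS] : itsat M iv rv (SEx n X p, e, E) by case: h => _ _; apply.
    apply: (q2 A M iv (rupd rv c S)); last first.
      apply: (sat_ext _ _ _).1 hq => // m Y mY; rewrite rupd_other //.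
      by apply: contraNneq Nc => -[_ <-]; case/andP: shq => _ /allP /(_ _ mY).
    apply/model_ofU; split; first by apply: (model_of_fresh_rv (B := B)).
    rewrite itsat_look rupd_same.
    apply: (sat_ext _ _ _).1 hS => // m Y _.
    case: (eqVneq (m, Y) (n, X)) => [[-> ->]|mY]; first by rewrite !rupd_same.
    rewrite !(rupd_other _ _ mY) rupd_other // xpair_eqE negb_and.
    case: eqVneq => //= _; have := DB _ Da => /andP[_ /allP /= eB].
    case: (look_in E m Y) => [->|[b bE <-]].
      by rewrite (ltn_eqF (leq_trans B0 Bc)).
    by rewrite (ltn_eqF (leq_trans (eB _ bE) Bc)).
  + by left.
  split; last by exists c; [|right].
  exists c.+1 => b [Gb|->].
    have /andP[h1 h2] := DB _ Gb.
    by apply/andP; split; [apply: sub_all h1|apply: sub_all h2] => y yB;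
      rewrite ltnS ltnW // (leq_trans yB).
  have /andP[/= h1 h2] := DB _ Da.
  by apply/andP; split => /=; rewrite ?leqnn; [apply: sub_all h1|apply: sub_all h2] => y yB;
      rewrite ltnS ltnW // (leq_trans yB).
Qed.

End Items.

(** * Saturation of an inseparable pair *)

Section Construction.
Variables (L : signature) (T : set (formula L)) (isN : nat -> bool).
Hypothesis isN0 : isN 0.
Hypothesis isN_unbounded : forall B, exists2 c, B <= c & isN c.
Hypothesis notN_unbounded : forall B, exists2 c, B <= c & ~~ isN c.

(** The common bound leaves fresh constants at every stage. *)
Definition good (s : set (item L) * set (item L)) : Prop :=
  [/\ inseparable T isN s.1 s.2, forall a, s.1 a -> okit isN a &
      exists2 B, 0 < B & below B s.1 /\ below B s.2].

Definition task : Type := (bool * item L)%type.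

Definition handled (t : task) (s : set (item L) * set (item L)) : Prop :=
  if t.1 then okit isN t.2 -> decided isN t.2 s.1 else decided predT t.2 s.2.

Lemma belowU (B : nat) G (a : item L) : below B G ->
  exists2 B', B <= B' & below B' (G `|` [set a]).
Proof.
move=> GB; set m := (\max_(x <- a.1.2) x + \max_(x <- a.2) x.2).+1.
have le1 x : x \in a.1.2 -> x <= \max_(x <- a.1.2) x.
  by move=> xa; apply: (leq_bigmax_seq (F := id)).
have le2 x : x \in a.2 -> x.2 <= \max_(x <- a.2) x.2.
  by move=> xa; apply: (leq_bigmax_seq (F := fun x => x.2)).
exists (B + m); first exact: leq_addr.
move=> b [/GB /andP[h1 h2]|->].
  by apply/andP; split; [apply: sub_all h1|apply: sub_all h2] => y yB;
    rewrite (leq_trans yB) // leq_addr.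
apply/andP; split; apply/allP => x xa; rewrite addnS ltnS.
  by rewrite (leq_trans (le1 _ xa)) // addnCA leq_addr.
by rewrite (leq_trans (le2 _ xa)) // addnA leq_addl.
Qed.

Lemma below_le B B' (G : set (item L)) : B <= B' -> below B G -> below B' G.
Proof.
move=> BB GB a /GB /andP[h1 h2].
by apply/andP; split; [apply: sub_all h1|apply: sub_all h2] => y yB; apply: leq_trans BB.
Qed.

Lemma step_exists s (t : task) : good s ->
  exists2 s', good s' & [/\ s.1 `<=` s'.1, s.2 `<=` s'.2 & handled t s'].
Proof.
case: s => G D [/= GD okG [B B0 [GB DB]]]; case: t => -[] a.
- case okA : (okit isN a); last by exists (G, D); split=> //=; [exists B|rewrite /handled /= okA].
  have [B1 BB1 GB1] := belowU a GB.
  case: (decide_l a GD) => ins.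
    have okG' b : (G `|` [set a]) b -> okit isN b by move=> [/okG|->].
    have [G' [ins' GG'] [[B' GB'] ok' w]] :=
      witness_l isN_unbounded (leq_trans B0 BB1) GB1 (below_le BB1 DB) okA ins (or_intror erefl).
    exists (G', D); split=> //=.
    + by move=> b /ok' [/okG'|].
    + exists (B + B'); first by rewrite ltn_addr.
      by split; [apply: below_le GB'; rewrite leq_addl|apply: below_le DB; rewrite leq_addr].
    + by move=> b Gb; apply: GG'; left.
    + by move=> _; right; split=> //=; apply: GG'; right.
  have [B2 BB2 GB2] := belowU (neg a) GB.
  exists (G `|` [set neg a], D); split=> //=.
  + by move=> b [/okG|->].
  + by exists B2; [apply: leq_trans BB2|split=> //; apply: below_le DB].
  + by move=> _; left; right.
- have [B1 BB1 DB1] := belowU a DB.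
  case: (decide_r a GD) => ins.
    have [D' [ins' DD'] [[B' DB'] w]] :=
      witness_r notN_unbounded (leq_trans B0 BB1) (below_le BB1 GB) DB1 ins (or_intror erefl).
    exists (G, D'); split=> //=.
    + exists (B + B'); first by rewrite ltn_addr.
      by split; [apply: below_le GB; rewrite leq_addr|apply: below_le DB'; rewrite leq_addl].
    + by move=> b Gb; apply: DD'; left.
    + by right; split=> //=; apply: DD'; right.
  have [B2 BB2 DB2] := belowU (neg a) DB.
  exists (G, D `|` [set neg a]); split=> //=.
  + by exists B2; [apply: leq_trans BB2|split=> //; apply: below_le GB].
  + by left; right.
Qed.

Lemma saturate (tk : nat -> task) s0 : good s0 ->
  exists s : nat -> set (item L) * set (item L), s 0 = s0 /\
    forall k, [/\ good (s k), (s k).1 `<=` (s k.+1).1,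
      (s k).2 `<=` (s k.+1).2 & handled (tk k) (s k.+1)].
Proof.
move=> g0; pose S := {s : set (item L) * set (item L) | good s}.
have /choice[f hf] : forall x : S * task, exists y : S,
    [/\ (sval x.1).1 `<=` (sval y).1, (sval x.1).2 `<=` (sval y).2 & handled x.2 (sval y)].
  by move=> [[s gs] t]; have [s' gs' h] := step_exists t gs; exists (exist _ s' gs').
pose st := fix st k : S := if k is k'.+1 then f (st k', tk k') else exist _ s0 g0.
exists (fun k => sval (st k)); split=> // k.
by have [h1 h2 h3] := hf (st k, tk k); split=> //; apply: (svalP (st k)).
Qed.

(** Inseparability contains consistency: if the left side had no model, a contradiction would
    separate; if the right side had none, a tautology would. *)
Lemma good_sat_l s : good s ->
  exists A (M : henkin L A) iv rv, model_of T s.1 M iv rv.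
Proof.
move=> [ins _ _]; apply: contrapT => h; apply: ins.
exists (FNot (FEq (TVar 0) (TVar 0))) => //; split=> A M iv rv hm; last by move=> /=.
by exfalso; apply: h; exists A, M, iv, rv.
Qed.

Lemma good_sat_r s : good s ->
  exists A (M : henkin L A) iv rv, model_of T s.2 M iv rv.
Proof.
move=> [ins _ _]; apply: contrapT => h; apply: ins.
exists (FEq (TVar 0) (TVar 0)) => //; split=> A M iv rv hm //.
by exfalso; apply: h; exists A, M, iv, rv.
Qed.

Lemma good_agree s p : good s -> shared isN p ->
  (forall A (M : henkin L A) iv rv, model_of T s.1 M iv rv -> sat M iv rv p) ->
  exists A (M : henkin L A) iv rv, model_of T s.2 M iv rv /\ sat M iv rv p.
Proof.
move=> [ins _ _] sp h; apply: contrapT => h'; apply: ins; exists p => //.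
by split=> // A M iv rv hm hp; apply: h'; exists A, M, iv, rv.
Qed.

End Construction.

(** * Term models *)

Definition idt (L : signature) n : n.+1.-tuple (term L) :=
  map_tuple (@TVar L) (iota_tuple n.+1 0).

Lemma idt_map (L : signature) B (f : term L -> B) n :
  val (map_tuple f (idt L n)) = [seq f (TVar i) | i <- iota 0 n.+1].
Proof. exact: (esym (map_comp f (@TVar L) (iota 0 n.+1))). Qed.

(** Existentially quantified, this says that two relations are not coextensive. Witnesses for it
    make identity of relations in the term model the identity of sets. *)
Definition differ (L : signature) n : formula L :=
  FNot (FIff (FVar 0 (idt L n)) (FVar 1 (idt L n))).

(** What the truth lemma needs beyond subformulas: identity of individuals, a tuple on which
    distinct relations differ, a name for each constant symbol and one generic atom for each
    relation symbol. *)
Record fragment (L : signature) (F : set (formula L)) : Prop := Fragment {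
  fr_not : forall p, F (FNot p) -> F p;
  fr_and : forall p q, F (FAnd p q) -> F p /\ F q;
  fr_ex : forall x p, F (FEx x p) -> F p;
  fr_sex : forall n X p, F (SEx n X p) -> F p;
  fr_eq : F (FEq (TVar 0) (TVar 1));
  fr_differ : forall n, F (foldr (@FEx L) (differ L n) (iota 0 n.+1));
  fr_csym : forall p c, F p -> c \in csyms p -> F (FEx 0 (FEq (TVar 0) (TCst c)));
  fr_sym : forall C ts, F (FSym C ts) -> F (FSym C (idt L (rar C)))
}.

Section TermModel.
Variables (L : signature) (T F : set (formula L)).
Hypothesis frF : fragment F.

Variables (eqc : nat -> nat -> Prop) (kc : csym L -> nat)
  (RC : forall C : rsym L, set ((rar C).+1.-tuple nat)).

(** The identification of constants and the interpretations of the symbols are parameters, not read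
    off from the theory [G], so that the models of the two sides have literally the same domain and
    the same symbols. *)
Definition tdom : Type := {S : set nat | exists c, S = eqc c}.
Definition cls (c : nat) : tdom := exist _ (eqc c) (ex_intro _ c erefl).
Definition crepr (a : tdom) : nat := projT1 (cid (svalP a)).

Lemma creprK a : cls (crepr a) = a.
Proof.
rewrite /crepr; case: (cid _) => c /= h; case: a h => S hS /= h.
by apply: eq_exist.
Qed.

Variables (okc : nat -> bool) (G : nat -> set (item L)).
Hypothesis okc0 : okc 0.

Definition holdsG (a : item L) : Prop := exists k, G k a.

Definition trel n (X : nat) : set (n.+1.-tuple tdom) :=
  [set t | holdsG (FVar 0 (idt L n), map crepr t, [:: (n, 0, X)])].

Lemma trel_neq0 n : [set S | exists2 X, okc X & S = @trel n X] !=set0.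
Proof. by exists (@trel n 0), 0. Qed.

Definition tmodel : henkin L tdom :=
  Henkin (inhabits (cls 0)) trel_neq0 (fun c => cls (kc c))
    (fun C => [set t | RC (map_tuple crepr t)]).

Hypothesis G_mono : forall k, G k `<=` G k.+1.
Hypothesis G_sat : forall k,
  exists A (M : henkin L A) iv rv, model_of T (G k) M iv rv.
Hypothesis G_dec : forall a, okit okc a -> F a.1.1 -> exists k, decided okc a (G k).
Hypothesis eqcE : forall c d, eqc c d <-> holdsG (FEq (TVar 0) (TVar 1), [:: c; d], [::]).
Hypothesis kcE : forall c, F (FEx 0 (FEq (TVar 0) (TCst c))) ->
  holdsG (FEq (TVar 0) (TCst c), [:: kc c], [::]).
Hypothesis RCE : forall C (t : (rar C).+1.-tuple nat), F (FSym C (idt L (rar C))) ->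
  (RC t <-> holdsG (FSym C (idt L (rar C)), val t, [::])).

Lemma G_le j k : j <= k -> G j `<=` G k.
Proof.
move=> /subnK <-; elim: (k - j) => [|i IH] a ha //; rewrite addSn.
by apply: G_mono; apply: IH.
Qed.

Lemma model_le j k A (M : henkin L A) iv rv :
  j <= k -> model_of T (G k) M iv rv -> model_of T (G j) M iv rv.
Proof. by move=> jk [h1 h2 h3]; split=> // a /(G_le jk) /h3. Qed.

(** This takes the place of provability from a stage over [T]; consistency is the existence of a
    model of each stage. *)
Definition consq (P : forall A, henkin L A -> (nat -> A) ->
    (forall n, nat -> set (n.+1.-tuple A)) -> Prop) : Prop :=
  exists k, forall A (M : henkin L A) iv rv, model_of T (G k) M iv rv -> P A M iv rv.

Lemma consq_and P Q : consq P -> consq Q ->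
  consq (fun A M iv rv => P A M iv rv /\ Q A M iv rv).
Proof.
move=> [j hj] [k hk]; exists (maxn j k) => A M iv rv h; split.
  by apply: hj; apply: model_le h; apply: leq_maxl.
by apply: hk; apply: model_le h; apply: leq_maxr.
Qed.

Lemma consq_imp (P Q : forall A, henkin L A -> (nat -> A) ->
    (forall n, nat -> set (n.+1.-tuple A)) -> Prop) :
  (forall A M iv rv, models M T -> rvalid M rv -> P A M iv rv -> Q A M iv rv) ->
  consq P -> consq Q.
Proof. by move=> PQ [k hk]; exists k => A M iv rv h; case: (h) => *; apply: PQ => //; apply: hk. Qed.

Lemma consq_false : ~ consq (fun A M iv rv => False).
Proof. by move=> [k hk]; have [A [M [iv [rv /hk]]]] := G_sat k. Qed.

Lemma holds_consq a : holdsG a -> consq (fun A M iv rv => itsat M iv rv a).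
Proof. by move=> [k Ga]; exists k => A M iv rv [_ _]; apply. Qed.

(** The item has been decided; if its negation had been added, some late stage would have no
    model. *)
Lemma consq_holds a : okit okc a -> F a.1.1 ->
  consq (fun A M iv rv => itsat M iv rv a) -> holdsG a.
Proof.
move=> oka Fa h; have [k [ka|[ka _]]] := G_dec oka Fa; last by exists k.
have h' : consq (fun A M iv rv => itsat M iv rv (neg a)) by apply: holds_consq; exists k.
exfalso; apply: consq_false; apply: consq_imp (consq_and h h') => A M iv rv _ _.
by case=> ? ?.
Qed.

Lemma holds_imp a b : okit okc b -> F b.1.1 ->
  consq (fun A M iv rv => itsat M iv rv a -> itsat M iv rv b) -> holdsG a -> holdsG b.
Proof.
move=> okb Fb h /holds_consq ha; apply: consq_holds => //.
by apply: consq_imp (consq_and h ha) => A M iv rv _ _ [] h1 /h1.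
Qed.

Lemma holds_equiv a b : okit okc a -> okit okc b -> F a.1.1 -> F b.1.1 ->
  consq (fun A M iv rv => itsat M iv rv a <-> itsat M iv rv b) -> holdsG a <-> holdsG b.
Proof.
move=> oka okb Fa Fb h; split; apply: holds_imp => //;
  by apply: consq_imp h => A M iv rv _ _ [].
Qed.

Lemma holds_neg a : okit okc a -> F a.1.1 -> holdsG (neg a) <-> ~ holdsG a.
Proof.
move=> oka Fa; split.
  move=> /holds_consq h1 /holds_consq h2; apply: consq_false.
  by apply: consq_imp (consq_and h1 h2) => A M iv rv _ _ [].
by move=> na; have [k [ka|[ka _]]] := G_dec oka Fa; [exists k|case: na; exists k].
Qed.

Lemma holds_wit a : okit okc a -> F a.1.1 -> holdsG a -> exists k, wit okc a (G k).
Proof.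
move=> oka Fa ha; have [k [ka|[_ w]]] := G_dec oka Fa; last by exists k.
by exfalso; move: ha; apply/(holds_neg oka Fa); exists k.
Qed.

Lemma eqc_consq c d : eqc c d -> consq (fun A M iv rv => iv c = iv d).
Proof. by move=> /eqcE /holds_consq; apply: consq_imp. Qed.

Lemma consq_eqc c d : consq (fun A M iv rv => iv c = iv d) -> eqc c d.
Proof. by move=> h; apply/eqcE; apply: consq_holds => //; apply: fr_eq frF. Qed.

Lemma consq_true (P : forall A, henkin L A -> (nat -> A) ->
    (forall n, nat -> set (n.+1.-tuple A)) -> Prop) :
  (forall A M iv rv, P A M iv rv) -> consq P.
Proof. by move=> h; exists 0. Qed.

Lemma cls_eq c d : cls c = cls d <-> eqc c d.
Proof.
split=> [[h]|h].
  by rewrite h; apply: consq_eqc; apply: consq_true.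
apply: eq_exist; apply/funext => x; apply/propext; split=> hx; apply: consq_eqc.
  by apply: consq_imp (consq_and (eqc_consq h) (eqc_consq hx)) => A M iv rv _ _ [<- <-].
by apply: consq_imp (consq_and (eqc_consq h) (eqc_consq hx)) => A M iv rv _ _ [-> <-].
Qed.

Lemma crepr_consq cs : consq (fun A M iv rv => map iv [seq crepr (cls c) | c <- cs] = map iv cs).
Proof.
elim: cs => [|c cs IH]; first exact: consq_true.
have /cls_eq /eqc_consq h : cls (crepr (cls c)) = cls c by rewrite creprK.
by apply: consq_imp (consq_and h IH) => A M iv rv _ _ [] /= -> ->.
Qed.

Definition tval (e : seq nat) (t : term L) : nat :=
  match t with TVar x => nth 0 e x | TCst c => kc c end.

Lemma teval_tmodel e t : teval tmodel (fun x => cls (nth 0 e x)) t = cls (tval e t).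
Proof. by case: t. Qed.

Lemma tval_consq e (ts : seq (term L)) :
  (forall c, c \in flatten [seq tcsyms t | t <- ts] -> F (FEx 0 (FEq (TVar 0) (TCst c)))) ->
  consq (fun A M iv rv =>
    map (teval M (fun x => iv (nth 0 e x))) ts = map iv (map (tval e) ts)).
Proof.
elim: ts => [|t ts IH] h; first exact: consq_true.
have {}IH := IH (fun c hc => h c (eq_ind_r (fun b : bool => b) (introT orP (or_intror hc)) (mem_cat _ _ _))).
have h1 : consq (fun A M iv rv => teval M (fun x => iv (nth 0 e x)) t = iv (tval e t)).
  case: t h => [x|c] h /=; first exact: consq_true.
  have /kcE /holds_consq : F (FEx 0 (FEq (TVar 0) (TCst c))) by apply: h; rewrite mem_head.
  by apply: consq_imp.
by apply: consq_imp (consq_and h1 IH) => A M iv rv _ _ [] /= -> ->.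
Qed.

Lemma idtE A (M : henkin L A) (iv : nat -> A) n (cs : n.+1.-tuple nat) :
  map_tuple (teval M (fun x => iv (nth 0 cs x))) (idt L n) = map_tuple iv cs.
Proof.
apply: val_inj; rewrite idt_map -[RHS](mkseq_nth (iv 0)) size_tuple /mkseq.
by apply/eq_in_map => i; rewrite mem_iota => hi; rewrite (nth_map 0) ?size_tuple.
Qed.

Lemma fr_differ_sub n : F (differ L n).
Proof.
have := fr_differ frF n; elim: (iota 0 n.+1) => //= x xs IH /(fr_ex frF); exact: IH.
Qed.

Lemma fr_var n : F (FVar 0 (idt L n)) /\ F (FVar 1 (idt L n)).
Proof.
have /(fr_not frF) := fr_differ_sub n.
by move=> /(fr_and frF) [/(fr_not frF) /(fr_and frF) [h1 /(fr_not frF) h2] _].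
Qed.

(** Membership does not depend on the chosen representatives, since they are equal to the given
    constants in all models of some stage. *)
Lemma trel_cls n X (cs : n.+1.-tuple nat) : okc X ->
  trel X (map_tuple cls cs) <-> holdsG (FVar 0 (idt L n), val cs, [:: (n, 0, X)]).
Proof.
move=> okX; rewrite /trel /=; apply: holds_equiv; rewrite /okit /= ?okX //;
  try exact: (fr_var n).1.
apply: consq_imp (crepr_consq cs) => A M iv rv _ _ E.
rewrite /itsat /= -[map cls cs]/(val (map_tuple cls cs)).
rewrite -[map crepr _]/(val (map_tuple crepr (map_tuple cls cs))) !idtE.
suff -> : map_tuple iv (map_tuple crepr (map_tuple cls cs)) = map_tuple iv cs by [].
by apply: val_inj => /=; rewrite -E; congr map; rewrite -map_comp.
Qed.

Lemma holds_FExs p xs e (E : seq (nat * nat * nat)) : all (fun x => okc x.2) E ->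
  F (foldr (@FEx L) p xs) -> holdsG (foldr (@FEx L) p xs, e, E) ->
  exists e', holdsG (p, e', E).
Proof.
move=> okE; elim: xs e => [|x xs IH] e /=; first by exists e.
move=> Fp /(holds_wit (okE : @okit L okc (_, e, E)) Fp) [k [c Gk]].
by apply: (IH (set_nth 0 e x c)); [apply: (fr_ex frF) Fp|exists k].
Qed.

Lemma okit_look (E : seq (nat * nat * nat)) (p : formula L) e n X : okit okc (p, e, E) -> okc (look E n X).
Proof.
by move=> /allP h; case: (look_in E n X) => [->|[a aE <-]]; [|apply: h].
Qed.

(** The truth lemma. The delicate case is identity of relations: two constants with the same
    extension might be declared distinct. But then all models of some stage have a tuple on which
    they differ, the existential [differ] formula is in the theory with its witnesses, and these
    name a tuple of the term model on which the extensions differ. *)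
Lemma truth p e E : F p -> okit okc (p, e, E) ->
  sat tmodel (fun x => cls (nth 0 e x)) (fun n X => trel (look E n X)) p <->
  holdsG (p, e, E).
Proof.
elim: p e E => [s t|n X Y|n X ts|C ts|p IH|p IHp q IHq|x p IH|n X p IH] e E Fp okE /=.
- rewrite !teval_tmodel cls_eq eqcE; apply: holds_equiv => //; first exact: fr_eq frF.
  have hc c : c \in flatten [seq tcsyms t | t <- [:: s; t]] -> F (FEx 0 (FEq (TVar 0) (TCst c))).
    by rewrite /= cats0 => hc; apply: (fr_csym frF Fp).
  by apply: consq_imp (tval_consq e hc) => A M iv rv _ _ [E1 E2]; rewrite /itsat /= E1 E2.
- have okX := okit_look n X okE; have okY := okit_look n Y okE.
  split=> h.
    apply: contrapT => /(holds_neg okE Fp) nh.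
    have okE' : okit okc (differ L n, [::], [:: (n, 0, look E n X); (n, 1, look E n Y)]).
      by rewrite /okit /= okX okY.
    have hd : holdsG (foldr (@FEx L) (differ L n) (iota 0 n.+1), [::],
        [:: (n, 0, look E n X); (n, 1, look E n Y)]).
      apply: holds_imp nh => //; first exact: fr_differ frF n.
      apply: consq_true => A M iv rv; rewrite /itsat /= => neq.
      apply: contrapT => h'; apply: neq; rewrite predeqE => t.
      apply: contrapT => ht; apply: h'; apply: (sat_FExs (p := differ L n) (xs := iota 0 n.+1)).
      exists (fun x => nth (iv 0) t x).
        move=> x hx; have : x \notin iota 0 n.+1 by exact: hx.
        rewrite mem_iota -leqNgt => xn.
        by rewrite nth_default ?size_tuple // nth_nil.
      have Et : map_tuple (teval M (fun x => nth (iv 0) t x)) (idt L n) = t.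
        by apply: val_inj; rewrite idt_map -[RHS](mkseq_nth (iv 0)) size_tuple.
      rewrite /= Et /look /= !eqxx /= xpair_eqE eqxx /= => -[h1 h2]; apply: ht.
      split=> hh; apply: contrapT => hh'; [apply: h1|apply: h2]; by split.
    have [e' he'] := holds_FExs okE' (fr_differ frF n) hd.
    (* The witnesses are the entries of [e'] at the variables of [idt]. *)
    pose cs := [tuple nth 0 e' i | i < n.+1].
    have he2 : consq (fun A M iv rv =>
      ~ (itsat M iv rv (FVar 0 (idt L n), val cs, [:: (n, 0, look E n X)]) <->
      itsat M iv rv (FVar 0 (idt L n), val cs, [:: (n, 0, look E n Y)]))).
      apply: consq_imp (holds_consq he') => A M iv rv _ _; rewrite /itsat /=.
      have -> : map_tuple (teval M (fun x => iv (nth 0 e' x))) (idt L n) =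
                map_tuple (teval M (fun x => iv (nth 0 cs x))) (idt L n).
        apply: val_inj; rewrite !idt_map.
        apply/eq_in_map => i; rewrite mem_iota => hi.
        suff Ecs : nth 0 cs i = nth 0 e' i by apply: (congr1 iv (esym Ecs)).
        by rewrite -[i]/(val (Ordinal (hi : i < n.+1))) -(tnth_nth 0 cs) tnth_mktuple.
      rewrite /look /= !eqxx /= xpair_eqE eqxx /= => hn h'; apply: hn.
      by split=> -[h1 h2]; apply: h2; apply/h'.
    have [okA okB] : okit okc (FVar 0 (idt L n), val cs, [:: (n, 0, look E n X)]) /\
      okit okc (FVar 0 (idt L n), val cs, [:: (n, 0, look E n Y)]).
      by rewrite /okit /= okX okY.
    have := trel_cls cs okX; rewrite h trel_cls // => hXY.
    case: (EM (holdsG (FVar 0 (idt L n), val cs, [:: (n, 0, look E n X)]))) => hX.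
      have hY := hXY.2 hX; apply: consq_false.
      apply: consq_imp (consq_and he2 (consq_and (holds_consq hX) (holds_consq hY))) => A M iv rv _ _.
      by move=> [h1 [h2 h3]]; apply: h1.
    have hY : ~ holdsG (FVar 0 (idt L n), val cs, [:: (n, 0, look E n Y)]) by move/hXY.
    move: hX hY => /(holds_neg okA (fr_var n).1) hX /(holds_neg okB (fr_var n).1) hY.
    apply: consq_false.
    apply: consq_imp (consq_and he2 (consq_and (holds_consq hX) (holds_consq hY))) => A M iv rv _ _.
    by move=> [h1 [h2 h3]]; apply: h1.
  rewrite predeqE => t; have -> : t = map_tuple cls (map_tuple crepr t).
    by apply: val_inj; rewrite /= -map_comp -[LHS]map_id; apply: eq_map => a /=; rewrite creprK.
  rewrite !trel_cls //; apply: holds_equiv; rewrite /okit /= ?okX ?okY //; try exact: (fr_var n).1.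
  apply: consq_imp (holds_consq h) => A M iv rv _ _; rewrite /itsat /= => h'.
  by rewrite /look /= !eqxx /= h'.
- have okX := okit_look n X okE.
  have -> : map_tuple (teval tmodel (fun x => cls (nth 0 e x))) ts =
    map_tuple cls (map_tuple (tval e) ts).
    by apply: val_inj; rewrite /= -map_comp; apply: eq_map => t /=; rewrite teval_tmodel.
  rewrite trel_cls //; apply: holds_equiv => //; first by rewrite /okit /= okX.
    exact: (fr_var n).1.
  apply: consq_imp (tval_consq e (fun c hc => fr_csym frF Fp hc)) => A M iv rv _ _ E1; rewrite /itsat /= idtE.
  have -> : map_tuple (teval M (fun x => iv (nth 0 e x))) ts = map_tuple iv (map_tuple (tval e) ts).
    exact: val_inj.
  by rewrite /look /= eqxx.
- have Fi := fr_sym frF Fp.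
  have -> : map_tuple (teval tmodel (fun x => cls (nth 0 e x))) ts =
    map_tuple cls (map_tuple (tval e) ts).
    by apply: val_inj; rewrite /= -map_comp; apply: eq_map => t /=; rewrite teval_tmodel.
  rewrite RCE //; apply: holds_equiv => //.
  have h1 := tval_consq e (fun c hc => fr_csym frF Fp hc).
  apply: consq_imp (consq_and h1 (crepr_consq (map (tval e) ts))) => A M iv rv _ _ [E1 E2].
  rewrite /itsat; cbn [fst snd sat].
  have -> : map_tuple (teval M (fun x => iv (nth 0 e x))) ts = map_tuple iv (map_tuple (tval e) ts).
    exact: val_inj.
  rewrite idtE.
  suff -> : map_tuple iv (map_tuple crepr (map_tuple cls (map_tuple (tval e) ts))) =
    map_tuple iv (map_tuple (tval e) ts) by [].
  by apply: val_inj => /=; rewrite -E2; congr map; rewrite -map_comp.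
- have Fp' := fr_not frF Fp; rewrite (IH e E Fp' okE).
  by rewrite -(holds_neg (a := (p, e, E))).
- have [Fp' Fq'] := fr_and frF Fp; rewrite (IHp e E Fp' okE) (IHq e E Fq' okE); split.
    move=> [/holds_consq h1 /holds_consq h2]; apply: consq_holds => //.
    exact: consq_imp (consq_and h1 h2).
  move=> /holds_consq h; split; apply: consq_holds => //;
    by apply: consq_imp h => A M iv rv _ _ [].
- have Fp' := fr_ex frF Fp; split.
    move=> [a]; rewrite -[a]creprK.
    have -> : (fun y => if y == x then cls (crepr a) else cls (nth 0 e y)) =
      (fun y => cls (nth 0 (set_nth 0 e x (crepr a)) y)) by rewrite set_nth_iv.
    move=> /(IH _ E Fp' okE); apply: holds_imp => //.
    apply: consq_true => A M iv rv; rewrite itsat_set /itsat /=.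
    by exists (iv (crepr a)).
  move=> /(holds_wit okE Fp) [k [c Gk]]; exists (cls c).
  rewrite -(set_nth_iv cls); apply/IH => //; by exists k.
- have Fp' := fr_sex frF Fp; split.
    move=> [S [Y okY ->]]; rewrite -(look_cons_rv (@trel)).
    have okE' : okit okc (p, e, (n, X, Y) :: E) by rewrite /okit /= okY.
    move=> /(IH _ _ Fp' okE') /holds_consq h; apply: consq_holds => //.
    apply: consq_imp h => A M iv rv _ rvM; rewrite itsat_look => h.
    by exists (rv n Y).
  move=> /(holds_wit okE Fp) [k [c okc' Gk]]; exists (trel c); first by exists c.
  rewrite -(look_cons_rv (@trel)); apply/IH => //; first by rewrite /okit /= okc'.
  by exists k.
Qed.

Lemma look_map (xs : seq (nat * nat)) (f : nat -> nat -> nat) n X : (n, X) \in xs ->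
  look [seq (Y.1, Y.2, f Y.1 Y.2) | Y <- xs] n X = f n X.
Proof.
elim: xs => //= -[m Y] xs IH; rewrite look_cons inE; case: eqVneq => [[-> ->] //|_] /=.
exact: IH.
Qed.

(** Every assignment of the term model is named by constants, and an instance of an axiom already
    holds in all models of stage 0; so it is in the theory, and the truth lemma applies. *)
Lemma tmodel_models : T `<=` F -> models tmodel T.
Proof.
move=> TF p Tp iv rv rvM.
have /choice[f hf] : forall Y : nat * nat, exists c, okc c /\ rv Y.1 Y.2 = trel c.
  by move=> [n X]; have [c okc' ->] := rvM n X; exists c.
pose E := [seq (Y.1, Y.2, f (Y.1, Y.2)) | Y <- frv p].
pose e := mkseq (fun x => crepr (iv x)) (\max_(x <- fiv p) x).+1.
have okE : okit okc (p, e, E).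
  by apply/allP => _ /mapP[Y _ ->] /=; exact: (hf (Y.1, Y.2)).1.
apply: (sat_ext _ _ _).1 ((truth (TF p Tp) okE).2 _).
- move=> x xp /=; rewrite nth_mkseq ?creprK //= ltnS.
  exact: (leq_bigmax_seq (F := id)).
- move=> n X nX; rewrite (look_map (fun n X => f (n, X))) //.
  by rewrite -(hf (n, X)).2.
- apply: consq_holds => //; first exact: TF.
  by exists 0 => A M iv' rv' [h1 h2 _]; apply: h1.
Qed.

End TermModel.

(** * The pair of models for a countable fragment *)

Section Pair.
Variables (L : signature) (T F : set (formula L)).
Hypotheses (frF : fragment F) (TF : T `<=` F).
Variable Fe : nat -> formula L.
Hypothesis FeP : forall p, F p -> exists k, Fe k = p.

Variable isN : nat -> bool.
Hypothesis isN0 : isN 0.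
Hypothesis isN_unbounded : forall B, exists2 c, B <= c & isN c.
Hypothesis notN_unbounded : forall B, exists2 c, B <= c & ~~ isN c.

Variables (Q : formula L) (E0 : seq (nat * nat * nat)).
Hypotheses (FQ : F Q) (okE0 : all (fun x => isN x.2) E0).
Hypothesis ins : inseparable T isN [set (Q, [::], E0)] [set (FNot Q, [::], E0)].

(** All pairs of a side and an item are listed, the formula through its number in the fragment; a
    number that codes nothing gives a harmless task. *)
Definition tasks (k : nat) : task L :=
  if unpickle k is Some (b, j, e, E) then (b, (Fe j, e, E)) else (true, (Q, [::], E0)).

Lemma tasksP b a : F a.1.1 -> exists k, tasks k = (b, a).
Proof.
case: a => [[p e] E] /= /FeP [j <-].
by exists (pickle (b, j, e, E)); rewrite /tasks pickleK.
Qed.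

(** Both sides are saturated along one enumeration. The term models can share their domain and
    symbols because atoms with shared constants, and their negations, are themselves admissible
    separators. *)
Lemma pair_exists : exists A (N M : henkin L A),
  [/\ models N T, models M T &
   [/\ forall n, hrel N n `<=` hrel M n, cI N =1 cI M, forall C, rI N C = rI M C &
   exists iv rv, [/\ rvalid N rv, sat N iv rv Q & ~ sat M iv rv Q]]].
Proof.
have g0 : good T isN ([set (Q, [::], E0)], [set (FNot Q, [::], E0)]).
  split=> //=; first by move=> a ->.
  have [B1 BB1 h1] := @belowU L 1 set0 (Q, [::], E0) (fun a => False_ind _).
  exists B1 => //; split=> a /= ->; first by apply: h1; right.
  have := h1 (Q, [::], E0); apply; by right.
have [s [s0 hs]] := saturate isN_unbounded notN_unbounded tasks g0.
pose G k := (s k).1; pose D k := (s k).2.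
have gs k : good T isN (s k) by have [] := hs k.
have G_mono k : G k `<=` G k.+1 by have [] := hs k.
have D_mono k : D k `<=` D k.+1 by have [] := hs k.
have G_sat k := good_sat_l (gs k).
have D_sat k := good_sat_r (gs k).
have G_dec a : okit isN a -> F a.1.1 -> exists k, decided isN a (G k).
  move=> oka /(tasksP true) [k hk]; exists k.+1.
  by have [_ _ _] := hs k; rewrite hk; apply.
have D_dec a : okit predT a -> F a.1.1 -> exists k, decided predT a (D k).
  move=> oka /(tasksP false) [k hk]; exists k.+1.
  by have [_ _ _] := hs k; rewrite hk; apply.
have okT a : @okit L predT a by apply: all_predT.
(* Here [p] is the item with its constants written as variables. If one side contained the item and
   the other its negation, [p] or [FNot p] would separate a common stage. *)
have agree a p : okit isN a -> F a.1.1 -> shared isN p -> shared isN (FNot p) ->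
    (forall A (M : henkin L A) iv rv, itsat M iv rv a <-> sat M iv rv p) ->
    holdsG G a <-> holdsG D a.
  move=> oka Fa sp snp ap; split=> ha; apply: contrapT => na.
    have [k nk] := (holds_neg D_mono D_sat D_dec (okT a) Fa).2 na.
    have [j aj] := ha.
    have [|A [M [iv [rv [hM]]]]] := good_agree (gs (maxn j k)) sp.
      move=> A M iv rv [_ _ h]; apply/ap; apply: h.
      exact: (G_le G_mono (leq_maxl j k)).
    move=> /ap; suff : itsat M iv rv (neg a) by [].
    by have [_ _] := hM; apply; apply: (G_le D_mono (leq_maxr j k)).
  have [k nk] := (holds_neg G_mono G_sat G_dec oka Fa).2 na.
  have [j aj] := ha.
  have [|A [M [iv [rv [hM]]]]] := good_agree (gs (maxn j k)) snp.
    move=> A M iv rv [_ _ h] /=; rewrite -(ap A M iv rv).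
    by apply: (h (neg a)); apply: (G_le G_mono (leq_maxr j k)).
  move=> /=; rewrite -(ap A M iv rv); apply.
  by have [_ _] := hM; apply; apply: (G_le D_mono (leq_maxl j k)).
pose eqc c d := holdsG G (FEq (TVar 0) (TVar 1), [:: c; d], [::]).
pose RC C (t : (rar C).+1.-tuple nat) := holdsG G (FSym C (idt L (rar C)), val t, [::]).
have /choice[kc hkc] : forall c, exists d, F (FEx 0 (FEq (TVar 0) (TCst c))) ->
    holdsG G (FEq (TVar 0) (TCst c), [:: d], [::]).
  move=> c; case: (EM (F (FEx 0 (FEq (TVar 0) (TCst c))))) => Fc; last by exists 0.
  have hex : holdsG G (FEx 0 (FEq (TVar 0) (TCst c)), [::], [::]).
    apply: (consq_holds G_mono G_sat G_dec) => //; apply: consq_true => A M iv rv.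
    by exists (cI M c).
  by have [k [d hd]] := holds_wit G_mono G_sat G_dec (a := (FEx 0 (FEq (TVar 0) (TCst c)), [::], [::])) isT Fc hex; exists d => _; exists k.
have eqcG c d : eqc c d <-> holdsG G (FEq (TVar 0) (TVar 1), [:: c; d], [::]) by [].
have eqcD c d : eqc c d <-> holdsG D (FEq (TVar 0) (TVar 1), [:: c; d], [::]).
  by rewrite eqcG; apply: (agree _ (FEq (TVar c) (TVar d))) => //; apply: fr_eq frF.
have kcD c : F (FEx 0 (FEq (TVar 0) (TCst c))) ->
    holdsG D (FEq (TVar 0) (TCst c), [:: kc c], [::]).
  move=> Fc; apply/(agree _ (FEq (TVar (kc c)) (TCst c))) => //; last exact: hkc.
  exact: (fr_ex frF Fc).
have RCG C (t : (rar C).+1.-tuple nat) : F (FSym C (idt L (rar C))) ->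
    (RC C t <-> holdsG G (FSym C (idt L (rar C)), val t, [::])) by [].
have mapTVar A (M : henkin L A) iv n (t : n.-tuple nat) :
    map_tuple (teval M iv) (map_tuple (@TVar L) t) = map_tuple iv t.
  by apply: val_inj; rewrite /= -map_comp.
have RCD C (t : (rar C).+1.-tuple nat) : F (FSym C (idt L (rar C))) ->
    (RC C t <-> holdsG D (FSym C (idt L (rar C)), val t, [::])).
  move=> FC; rewrite RCG //; apply: (agree _ (FSym C (map_tuple (@TVar L) t))) => //.
  by move=> A M iv rv; rewrite /itsat; cbn [fst snd sat]; rewrite idtE mapTVar.
pose N := tmodel eqc kc RC G isN0.
pose M := tmodel eqc kc RC D (isT : predT 0).
(* A shared constant names the same relation on both sides; hence the relations of [N] are relations
   of [M]. *)
have trelE n X : isN X -> trel (eqc := eqc) G X = trel D X :> set (n.+1.-tuple _).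
  move=> NX; rewrite predeqE => t.
  have Nl : look [:: (n, 0, X)] n 0 = X by rewrite look_cons eqxx.
  rewrite /trel /=.
  apply: (agree (FVar 0 (idt L n), [seq @crepr eqc a | a <- t], [:: (n, 0, X)]) (FVar X (map_tuple (@TVar L) (map_tuple (@crepr eqc) t)))).
  - by rewrite /okit /= NX.
  - exact: (fr_var frF n).1.
  - by rewrite /shared /= NX.
  - by rewrite /shared /= NX.
  - move=> A M' iv rv; rewrite /itsat; cbn [fst snd sat].
    by rewrite -[map _ t]/(val (map_tuple (@crepr eqc) t)) idtE mapTVar Nl.
exists (tdom eqc), N, M; split.
- exact: (@tmodel_models _ _ _ frF).
- exact: (@tmodel_models _ _ _ frF).
split=> //.
- by move=> n S [X NX ->]; exists X => //; apply: trelE.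
have NE0 n X : isN (look E0 n X) := okit_look isN0 n X (okE0 : okit isN (Q, [::], E0)).
exists (fun x => cls eqc (nth 0 [::] x)), (fun n X => trel G (look E0 n X)); split.
- by move=> n X; exists (look E0 n X).
- apply/(truth frF isN0 G_mono G_sat G_dec eqcG hkc RCG) => //.
  by exists 0; rewrite /G s0.
- move=> hQ; have : sat M (fun x => cls eqc (nth 0 [::] x)) (fun n X => trel D (look E0 n X)) Q.
    by apply: (sat_ext _ _ _).1 hQ => // n X _; exact: trelE.
  move=> /(truth frF (isT : predT 0) D_mono D_sat D_dec eqcD kcD RCD FQ (okT _)).
  apply/(holds_neg D_mono D_sat D_dec) => //.
  by exists 0; rewrite /D s0.
Qed.

End Pair.

(** * Countable fragments generated by finitely many formulas *)

Lemma In_cat (T : Type) (x : T) s t : List.In x (s ++ t) <-> List.In x s \/ List.In x t.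
Proof. by elim: s => /= [|y s IH]; [tauto|rewrite IH; tauto]. Qed.

Section Fragment.
Variable L : signature.

Fixpoint subs (p : formula L) : seq (formula L) :=
  p :: match p with
  | FNot p => subs p
  | FAnd p q => subs p ++ subs q
  | FEx _ p => subs p
  | SEx _ _ p => subs p
  | _ => [::]
  end.

Definition isubs (p : formula L) : seq (formula L) :=
  match p with
  | FNot p => [:: p]
  | FAnd p q => [:: p; q]
  | FEx _ p => [:: p]
  | SEx _ _ p => [:: p]
  | _ => [::]
  end.

Lemma subs_refl p : List.In p (subs p). Proof. by case: p; left. Qed.

Lemma subs_closed r p q : List.In p (subs r) -> List.In q (isubs p) -> List.In q (subs r).
Proof.
elim: r => [s t|n X Y|n X ts|C ts|r IH|r1 IH1 r2 IH2|x r IH|n X r IH] /=;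
  move=> [<-|] //=; try by move=> [<-|//]; right; apply: subs_refl.
- by move=> h1 h2; right; apply: IH.
- by move=> [<-|[<-|//]]; right; apply/In_cat; [left|right]; apply: subs_refl.
- move=> /In_cat[] h1 h2; right; apply/In_cat; [left|right]; auto.
- by move=> h1 h2; right; apply: IH.
- by move=> h1 h2; right; apply: IH.
Qed.

Definition symof (p : formula L) : seq (rsym L) :=
  if p is FSym C _ then [:: C] else [::].

Variable bs : seq (formula L).

Definition base : seq (formula L) := List.flat_map subs bs.

Definition name (c : csym L) : formula L := FEx 0 (FEq (TVar 0) (TCst c)).

(** Extensionality needs witnesses in every arity, so the fragment is infinite. Each level is
    finite: level 0 comes from the given formulas, and every later level serves one arity. This
    makes it countable. *)
Definition level (k : nat) : seq (formula L) :=
  if k is n.+1 then subs (foldr (@FEx L) (differ L n) (iota 0 n.+1))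
  else FEq (TVar 0) (TVar 1) :: base ++ List.flat_map (fun c => subs (name c)) (flatten (map (@csyms L) base))
    ++ List.map (fun C => FSym C (idt L (rar C))) (List.flat_map symof base).

Definition frag : set (formula L) := [set p | exists k, List.In p (level k)].

Definition frag_enum (d : formula L) (k : nat) : formula L :=
  if unpickle k is Some (i, j) then nth d (level i) j else d.

Lemma In_nth_ex (T : Type) (d x : T) s : List.In x s -> exists j, nth d s j = x.
Proof.
elim: s => //= y s IH [->|/IH[j hj]]; first by exists 0.
by exists j.+1.
Qed.

Lemma frag_enumP d p : frag p -> exists k, frag_enum d k = p.
Proof.
move=> [i /(In_nth_ex d) [j <-]]; exists (pickle (i, j)).
by rewrite /frag_enum pickleK.
Qed.

Lemma level0 p : List.In p (level 0) <->
  [\/ p = FEq (TVar 0) (TVar 1), List.In p base,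
      exists2 c, c \in flatten (map (@csyms L) base) & List.In p (subs (name c)) |
      exists2 C, List.In C (List.flat_map symof base) & p = FSym C (idt L (rar C))].
Proof.
have Inmem (K : eqType) (s : seq K) c : List.In c s <-> c \in s.
  elim: s => //= y s IH; rewrite inE; split=> [[->|/IH ->]|/orP[/eqP ->|/IH]]; rewrite ?eqxx ?orbT //;
  by [left|right].
split=> [[<-|/In_cat[h|/In_cat[|]]]|[->|h|[c /Inmem hc h]|[C hC ->]]] /=.
- exact: Or41.
- exact: Or42.
- by move=> /List.in_flat_map[c [/Inmem hc h]]; apply: Or43; exists c.
- by move=> /List.in_map_iff[C [<- hC]]; apply: Or44; exists C.
- by left.
- by right; apply/In_cat; left.
- right; apply/In_cat; right; apply/In_cat; left.
  by apply/List.in_flat_map; exists c.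
- right; apply/In_cat; right; apply/In_cat; right.
  by apply/List.in_map_iff; exists C.
Qed.

Lemma frag_base p : List.In p bs -> frag p.
Proof.
move=> pb; exists 0; apply/level0; apply: Or42; apply/List.in_flat_map; exists p.
by split=> //; apply: subs_refl.
Qed.

Lemma frag_closed p q : frag p -> List.In q (isubs p) -> frag q.
Proof.
move=> [[|n] hp] hq; last by exists n.+1; apply: subs_closed hp hq.
move/level0: hp => [E|h|[c hc h]|[C hC E]]; rewrite ?E // in hq.
  exists 0; apply/level0; apply: Or42; move/List.in_flat_map: h => [r [rb hr]].
  by apply/List.in_flat_map; exists r; split=> //; apply: subs_closed hr hq.
exists 0; apply/level0; apply: Or43; exists c => //; exact: subs_closed h hq.
Qed.

Lemma differ_subs n xs p : List.In p (subs (foldr (@FEx L) (differ L n) xs)) ->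
  csyms p = [::] /\ symof p = [::].
Proof.
have cs0 X : csyms (FVar X (idt L n)) = [::].
  rewrite /=; elim: (iota 1 n) => //.
rewrite /differ.
have [a [-> ca sa ya]] : exists a, [/\ FVar 0 (idt L n) = a, csyms a = [::], subs a = [:: a] & symof a = [::]].
  by exists (FVar 0 (idt L n)).
have [b [-> cb sb yb]] : exists a, [/\ FVar 1 (idt L n) = a, csyms a = [::], subs a = [:: a] & symof a = [::]].
  by exists (FVar 1 (idt L n)).
elim: xs => [|x xs IH] /=; last first.
  move=> [<-|//]; split=> //=; elim: xs {IH} => //=; by rewrite ca cb.
rewrite sa sb /=.
(* The formula [differ] has twelve occurrences of subformulas: itself, the conjunction, and five in
   each implication. *)
by do 12![case=> [<-|]; first by rewrite /= ?ca ?cb]; case.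
Qed.

Lemma fragmentP : fragment frag.
Proof.
split.
- by move=> p h; apply: frag_closed h _; left.
- by move=> p q h; split; apply: frag_closed h _; [left|right; left].
- by move=> x p h; apply: frag_closed h _; left.
- by move=> n X p h; apply: frag_closed h _; left.
- by exists 0; left.
- by move=> n; exists n.+1; apply: subs_refl.
- move=> p c [[|n] hp] hc; last by move: hc; rewrite (differ_subs hp).1.
  suff h : c \in flatten (map (@csyms L) base).
    by exists 0; apply/level0; apply: Or43; exists c => //; apply: subs_refl.
  move/level0: hp => [E|h|[d hd h]|[C hC E]].
  + by rewrite E in hc.
  + elim: (base) h => //= q s IH [->|/IH h]; by rewrite mem_cat ?hc ?h ?orbT.
  + by move: hc; case: h => [<-|h]; last case: h => [<-|[]]; rewrite /= inE => /eqP ->.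
  + rewrite E in hc; suff : csyms (FSym C (idt L (rar C))) = [::] by move=> E2; rewrite E2 in hc.
    by rewrite /=; elim: (iota 1 _).
- move=> C ts [[|n] hp]; last by have [] := differ_subs hp.
  move/level0: hp => [//|h|[d hd h]|[D hD [E]]].
  + exists 0; apply/level0; apply: Or44; exists C => //.
    by apply/List.in_flat_map; exists (FSym C ts); split=> //; left.
  + by case: h => [//|h]; case: h => [//|[]].
  + by exists 0; apply/level0; apply: Or44; exists C => //; rewrite E.
Qed.

End Fragment.

(** * Ultraproducts of Henkin models *)

Section Ultraproduct.
Variables (I : Type) (U : set_system I) (UU : UltraFilter U) (A : I -> Type).

Local Notation prodA := (forall i, A i).

Definition uqe (f g : prodA) : Prop := U [set i | f i = g i].
Definition udom : Type := {S : set prodA | exists f, S = uqe f}.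
Definition ucls (f : prodA) : udom := exist _ (uqe f) (ex_intro _ f erefl).
Definition urep (a : udom) : prodA := projT1 (cid (svalP a)).

Lemma urepK a : ucls (urep a) = a.
Proof.
rewrite /urep; case: (cid _) => f /= h; case: a h => S hS /= h.
by apply: eq_exist.
Qed.

Lemma uset_and (X Y : set I) : U X -> U Y -> U (X `&` Y).
Proof. exact: filterI. Qed.

Lemma uset_sub (X Y : set I) : X `<=` Y -> U X -> U Y.
Proof. exact: filterS. Qed.

Lemma usetC (X : set I) : U (~` X) <-> ~ U X.
Proof.
split=> [h1 h2|h].
  by have := uset_and h1 h2; rewrite setICl; apply: filter_not_empty.
by case: (in_ultra_setVsetC X UU).
Qed.

Lemma ucls_eq f g : ucls f = ucls g <-> U [set i | f i = g i].
Proof.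
split=> [[h]|h].
  by rewrite -/(uqe f g) h; apply: uset_sub filterT.
apply: eq_exist; apply/funext => k; apply/propext; split=> hk.
  by apply: uset_sub (uset_and h hk) => i [/= <- <-].
by apply: uset_sub (uset_and h hk) => i [/= -> <-].
Qed.

Lemma map_urep n (fs : n.-tuple prodA) :
  U [set i | map_tuple (fun a => urep a i) (map_tuple ucls fs) = map_tuple (@^~ i) fs].
Proof.
case: fs => s hs /=; set P := (X in U X).
have -> : P = [set i | map (fun a => urep a i) (map ucls s) = map (@^~ i) s].
  by rewrite predeqE => i; split=> [[]//|h]; apply: val_inj.
elim: s {hs P} => [|f s IH]; first by apply: uset_sub filterT.
have h : U [set i | urep (ucls f) i = f i] by apply/ucls_eq; rewrite urepK.
by apply: uset_sub (uset_and h IH) => i [/= -> ->].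
Qed.

Definition uset n (S : forall i, set (n.-tuple (A i))) : set (n.-tuple udom) :=
  [set t | U [set i | S i (map_tuple (fun a => urep a i) t)]].

Lemma uset_cls n (S : forall i, set (n.-tuple (A i))) (fs : n.-tuple prodA) :
  uset S (map_tuple ucls fs) <-> U [set i | S i (map_tuple (@^~ i) fs)].
Proof.
split=> h; apply: uset_sub (uset_and h (map_urep fs)) => i /= [h1 h2].
  by rewrite -h2.
by rewrite h2.
Qed.

Variables (L : signature).

Section OneFamily.
Variable N : forall i, henkin L (A i).

Lemma udom_inhabited : inhabited udom.
Proof.
have h i : exists a : A i, True by case: (hdom (N i)) => a; exists a.
by constructor; exact: (ucls (fun i => projT1 (cid (h i)))).
Qed.

Lemma urel_neq0 n :
  [set uset S | S in [set S : forall i, set (n.+1.-tuple (A i)) | forall i, hrel (N i) n (S i)]] !=set0.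
Proof.
pose S i := projT1 (cid (hrel_neq0 (N i) n)).
by exists (uset S), S => // i; rewrite /S; case: cid.
Qed.

Definition uhenkin : henkin L udom :=
  Henkin udom_inhabited urel_neq0 (fun c => ucls (fun i => cI (N i) c))
    (fun C => uset (fun i => rI (N i) C)).

(** The theorem of Los. Relations of the ultraproduct are the internal ones, given by families, so
    second-order witnesses can be chosen index by index just like individual ones. *)
Lemma los p (iv : nat -> prodA) (rv : forall n, nat -> forall i, set (n.+1.-tuple (A i))) :
  sat uhenkin (fun x => ucls (iv x)) (fun n X => uset (rv n X)) p <->
  U [set i | sat (N i) (fun x => iv x i) (fun n X => rv n X i) p].
Proof.
have tevalE t (iv' : nat -> prodA) : teval uhenkin (fun x => ucls (iv' x)) t =
    ucls (fun i => teval (N i) (fun x => iv' x i) t) by case: t.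
have mapE n (ts : n.-tuple (term L)) (iv' : nat -> prodA) :
    map_tuple (teval uhenkin (fun x => ucls (iv' x))) ts =
    map_tuple ucls (map_tuple (fun t i => teval (N i) (fun x => iv' x i) t) ts).
  by apply: val_inj; rewrite /= -map_comp; apply: eq_map => t /=; rewrite tevalE.
have mapE2 n (ts : n.-tuple (term L)) (iv' : nat -> prodA) i :
    map_tuple (@^~ i) (map_tuple (fun t i => teval (N i) (fun x => iv' x i) t) ts) =
    map_tuple (teval (N i) (fun x => iv' x i)) ts.
  by apply: val_inj; rewrite /= -map_comp.
elim: p iv rv => [s t|n X Y|n X ts|C ts|p IH|p IHp q IHq|x p IH|n X p IH] iv rv.
- by cbn [sat]; rewrite !tevalE; exact: ucls_eq.
- cbn [sat]; split=> h; last first.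
    rewrite predeqE => t; split=> ht; apply: uset_sub (uset_and h ht) => i [/= h1].
      by rewrite h1.
    by rewrite h1.
  apply: contrapT => /usetC h'.
  (* A point of disagreement at every index where the relations differ; if that is almost
     everywhere, the tuple of these points distinguishes the two internal relations. *)
  have H i : exists t, rv n X i <> rv n Y i -> ~ (rv n X i t <-> rv n Y i t).
    case: (EM (rv n X i = rv n Y i)) => e.
      by case: (hdom (N i)) => a; exists [tuple a | j < n.+1].
    apply: contrapT => hn; apply: e; rewrite predeqE => t; apply: contrapT => ht.
    by apply: hn; exists t.
  pose t i := projT1 (cid (H i)).
  have ht i : rv n X i <> rv n Y i -> ~ (rv n X i (t i) <-> rv n Y i (t i)).
    by rewrite /t; case: cid.
  pose fs : n.+1.-tuple prodA := [tuple (fun i => tnth (t i) j) | j < n.+1].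
  have fsE i : map_tuple (@^~ i) fs = t i.
    by apply: eq_from_tnth => j; rewrite tnth_map tnth_mktuple.
  have := uset_cls (rv n X) fs; rewrite h uset_cls => hXY.
  have {}hXY : U [set i | rv n X i (t i)] <-> U [set i | rv n Y i (t i)].
    move: hXY; rewrite (_ : [set i | rv n X i (map_tuple (@^~ i) fs)] = [set i | rv n X i (t i)]).
      by move=> <-; rewrite (_ : [set i | rv n Y i (t i)] = [set i | rv n Y i (map_tuple (@^~ i) fs)]) //;
        rewrite predeqE => i /=; rewrite fsE.
    by rewrite predeqE => i /=; rewrite fsE.
  case: (EM (U [set i | rv n X i (t i)])) => hX.
    have hY := hXY.1 hX; move: (uset_and h' (uset_and hX hY)) => h3.
    apply: (filter_not_empty U); apply: uset_sub h3 => i [/= h1 [h2 h4]].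
    by apply: (ht i h1); split.
  have hY : ~ U [set i | rv n Y i (t i)] by move/hXY.
  move/usetC: hX => hX; move/usetC: hY => hY; move: (uset_and h' (uset_and hX hY)) => h3.
  apply: (filter_not_empty U); apply: uset_sub h3 => i [/= h1 [h2 h4]].
  by apply: (ht i h1); split.
- cbn [sat]; rewrite mapE uset_cls.
  by split; apply: uset_sub => i /=; rewrite mapE2.
- cbn [sat]; rewrite mapE -[rI uhenkin C]/(uset (fun i => rI (N i) C)) uset_cls.
  by split; apply: uset_sub => i /=; rewrite mapE2.
- by cbn [sat]; rewrite IH -usetC.
- cbn [sat]; rewrite IHp IHq; split=> [[h1 h2]|h].
    exact: uset_sub (uset_and h1 h2).
  by split; apply: uset_sub h => i [].
- have updE (f : prodA) :
    (fun y => if y == x then ucls f else ucls (iv y)) = (fun y => ucls (if y == x then f else iv y)).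
    by apply/funext => y; case: ifP.
  have updE2 (f : prodA) i :
    (fun y => (if y == x then f else iv y) i) = (fun y => if y == x then f i else iv y i).
    by apply/funext => y; case: ifP.
  cbn [sat]; split=> [[a]|h].
    rewrite -(urepK a) updE IH; apply: uset_sub => i /=; rewrite updE2 => h.
    by exists (urep a i).
  have H i : exists a, (exists a, sat (N i) (fun y => if y == x then a else iv y i)
      (fun n X => rv n X i) p) -> sat (N i) (fun y => if y == x then a else iv y i)
      (fun n X => rv n X i) p.
    case: (EM (exists a, sat (N i) (fun y => if y == x then a else iv y i)
      (fun n X => rv n X i) p)) => [[a ha]|na]; first by exists a.
    by case: (hdom (N i)) => a; exists a.
  exists (ucls (fun i => projT1 (cid (H i)))); rewrite updE IH.
  by apply: uset_sub h => i /= h; rewrite updE2; case: cid => a /=; apply.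
- have updE (S : forall i, set (n.+1.-tuple (A i))) :
    rupd (fun m Y => uset (rv m Y)) X (uset S) =
    (fun m Y => uset (fun i => @rupd _ (fun m Y => rv m Y i) n X (S i) m Y)).
    apply: functional_extensionality_dep => m; apply/funext => Y.
    case: (eqVneq (m, Y) (n, X)) => [[-> ->]|mY].
      rewrite rupd_same; congr uset; apply: functional_extensionality_dep => i.
      by rewrite rupd_same.
    rewrite rupd_other //; congr uset; apply: functional_extensionality_dep => i.
    by rewrite rupd_other.
  cbn [sat]; split=> [[_ [S SN <-]]|h].
    rewrite updE (IH iv (fun m Y i => @rupd _ (fun m Y => rv m Y i) n X (S i) m Y)).
    by apply: uset_sub => i /= h; exists (S i).
  have H i : exists S, hrel (N i) n S /\ ((exists2 S, hrel (N i) n S &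
      sat (N i) (fun x => iv x i) (rupd (fun m Y => rv m Y i) X S) p) ->
      sat (N i) (fun x => iv x i) (rupd (fun m Y => rv m Y i) X S) p).
    case: (EM (exists2 S, hrel (N i) n S &
      sat (N i) (fun x => iv x i) (rupd (fun m Y => rv m Y i) X S) p)) => [[S hS hp]|nS].
      by exists S.
    by have [S hS] := hrel_neq0 (N i) n; exists S.
  pose S i := projT1 (cid (H i)).
  have hS i : hrel (N i) n (S i) by rewrite /S; case: cid => ? [].
  have hS2 i : (exists2 S, hrel (N i) n S &
      sat (N i) (fun x => iv x i) (rupd (fun m Y => rv m Y i) X S) p) ->
      sat (N i) (fun x => iv x i) (rupd (fun m Y => rv m Y i) X (S i)) p.
    by rewrite /S; case: cid => ? [].
  exists (uset S); first by exists S.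
  rewrite updE (IH iv (fun m Y i => @rupd _ (fun m Y => rv m Y i) n X (S i) m Y)).
  by apply: uset_sub h => i /= /hS2.
Qed.

Lemma uhenkin_holds p : U [set i | holds (N i) p] -> holds uhenkin p.
Proof.
move=> h iv rv rvM.
pose S n X := projT1 (cid2 (rvM n X)).
have hS n X i : hrel (N i) n (S n X i) by rewrite /S; case: cid2 => ? /=.
have rvE : rv = fun n X => uset (S n X).
  apply: functional_extensionality_dep => n; apply/funext => X.
  by rewrite /S; case: cid2 => ? /=.
have ivE : iv = fun x => ucls (urep (iv x)) by apply/funext => x; rewrite urepK.
rewrite ivE rvE los; apply: uset_sub h => i; apply => n X; exact: hS.
Qed.

End OneFamily.

End Ultraproduct.

(** * The interpolation theorem *)

Lemma map_tuple_id_set A n (S : set (n.-tuple A)) : map_tuple id @` S = S.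
Proof.
have E (t : n.-tuple A) : map_tuple id t = t by apply: val_inj; rewrite /= map_id.
rewrite predeqE => t; split=> [[s Ss <-]|St]; first by rewrite E.
by exists t => //; rewrite E.
Qed.

Section Interpolation.
Variables (L : signature) (T : set (formula L)) (l : nat) (n : 'I_l -> nat) (Q : formula L).
Hypothesis genQ : gen_quantifier n Q.

(** Only the displayed variables are free in [Q], so a single assignment decides it. *)
Lemma satQE A (M : henkin L A) (R : forall i, set ((n i).+1.-tuple A)) iv rv :
  rvalid M rv -> (forall i : 'I_l, rv (n i) i = R i) ->
  satQ M Q R <-> sat M iv rv Q.
Proof.
move=> rvM rvR; split=> [|h iv' rv' rvM' rvR']; first exact.
apply: (sat_ext _ _ _).1 h; first by rewrite genQ.1.
by move=> m X /genQ.2 [i [-> ->]]; rewrite rvR rvR'.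
Qed.

Lemma satQ_FNot A (M : henkin L A) (R : forall i, set ((n i).+1.-tuple A)) :
  (exists2 rv, rvalid M rv & forall i : 'I_l, rv (n i) i = R i) ->
  satQ M (FNot Q) R <-> ~ satQ M Q R.
Proof.
move=> [rv rvM rvR]; case: (hdom M) => a.
rewrite (satQE (fun _ => a) rvM rvR); split.
  by move=> h; exact: (h (fun _ => a) rv rvM rvR).
move=> h iv' rv' rvM' rvR' /= h'; apply: h; apply: (sat_ext _ _ _).1 h'.
  by rewrite genQ.1.
by move=> m X /genQ.2 [i [-> ->]]; rewrite rvR rvR'.
Qed.

Hypothesis indQ : domain_independent T n Q.

Theorem interpolation : exists2 p, sigma true p &
  forall A (M : henkin L A) iv rv, models M T -> rvalid M rv ->
    sat M iv rv Q <-> sat M iv rv p.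
Proof.
(* The parameter number i is named by the constant number i of its arity. *)
pose E0 := [seq (Y.1, Y.2, Y.2) | Y <- [seq (n i, val i) | i <- enum 'I_l]].
(* Constants below [l] name parameters and must be shared. From [l] on, even constants are shared
   and odd ones private, so both kinds are unbounded. *)
pose isN c := (c < l) || ~~ odd c.
have isN0 : isN 0 by rewrite /isN /= orbT.
have isN_unbounded B : exists2 c, B <= c & isN c.
  by exists B.*2; rewrite /isN ?odd_double ?orbT // -addnn leq_addr.
have notN_unbounded B : exists2 c, B <= c & ~~ isN c.
  exists (l + B).*2.+1; first by rewrite (leq_trans (leq_addl l B)) // -addnn leqW // leq_addr.
  by rewrite /isN /= odd_double /= orbF -leqNgt leqW // -addnn -!addnA leq_addr.
have okE0 : all (fun x => isN x.2) E0.
  by apply/allP => _ /mapP[_ /mapP[i _ ->] ->] /=; rewrite /isN /= ltn_ord.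
have itQ A (M : henkin L A) iv rv p : (p = Q \/ p = FNot Q) ->
    itsat M iv rv (p, [::], E0) <-> sat M iv rv p.
  move=> pQ; have [fi fr] : fiv p = [::] /\ frv p = frv Q by case: pQ => -> /=; rewrite genQ.1.
  apply: sat_ext => /=; first by rewrite fi.
  move=> m X; rewrite fr => /genQ.2 [i [-> ->]].
  rewrite (look_map (fun n X => X)) //; apply/mapP; exists i => //.
  by rewrite mem_enum.
apply: contrapT => nop.
pose Ix := seq {p : formula L | T p}.
pose Ts (s : Ix) : set (formula L) := [set p | exists x, List.In x s /\ sval x = p].
(* A separator over finitely many axioms is equivalent to [Q] in all models of those axioms, hence
   of [T], which is excluded by [nop]. *)
have ins s : inseparable (Ts s) isN [set (Q, [::], E0)] [set (FNot Q, [::], E0)].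
  move=> [p /andP[sp _] [p1 p2]]; apply: nop; exists p => // A M iv rv MT rvM.
  have MTs : models M (Ts s) by move=> q [[q' Tq] [_ /= <-]]; apply: MT.
  split=> hQ.
    by apply: p1; split=> // a ->; apply/itQ => //; left.
  apply: contrapT => nQ; apply: p2 hQ; split=> // a ->.
  by apply/(itQ _ _ _ _ (FNot Q)); [right|].
pose bs (s : Ix) := Q :: List.map (fun x => sval x) s.
have /choice[f hf] : forall s : Ix, exists x : {A : Type & (henkin L A * henkin L A *
    ((nat -> A) * (forall n, nat -> set (n.+1.-tuple A))))%type},
    let: existT A (N, M, (iv, rv)) := x in
    [/\ models N (Ts s), models M (Ts s) &
     [/\ forall n, hrel N n `<=` hrel M n, cI N =1 cI M, forall C, rI N C = rI M C &
     [/\ rvalid N rv, sat N iv rv Q & ~ sat M iv rv Q]]].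
  move=> s; have TF : Ts s `<=` frag (bs s).
    by move=> p [x [xs <-]]; apply: frag_base; right; apply: List.in_map.
  have FQ : frag (bs s) Q by apply: frag_base; left.
  have [A [N [M [h1 h2 [h3 h4 h5 [iv [rv h6]]]]]]] := pair_exists (fragmentP _) TF
    (frag_enumP Q) isN0 isN_unbounded notN_unbounded FQ okE0 (ins s).
  by exists (existT _ A (N, M, (iv, rv))).
pose A s := projT1 (f s).
pose N s : henkin L (A s) := (projT2 (f s)).1.1.
pose M s : henkin L (A s) := (projT2 (f s)).1.2.
pose iv s : nat -> A s := (projT2 (f s)).2.1.
pose rv s : forall n, nat -> set (n.+1.-tuple (A s)) := (projT2 (f s)).2.2.
have {hf}hf s : [/\ models (N s) (Ts s), models (M s) (Ts s) &
     [/\ forall n, hrel (N s) n `<=` hrel (M s) n, cI (N s) =1 cI (M s),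
         forall C, rI (N s) C = rI (M s) C &
     [/\ rvalid (N s) (rv s), sat (N s) (iv s) (rv s) Q & ~ sat (M s) (iv s) (rv s) Q]]].
  move: (hf s); rewrite /N /M /iv /rv /A.
  by case: (f s) => B [[N' M'] [iv' rv']].
(* The filter generated by the sets of all lists that extend a given list. Each axiom of [T] belongs
   to almost every list in this sense. *)
pose Fi : set_system Ix :=
  [set X | exists s0, [set s | forall x, List.In x s0 -> List.In x s] `<=` X].
have PF : ProperFilter Fi.
  apply: Build_ProperFilter_ex.
    by move=> X [s0 h]; exists s0; apply: h.
  split.
  - by exists [::].
  - move=> X Y [s hs] [t ht]; exists (s ++ t) => r hr.
    by split; [apply: hs|apply: ht] => x xs; apply: hr; apply/In_cat; [left|right].
  - by move=> X Y XY [s hs]; exists s; apply: subset_trans XY.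
have [U [UU FU]] := ultraFilterLemma PF.
have UT p : T p -> U [set s | Ts s p].
  move=> Tp; apply: FU; exists [:: exist _ p Tp] => s hs.
  by exists (exist _ p Tp); split=> //; apply: hs; left.
have NT : models (uhenkin U N) T.
  move=> p Tp; apply: uhenkin_holds; apply: filterS (UT _ Tp) => s /=.
  by have [h _ _] := hf s; apply: h.
have MT : models (uhenkin U M) T.
  move=> p Tp; apply: uhenkin_holds; apply: filterS (UT _ Tp) => s /=.
  by have [_ h _] := hf s; apply: h.
(* The two ultraproducts have the same domain because [N s] and [M s] do, so the embedding is the
   identity. *)
have subNM : substructure (uhenkin U N) (uhenkin U M) id.
  split=> //.
  - move=> m S [S' hS' <-]; rewrite map_tuple_id_set; exists S' => // s.
    by have [_ _ [h _ _ _]] := hf s; apply: h; apply: hS'.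
  - move=> c /=; congr ucls; apply: functional_extensionality_dep => s.
    by have [_ _ [_ -> _ _]] := hf s.
  - move=> C ts; have -> : map_tuple id ts = ts by apply: val_inj; rewrite /= map_id.
    rewrite /= (_ : (fun i => rI (M i) C) = (fun i => rI (N i) C)) //.
    apply: functional_extensionality_dep => s.
    by have [_ _ [_ _ -> _]] := hf s.
pose urv m X := @uset _ U A m.+1 (fun s => rv s m X).
pose uiv x := @ucls _ U A (fun s => iv s x).
have rvN : rvalid (uhenkin U N) urv.
  by move=> m X; exists (fun s => rv s m X) => // s; have [_ _ [_ _ _ [h _ _]]] := hf s; apply: h.
have rvM : rvalid (uhenkin U M) urv.
  by move=> m X; have [_ h _ _] := subNM; have := h _ _ (rvN m X); rewrite map_tuple_id_set.
have := indQ NT MT subNM (R := fun i => urv (n i) i) (fun i => rvN _ _).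
rewrite (satQE uiv rvN) // (satQE uiv rvM) //; last by move=> i; rewrite map_tuple_id_set.
rewrite !(los UU _ Q (fun x s => iv s x) (fun m X s => rv s m X)) => h.
have /h hM : U [set s | sat (N s) (iv s) (rv s) Q].
  by apply: filterS filterT => s _ /=; have [_ _ [_ _ _ []]] := hf s.
apply: (filter_not_empty U); apply: filterS hM => s /=.
by have [_ _ [_ _ _ []]] := hf s.
Qed.

End Interpolation.


(** * Assignments with prescribed displayed relations *)

Section Displayed.
Variables (L : signature) (A : Type) (l : nat) (n : 'I_l -> nat).

Definition display (R : forall i, set ((n i).+1.-tuple A))
    (rv : forall m, nat -> set (m.+1.-tuple A)) : forall m, nat -> set (m.+1.-tuple A) :=
  foldr (fun i rv => rupd rv (val i) (R i)) rv (enum 'I_l).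

Lemma displayE R rv (i : 'I_l) : @display R rv (n i) i = R i.
Proof.
rewrite /display; have : i \in enum 'I_l by rewrite mem_enum.
elim: (enum 'I_l) => //= j s IH; rewrite inE; case: (eqVneq i j) => [-> _|ij /= /IH E].
  by rewrite rupd_same.
by rewrite rupd_other // xpair_eqE negb_and ij orbT.
Qed.

Lemma display_other R rv m X : (forall i : 'I_l, (m, X) != (n i, val i)) ->
  @display R rv m X = rv m X.
Proof.
move=> h; rewrite /display; elim: (enum 'I_l) => //= j s IH.
by rewrite rupd_other.
Qed.

Lemma display_valid (M : henkin L A) R rv :
  rvalid M rv -> (forall i, hrel M (n i) (R i)) -> rvalid M (display R rv).
Proof.
move=> rvM RM; rewrite /display; elim: (enum 'I_l) => //= i s IH.
exact: rupd_valid.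
Qed.

Lemma display_exists (M : henkin L A) (R : forall i, set ((n i).+1.-tuple A)) :
  (forall i, hrel M (n i) (R i)) ->
  exists2 rv, rvalid M rv & forall i : 'I_l, rv (n i) i = R i.
Proof.
move=> RM; pose rv m (X : nat) := projT1 (cid (hrel_neq0 M m)).
exists (display R rv); last exact: displayE.
by apply: display_valid => // m X; rewrite /rv; case: cid.
Qed.

End Displayed.

Lemma domain_independent_FNot (L : signature) T l (n : 'I_l -> nat) (Q : formula L) :
  gen_quantifier n Q -> domain_independent T n Q -> domain_independent T n (FNot Q).
Proof.
move=> gQ indQ A B M N f MT NT sMN R RM.
rewrite (satQ_FNot gQ (display_exists RM)) (satQ_FNot gQ (M := N)); last first.
  by apply: display_exists => i; case: sMN => _ h _ _; apply: h.
by rewrite (indQ A B M N f MT NT sMN R RM).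
Qed.

(** * Borel sets *)

Section Lusin.
Variables (X : Type) (coord : nat -> X -> bool) (B : set (set X)).
Hypothesis B_coord : forall j, B [set x | coord j x].
Hypothesis B_setC : forall E, B E -> B (~` E).
Hypothesis B_bigcup : forall E : nat -> set X, (forall i, B (E i)) -> B (\bigcup_i E i).
(* Compactness of the Cantor space. *)
Hypothesis coord_onto : forall b : nat -> bool,
  (forall k, exists x, forall j, j < k -> coord j x = b j) ->
  exists x, forall j, coord j x = b j.

Definition agree_upto k (x y : X) : Prop := forall j, j < k -> coord j x = coord j y.

(** Closed in the product of [X], with the topology given by the coordinates, and the Baire
    space. *)
Definition closed_rel (C : X -> (nat -> nat) -> Prop) : Prop :=
  forall x f, ~ C x f -> exists k, forall y g,
    agree_upto k x y -> (forall i, i < k -> f i = g i) -> ~ C y g.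

Definition analytic (E : set X) : Prop :=
  exists2 C, closed_rel C & forall x, E x <-> exists f, C x f.

Definition separable (E F : set X) : Prop :=
  exists S, [/\ B S, E `<=` S & forall x, F x -> ~ S x].

Lemma separable_sym E F : separable E F -> separable F E.
Proof.
move=> [S [BS ES FS]]; exists (~` S); split; [exact: B_setC|exact: FS|].
by move=> x /ES Sx; apply.
Qed.

Lemma B0 : B set0.
Proof.
(* The whole space is the union of a coordinate set and its complement. *)
rewrite (_ : set0 = ~` \bigcup_j (if j == 0 then [set x | coord 0 x] else ~` [set x | coord 0 x])).
  by apply: B_setC; apply: B_bigcup => -[|j] //=; apply: B_setC.
rewrite predeqE => x; split=> // h; exfalso; apply: h.
by case: (EM (coord 0 x)) => h; [exists 0|exists 1].
Qed.

Lemma separable_ex (Z : countType) (E : Z -> set X) F :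
  (forall z, separable (E z) F) -> separable [set x | exists z, E z x] F.
Proof.
move=> /choice[S hS]; exists (\bigcup_k (if unpickle k is Some z then S z else set0)); split.
- apply: B_bigcup => k; case: unpickle => [z|]; last exact: B0.
  by have [] := hS z.
- move=> x [z Ez]; exists (pickle z) => //=; rewrite pickleK.
  by have [_ h _] := hS z; apply: h.
- move=> x Fx [k _]; case: unpickle => // z; have [_ _ h] := hS z; exact: h.
Qed.

(** Read contrapositively: if two countable unions are inseparable, then so are some piece of the
    one and some piece of the other. *)
Lemma separable_ex2 (Z : countType) (E F : Z -> set X) :
  (forall z w, separable (E z) (F w)) ->
  separable [set x | exists z, E z x] [set x | exists z, F z x].
Proof.
move=> h; apply: separable_ex => z; apply: separable_sym; apply: separable_ex => w.
exact: separable_sym.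
Qed.

Definition branch : Type := (nat * bool)%type.

(** A branch records the witness and the coordinates of the point side by side, so an infinite
    branch determines both. *)
Definition branchof (C : X -> (nat -> nat) -> Prop) (s : seq branch) : set X :=
  [set x | exists h : nat -> branch,
    [/\ mkseq h (size s) = s, C x (fun k => (h k).1) & forall j, coord j x = (h j).2]].

Lemma branchof_split C s : branchof C s `<=` [set x | exists z, branchof C (rcons s z) x].
Proof.
move=> x [h [hs hC hx]]; exists (h (size s)), h; split=> //.
by rewrite size_rcons /mkseq -addn1 iotaD map_cat -/(mkseq _ _) hs cats1.
Qed.

Lemma separable_sub E E' F F' : E `<=` E' -> F `<=` F' -> separable E' F' -> separable E F.
Proof. by move=> h1 h2 [S [? ? h]]; exists S; split=> // x; [move/h1; auto|move/h2; apply: h]. Qed.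

(** From an inseparable pair one descends through inseparable pairs of pieces and obtains two
    infinite branches. Their coordinate bits agree, since at a disagreement a coordinate set would
    separate. So both branches describe one point, and it lies in [E] and in [F] because the
    relations are closed and no piece is empty. *)
Lemma lusin E F : analytic E -> analytic F -> (forall x, E x -> ~ F x) -> separable E F.
Proof.
move=> [C Ccl EC] [D Dcl FD] EF; apply: contrapT => nsep.
have n0 : ~ separable (branchof C [::]) (branchof D [::]).
  apply: contra_not nsep; apply: separable_sub.
    by move=> x /EC [f Cf]; exists (fun k => (f k, coord k x)).
  by move=> x /FD [f Cf]; exists (fun k => (f k, coord k x)).
pose S := {p : seq branch * seq branch | ~ separable (branchof C p.1) (branchof D p.2)}.
have /choice[nx hnx] : forall p : S, exists q : S,
    exists z w, sval q = (rcons (sval p).1 z, rcons (sval p).2 w).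
  move=> [[s t] /= ns]; apply: contrapT => h; apply: ns.
  apply: separable_sub (@branchof_split C s) (@branchof_split D t) _.
  apply: separable_ex2 => z w; apply: contrapT => ns; apply: h.
  by exists (exist _ (rcons s z, rcons t w) ns), z, w.
pose st := fix st k : S := if k is k'.+1 then nx (st k') else exist _ ([::], [::]) n0.
pose h i := nth (0, false) (sval (st i.+1)).1 i.
pose g i := nth (0, false) (sval (st i.+1)).2 i.
have sth k : (sval (st k)).1 = mkseq h k /\ (sval (st k)).2 = mkseq g k.
  elim: k => [//|k [IH1 IH2]].
  have [z [w E1]] := hnx (st k); rewrite -/(st k.+1) in E1.
  have hk : h k = z by rewrite /h E1 /= IH1 nth_rcons size_mkseq ltnn eqxx.
  have gk : g k = w by rewrite /g E1 /= IH2 nth_rcons size_mkseq ltnn eqxx.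
  by rewrite E1 /= IH1 IH2 -hk -gk /mkseq -addn1 !iotaD !map_cat !cats1.
have nk k : ~ separable (branchof C (mkseq h k)) (branchof D (mkseq g k)).
  by have [<- <-] := sth k; apply: (svalP (st k)).
have mkseqE (u v : nat -> branch) k : mkseq u (size (mkseq v k)) = mkseq v k ->
    forall j, j < k -> u j = v j.
  rewrite size_mkseq => e j jk.
  by rewrite -(nth_mkseq (0, false) u jk) e nth_mkseq.
have hg j : (h j).2 = (g j).2.
  apply: contrapT => ne; apply: (nk j.+1).
  have sE : branchof C (mkseq h j.+1) `<=` [set x | coord j x = (h j).2].
    by move=> x [u [/mkseqE e _ ux]] /=; rewrite ux e.
  have sF : branchof D (mkseq g j.+1) `<=` [set x | coord j x = (g j).2].
    by move=> x [u [/mkseqE e _ ux]] /=; rewrite ux e.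
  apply: separable_sub sE sF _; exists [set x | coord j x = (h j).2]; split=> //; last first.
    by move=> x /= -> e; apply: ne.
  case: (h j).2; first exact: B_coord.
  rewrite (_ : [set _ | _] = ~` [set x | coord j x]); first exact: B_setC.
  by rewrite predeqE => x /=; case: coord; split.
have neE k : exists x, branchof C (mkseq h k) x.
  apply: contrapT => em; apply: (nk k); exists set0; split; first exact: B0.
    by move=> x Ex; case: em; exists x.
  by move=> x _.
have neF k : exists x, branchof D (mkseq g k) x.
  apply: contrapT => em; apply: (nk k); exists setT; split=> //; last by move=> x Ex; case: em; exists x.
  by rewrite -setC0; apply: B_setC; apply: B0.
have [|x hx] := coord_onto (b := fun j => (h j).2).
  move=> k; have [x [u [/mkseqE e _ ux]]] := neE k; exists x => j jk.
  by rewrite ux e.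
apply: (EF x).
  apply/EC; exists (fun k => (h k).1); apply: contrapT => /Ccl [k hk].
  have [y [u [/mkseqE e Cy uy]]] := neE k; apply: (hk y (fun k => (u k).1)) => //.
    by move=> j jk; rewrite hx uy e.
  by move=> i ik; rewrite e.
apply/FD; exists (fun k => (g k).1); apply: contrapT => /Dcl [k hk].
have [y [u [/mkseqE e Cy uy]]] := neF k; apply: (hk y (fun k => (u k).1)) => //.
  by move=> j jk; rewrite hx uy e // hg.
by move=> i ik; rewrite e.
Qed.

End Lusin.

(** * Analytic sets of environments *)

Section Environments.
Variables (L : signature) (A : Type) (M : henkin L A).
Variable idx : A -> nat.
Hypothesis idx_inj : injective idx.
Hypothesis stdM : standard M.

Definition env : Type := forall m, nat -> set (m.+1.-tuple A).

Definition tidx n (t : n.-tuple A) : nat := pickle (map idx t).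

Lemma tidx_inj n : injective (@tidx n).
Proof.
move=> s t /(pcan_inj pickleK) e; apply: val_inj.
by apply: inj_map e.
Qed.

Definition place : Type := {m : nat & (nat * m.+1.-tuple A)%type}.

Definition agree (s : seq place) (rv rv' : env) : Prop :=
  forall j, List.In j s -> rv (tag j) (tagged j).1 (tagged j).2 <-> rv' (tag j) (tagged j).1 (tagged j).2.

Definition closed_env (C : env -> (nat -> nat) -> Prop) : Prop :=
  forall rv f, ~ C rv f -> exists s k, forall rv' g,
    agree s rv rv' -> (forall i, i < k -> f i = g i) -> ~ C rv' g.

Definition analytic_env (E : env -> Prop) : Prop :=
  exists2 C, closed_env C & forall rv, E rv <-> exists f, C rv f.

(** A condition on finitely many places is clopen, so a dummy witness will do. *)
Lemma analytic_finite s (E : env -> Prop) :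
  (forall rv rv', agree s rv rv' -> E rv -> E rv') -> analytic_env E.
Proof.
move=> h; exists (fun rv _ => E rv).
  move=> rv f nE; exists s, 0 => rv' g ag _ E'; apply: nE; apply: h E'.
  by move=> j js; split=> ?; apply/(ag j js).
by move=> rv; split=> [|[]//]; exists (fun _ => 0).
Qed.

Lemma analytic_ext E F : (forall rv, E rv <-> F rv) -> analytic_env E -> analytic_env F.
Proof. by move=> h [C cl hC]; exists C => // rv; rewrite -h. Qed.

Section Countable.
Variables (Z : Type) (zi : Z -> nat).
Hypothesis zi_inj : injective zi.

(** One point of the Baire space codes a whole family of witnesses, one for each [z]. *)
Lemma analytic_all (E : Z -> env -> Prop) :
  (forall z, analytic_env (E z)) -> analytic_env (fun rv => forall z, E z rv).
Proof.
move=> hE; have /choice[C hC] : forall z, exists C, closed_env C /\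
    forall rv, E z rv <-> exists f, C rv f by move=> z; case: (hE z) => C; exists C.
exists (fun rv f => forall z, C z rv (fun k => f (pickle (zi z, k)))).
  move=> rv f /existsNP[z nC]; have [cl _] := hC z; have [s [k hk]] := cl _ _ nC.
  (* The bound exceeds the positions at which the first [k] values of the component for [z] are
     stored. *)
  exists s, (\max_(j < k) (pickle (zi z, val j)).+1) => rv' g ag fg /(_ z).
  apply: hk => // i ik; apply: fg.
  exact: (leq_bigmax (F := fun j : 'I_k => (pickle (zi z, val j)).+1) (Ordinal ik)).
move=> rv; split=> [h|[f hf] z]; last first.
  by apply/(hC z).2; exists (fun k => f (pickle (zi z, k))).
have /choice[F hF] : forall z, exists f, C z rv f by move=> z; apply/(hC z).2.
have /choice[G hG] : forall j : nat, exists f : nat -> nat, forall z, zi z = j -> f = F z.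
  move=> j; case: (EM (exists z, zi z = j)) => [[z <-]|nz].
    by exists (F z) => y /zi_inj ->.
  by exists id => z zj; case: nz; exists z.
exists (fun j => if unpickle j is Some (a, k) then G a k else 0) => z.
rewrite (_ : (fun k => _) = F z) //; apply/funext => k; rewrite pickleK.
by rewrite (hG _ z).
Qed.

(** The first value of the witness names [z], the others form a witness for it. *)
Lemma analytic_ex (E : Z -> env -> Prop) :
  (forall z, analytic_env (E z)) -> analytic_env (fun rv => exists z, E z rv).
Proof.
move=> hE; have /choice[C hC] : forall z, exists C, closed_env C /\
    forall rv, E z rv <-> exists f, C rv f by move=> z; case: (hE z) => C; exists C.
exists (fun rv f => exists z, zi z = f 0 /\ C z rv (fun k => f k.+1)).
  move=> rv f nC; case: (EM (exists z, zi z = f 0)) => [[z zf]|nz]; last first.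
    exists [::], 1 => rv' g _ fg [z [zg _]]; apply: nz; exists z.
    by rewrite zg fg.
  have [|s [k hk]] := (hC z).1 rv (fun k => f k.+1); first by move=> h; apply: nC; exists z.
  exists s, k.+1 => rv' g ag fg [y [yg Cy]].
  have yz : y = z by apply: zi_inj; rewrite yg zf fg.
  rewrite yz in Cy; apply: (hk rv' (fun k => g k.+1)) => // i ik.
  exact: fg.
move=> rv; split=> [[z /(hC z).2 [f hf]]|[f [z [_ hz]]]].
  by exists (fun k => if k is k'.+1 then f k' else zi z), z.
by exists z; apply/(hC z).2; exists (fun k => f k.+1).
Qed.

End Countable.

Lemma nat_of_bool_inj : injective nat_of_bool. Proof. by case=> -[]. Qed.

Lemma analytic_and E F : analytic_env E -> analytic_env F ->
  analytic_env (fun rv => E rv /\ F rv).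
Proof.
move=> hE hF; have := analytic_all nat_of_bool_inj (E := fun b => if b then E else F).
move=> /(_ _) h; apply: analytic_ext (h _) => [rv|[]//].
by split=> [H|[? ?] []//]; split; [apply: (H true)|apply: (H false)].
Qed.

Lemma analytic_or E F : analytic_env E -> analytic_env F ->
  analytic_env (fun rv => E rv \/ F rv).
Proof.
move=> hE hF; have := analytic_ex nat_of_bool_inj (E := fun b => if b then E else F).
move=> /(_ _) h; apply: analytic_ext (h _) => [rv|[]//].
by split=> [[[]]|[]]; [left|right|exists true|exists false].
Qed.

Lemma analytic_place n X t (b : bool) :
  analytic_env (fun rv : env => if b then rv n X t else ~ rv n X t).
Proof.
apply: (analytic_finite (s := [:: existT _ n (X, t)])) => rv rv' ag.
have /= e := ag _ (or_introl erefl); by case: b => /=; rewrite e.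
Qed.

(** The relation is coded by the even positions of the witness, the witness for [E] by the odd
    ones. *)
Lemma analytic_SEx n X (E : env -> Prop) : analytic_env E ->
  analytic_env (fun rv => exists S : set (n.+1.-tuple A), E (rupd rv X S)).
Proof.
move=> [C cl hC].
pose dec (f : nat -> nat) : set (n.+1.-tuple A) := [set t | f (tidx t).*2 = 1].
exists (fun rv f => C (rupd rv X (dec f)) (fun k => f k.*2.+1)).
  move=> rv f /cl [s [k hk]].
  (* Far enough for the first [k] odd positions and for the even positions of all tuples in [s],
     which settle the places of the quantified variable. *)
  exists s, (k.*2 + \max_(j <- s) (tidx (tagged j).2).*2.+1)%N => rv' g ag fg; apply: hk; last first.
    by move=> i ik; apply: fg; rewrite ltn_addr // -doubleS leq_double.
  move=> [m [Y t]] /= js; case: (eqVneq (m, Y) (n, X)) => [e|ne]; last first.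
    by rewrite !rupd_other //; exact: (ag _ js).
  case: e js => em ->; move: t; rewrite em => t js; rewrite !rupd_same /dec /= fg //.
  apply: leq_trans (leq_addl _ _); elim: (s) js => //= j s' IH; rewrite big_cons.
  by move=> [->|/IH h]; rewrite leq_max ?leqnn // h orbT.
move=> rv; split=> [[S /hC [f hf]]|[f hf]]; last by exists (dec f); apply/hC; eexists; exact: hf.
exists (fun j => if odd j then f j./2 else `[< exists2 t, S t & (tidx t).*2 = j >] : nat).
rewrite (_ : dec _ = S); last first.
  rewrite predeqE => t; rewrite /dec /= odd_double; case: asboolP => [[u Su]|h] /=.
    by move=> /double_inj /tidx_inj <-.
  by split=> // St; case: h; exists t.
rewrite (_ : (fun k => _) = f) //; apply/funext => k.
by rewrite /= odd_double /= uphalf_double.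
Qed.

(** The polarity [b] moves negations inwards: conjunction and first-order quantifiers are analytic
    operations in both polarities, and [sigma] admits second-order quantifiers only for [b] true. *)
Lemma analytic_sat p b iv : sigma b p ->
  analytic_env (fun rv => if b then sat M iv rv p else ~ sat M iv rv p).
Proof.
elim: p b iv => [s t|n X Y|n X ts|C ts|p IH|p IHp q IHq|x p IH|n X p IH] b iv sp.
- by apply: (analytic_finite (s := [::])).
- case: b {sp} => /=.
    apply: analytic_ext (analytic_all (@tidx_inj n.+1)
      (E := fun t rv => (rv n X t /\ rv n Y t) \/ (~ rv n X t /\ ~ rv n Y t)) _).
      move=> rv; rewrite predeqE; split=> h t; have := h t; first by tauto.
      by case: (EM (rv n X t)) => ?; tauto.
    move=> t; apply: analytic_or; apply: analytic_and; 
    [exact: (analytic_place X t true)|exact: (analytic_place Y t true)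
    |exact: (analytic_place X t false)|exact: (analytic_place Y t false)].
  apply: analytic_ext (analytic_ex (@tidx_inj n.+1)
      (E := fun t rv => (rv n X t /\ ~ rv n Y t) \/ (~ rv n X t /\ rv n Y t)) _).
    move=> rv; split=> [[t h] e|h]; first by rewrite e in h; tauto.
    apply: contrapT => h'; apply: h; rewrite predeqE => t; apply: contrapT => ht.
    by apply: h'; exists t; case: (EM (rv n X t)) => ?; case: (EM (rv n Y t)) => ?; tauto.
  move=> t; apply: analytic_or; apply: analytic_and;
    [exact: (analytic_place X t true)|exact: (analytic_place Y t false)
    |exact: (analytic_place X t false)|exact: (analytic_place Y t true)].
- exact: analytic_place.
- by apply: (analytic_finite (s := [::])).
- apply: analytic_ext (IH (~~ b) iv sp) => rv; case: b {sp} => //=.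
  by rewrite not_notE.
- case/andP: sp => sp sq; case: b sp sq => sp sq.
    by apply: analytic_and; [apply: (IHp true)|apply: (IHq true)].
  apply: analytic_ext (analytic_or (IHp false iv sp) (IHq false iv sq)) => rv /=.
  by rewrite not_andE.
- case: b sp => sp.
    by apply: (analytic_ex idx_inj) => a; apply: (IH true).
  apply: analytic_ext (analytic_all idx_inj (fun a => IH false (fun y => if y == x then a else iv y) sp)) => rv /=.
  by split=> [h [a /h]|h a ha] //; apply: h; exists a.
- case/andP: sp => -> sp.
  have := @analytic_SEx n X _ (IH true iv sp); apply: analytic_ext => rv /=.
  by split=> [[S h]|[S _ h]]; exists S => //; rewrite stdM.
Qed.

End Environments.

(** * Borel quantifiers *)

Lemma coordinate_continuous (I : Type) (K : I -> topologicalType) (i : I) :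
  continuous (fun f : prod_topology K => f i).
Proof.
move=> f S fS; have /cvg_sup/(_ i) h : f --> f by apply: cvg_id.
by apply: h; apply: (@initial_continuous _ _ (fun f : forall i, K i => f i)).
Qed.

Section BorelQuantifier.
Variables (L : signature) (A : Type) (l : nat) (n : 'I_l -> nat).
Variable idx : A -> nat.
Hypothesis idx_inj : injective idx.

Definition code (i : 'I_l) (t : (n i).+1.-tuple A) : nat := pickle (val i, tidx idx t).

Lemma code_inj (u : relspace A n) i (t : (n i).+1.-tuple A) j (s : (n j).+1.-tuple A) :
  code t = code s -> u i t = u j s.
Proof.
move=> /(pcan_inj pickleK) [/val_inj ij]; case: j / ij s => s /(tidx_inj idx_inj) ->.
by [].
Qed.

Definition rcoord (j : nat) (u : relspace A n) : bool :=
  `[< exists i (t : (n i).+1.-tuple A), code t = j /\ u i t >].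

Lemma rcoord_code i (t : (n i).+1.-tuple A) u : rcoord (code t) u = u i t.
Proof.
apply/asboolP/idP => [[j [s [/(code_inj u) e h]]]|h]; first by rewrite -e.
by exists i, t.
Qed.

Lemma rcoord_onto (b : nat -> bool) :
  (forall k, exists u, forall j, j < k -> rcoord j u = b j) ->
  exists u, forall j, rcoord j u = b j.
Proof.
move=> h; exists (fun i t => b (code t)) => j.
case: (EM (exists i (t : (n i).+1.-tuple A), code t = j)) => [[i [t <-]]|ne].
  by rewrite rcoord_code.
have [u /(_ j (leqnn _)) <-] := h j.+1.
by apply/asboolP/asboolP => -[i [t [e _]]]; case: ne; exists i, t.
Qed.

Lemma open_coord i (t : (n i).+1.-tuple A) : open [set u : relspace A n | u i t].
Proof.
have c1 : continuous (fun u : relspace A n => u i).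
  exact: (@coordinate_continuous _ (fun i : 'I_l => prod_topology (fun _ : (n i).+1.-tuple A => bool)) i).
have c2 : continuous (fun v : prod_topology (fun _ : (n i).+1.-tuple A => bool) => v t).
  exact: (@coordinate_continuous _ (fun _ : (n i).+1.-tuple A => bool) t).
have c : continuous (fun u : relspace A n => u i t).
  by move=> u; exact: (@continuous_comp (relspace A n) _ bool (fun u : relspace A n => u i)
    (fun v : prod_topology (fun _ : (n i).+1.-tuple A => bool) => v t) u (c1 u) (c2 (u i))).
have /continuousP h := c; apply: (h [set b : bool | b]).
exact: (@discrete_open bool).
Qed.

Lemma borel_rcoord j : borel [set u : relspace A n | rcoord j u].
Proof.
case: (EM (exists i (t : (n i).+1.-tuple A), code t = j)) => [[i [t <-]]|ne].
  apply: sub_sigma_algebra; rewrite (_ : [set u | _] = [set u : relspace A n | u i t]).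
    exact: open_coord.
  by rewrite predeqE => u /=; rewrite rcoord_code.
rewrite (_ : [set u | _] = set0); first exact: sigma_algebra0.
rewrite -subset0 => u /asboolP [i [t [e _]]]; by case: ne; exists i, t.
Qed.

Definition renv (u : relspace A n) : env A :=
  display (fun i => [set t | u i t]) (fun _ _ => set0).

Lemma renv_agree s : exists k, forall u v, agree_upto rcoord k u v -> agree s (renv u) (renv v).
Proof.
elim: s => [|[m [X t]] s [k hk]]; first by exists 0 => u v _ j [].
have [k' hk'] : exists k, forall u v, agree_upto rcoord k u v -> renv u X t <-> renv v X t.
  case: (EM (exists i : 'I_l, (m, X) = (n i, val i))) => [[i [e e']]|ne].
    move: t; rewrite e e' => t; exists (code t).+1 => u v /(_ (code t) (leqnn _)).
    by rewrite !rcoord_code /renv !displayE /= => ->.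
  exists 0 => u v _; rewrite /renv !display_other // => i; apply/eqP => e; by apply: ne; exists i.
exists (maxn k k') => u v uv j /= [<-|js] /=.
  by apply: hk' => i ik; apply: uv; rewrite leq_max ik orbT.
by apply: hk => // i ik; apply: uv; rewrite leq_max ik.
Qed.

Lemma analytic_renv (E : env A -> Prop) : analytic_env E ->
  analytic rcoord [set u | E (renv u)].
Proof.
move=> [C cl hC]; exists (fun u f => C (renv u) f); last by move=> u; apply: hC.
move=> u f /cl [s [k hk]]; have [k' hk'] := renv_agree s.
exists (maxn k k') => v g uv fg; apply: hk.
  by apply: hk' => i ik; apply: uv; rewrite leq_max ik orbT.
by move=> i ik; apply: fg; rewrite leq_max ik.
Qed.

Variables (T : set (formula L)) (Q : formula L) (M : henkin L A).
Hypotheses (genQ : gen_quantifier n Q) (indQ : domain_independent T n Q).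
Hypotheses (stdM : standard M) (MT : models M T).

Lemma borel_quantifier_set : borel (quantifier_set M n Q).
Proof.
have [p sp hp] := interpolation genQ indQ.
have genNQ : gen_quantifier n (FNot Q) := genQ.
have [q sq hq] := interpolation genNQ (domain_independent_FNot genQ indQ).
case: (hdom M) => a; pose iv (_ : nat) := a.
have EP u : quantifier_set M n Q u <-> sat M iv (renv u) p.
  rewrite -(hp _ _ _ _ MT (standard_valid _ stdM)).
  by apply: (satQE genQ _ (standard_valid _ stdM)) => i; apply: displayE.
have EQ u : (~` quantifier_set M n Q) u <-> sat M iv (renv u) q.
  rewrite -(hq _ _ _ _ MT (standard_valid _ stdM)) /=.
  rewrite -(satQE genQ (R := fun i => [set t | u i t]) iv (standard_valid _ stdM)) //.
  by move=> i; apply: displayE.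
have aP := analytic_renv (analytic_sat (M := M) idx_inj stdM (b := true) iv sp).
have aQ := analytic_renv (analytic_sat (M := M) idx_inj stdM (b := true) iv sq).
have [|S [BS PS QS]] := lusin borel_rcoord (@sigma_algebraC _ _)
  (@sigma_algebra_bigcup _ setT _) rcoord_onto aP aQ.
  by move=> u /EP h1 /EQ; apply.
rewrite (_ : quantifier_set M n Q = S) // predeqE => u; split.
  by move=> /EP /PS.
by move=> Su; apply: contrapT => /EQ /QS; apply.
Qed.

End BorelQuantifier.

(** * Nondeterministic programs *)

Record store := Store {
  cnt : nat -> nat;
  arr : nat -> seq bool * seq bool;
  inp : seq bool
}.

Definition upd T (f : nat -> T) k v : nat -> T := fun j => if j == k then v else f j.

Definition setc s k v := Store (upd (cnt s) k v) (arr s) (inp s).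
Definition seta s k z := Store (cnt s) (upd (arr s) k z) (inp s).
Definition seti s w := Store (cnt s) (arr s) w.

(* An array [(l, r)] is a tape whose head is behind the bits [rev l] and in
   front of the bits [r]. *)
Inductive op :=
| Inc of nat
| Dec of nat
| Zero of nat
| Put of nat & bool
| Get of nat & bool
| Back of nat
| AtStart of nat
| InGet of bool
| InEnd.

Definition opsem (o : op) (s s' : store) : Prop :=
  match o with
  | Inc k => s' = setc s k (cnt s k).+1
  | Dec k => 0 < cnt s k /\ s' = setc s k (cnt s k).-1
  | Zero k => cnt s k = 0 /\ s' = s
  | Put k b => s' = seta s k (b :: (arr s k).1, behead (arr s k).2)
  | Get k b => exists2 r, (arr s k).2 = b :: r & s' = seta s k (b :: (arr s k).1, r)
  | Back k => exists b l, (arr s k).1 = b :: l /\ s' = seta s k (l, b :: (arr s k).2)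
  | AtStart k => (arr s k).1 = [::] /\ s' = s
  | InGet b => exists2 w, inp s = b :: w & s' = seti s w
  | InEnd => inp s = [::] /\ s' = s
  end.

(** Regular programs. A run that meets an operation without a successor store is lost, so tests are
    operations that may block, and a loop is [Star] followed by a test that blocks if the loop is
    left too early. *)
Inductive prog :=
| Do of op
| Skip
| Stop
| Seq of prog & prog
| Alt of prog & prog
| Star of prog.

Inductive star (R : nat -> store -> store -> Prop) : nat -> store -> store -> Prop :=
| star0 s : star R 1 s s
| starS t1 t2 s1 s2 s3 : R t1 s1 s2 -> star R t2 s2 s3 -> star R (t1 + t2).+1 s1 s3.

(** The number counts exactly the steps of the compiled machine: two instructions for an operation,
    one step for [Skip], for a choice in [Alt], and for each entry to or exit from the body of
    [Star]. *)
Fixpoint exec (p : prog) : nat -> store -> store -> Prop :=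
  match p with
  | Do o => fun t s s' => t = 2 /\ opsem o s s'
  | Skip => fun t s s' => t = 1 /\ s' = s
  | Stop => fun t s s' => False
  | Seq p q => fun t s s' =>
      exists t1 t2 s1, [/\ t = t1 + t2, exec p t1 s s1 & exec q t2 s1 s']
  | Alt p q => fun t s s' =>
      exists2 t', t = t'.+1 & exec p t' s s' \/ exec q t' s s'
  | Star p => star (exec p)
  end.

(** * Stores on tapes *)

Definition sym : Type := option (bool + void).
Definition B (b : bool) : sym := Some (inl b).

Definition tid : Type := option (bool * nat).
Definition tinp : tid := None.
Definition tcnt (k : nat) : tid := Some (true, k).
Definition tarr (k : nat) : tid := Some (false, k).

Record instr := Instr { itid : tid; iact : sym -> option sym; imove : move }.

Definition only (a : sym) : sym -> option sym := fun b => if b == a then Some b else None.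
Definition nonblank : sym -> option sym := fun b => if b is Some _ then Some b else None.

(** A machine writes before it moves, but [Inc], [Put] and [Get] act on the cell reached by the
    move; so every operation is compiled to two instructions on the same tape. *)
Definition instr1 (o : op) : instr :=
  match o with
  | Inc k => Instr (tcnt k) Some MoveR
  | Dec k => Instr (tcnt k) (fun b => if b is Some _ then Some None else None) MoveL
  | Zero k => Instr (tcnt k) (only None) MoveN
  | Put k _ => Instr (tarr k) Some MoveR
  | Get k _ => Instr (tarr k) Some MoveR
  | Back k => Instr (tarr k) nonblank MoveL
  | AtStart k => Instr (tarr k) (only None) MoveN
  | InGet b => Instr tinp (only (B b)) MoveR
  | InEnd => Instr tinp (only None) MoveN
  end.

Definition instr2 (o : op) : instr :=
  match o with
  | Inc k => Instr (tcnt k) (fun _ => Some (B true)) MoveN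
  | Put k b => Instr (tarr k) (fun _ => Some (B b)) MoveN
  | Get k b => Instr (tarr k) (only (B b)) MoveN
  | Dec k | Zero k => Instr (tcnt k) Some MoveN
  | Back k | AtStart k => Instr (tarr k) Some MoveN
  | _ => Instr tinp Some MoveN
  end.

Definition ltape : Type := (seq sym * seq sym)%type.

Definition istep (i : instr) (t t' : ltape) : Prop :=
  exists2 b, iact i (head None t.2) = Some b &
    t' = match imove i with
         | MoveL => (behead t.1, head None t.1 :: b :: behead t.2)
         | MoveN => (t.1, b :: behead t.2)
         | MoveR => (b :: t.1, behead t.2)
         end.

(* Tapes matter up to trailing blanks. *)
Definition teq (t t' : ltape) : Prop :=
  nth None t.1 =1 nth None t'.1 /\ nth None t.2 =1 nth None t'.2.

(** The head rests on the last bit to its left, or on a blank if there is none. Hence a blank under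
    the head means the start of an array, or zero for a counter, which is kept as a block of
    ones. *)
Definition zlist (z : seq bool * seq bool) : ltape :=
  (map B (behead z.1), (if z.1 is b :: _ then B b else None) :: map B z.2).

(** The input is read once, so only the part from the head on is recorded. *)
Definition trep (i : tid) (t : ltape) (s : store) : Prop :=
  match i with
  | None => nth None t.2 =1 nth None (map B (inp s))
  | Some (true, k) => teq t (zlist (nseq (cnt s k) true, [::]))
  | Some (false, k) => teq t (zlist (arr s k))
  end.

Lemma trep_teq i t t' s : teq t t' -> trep i t s -> trep i t' s.
Proof.
move=> [h1 h2]; case: i => [[[] k]|] /=; rewrite /teq; try by move=> [h3 h4]; split=> j; rewrite -?h1 -?h2.
by move=> h j; rewrite -h2.
Qed.

Lemma opsem_other o s s' j t : opsem o s s' -> j != itid (instr1 o) -> trep j t s -> trep j t s'.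
Proof.
case: o => [k|k|k|k b|k b|k|k|b|] /=.
- by move=> ->; case: j => [[[] m]|] //= ne; rewrite /upd; case: eqP => // e; rewrite e eqxx in ne.
- by move=> [_ ->]; case: j => [[[] m]|] //= ne; rewrite /upd; case: eqP => // e; rewrite e eqxx in ne.
- by move=> [_ ->].
- by move=> ->; case: j => [[[] m]|] //= ne; rewrite /upd; case: eqP => // e; rewrite e eqxx in ne.
- by move=> [r _ ->]; case: j => [[[] m]|] //= ne; rewrite /upd; case: eqP => // e; rewrite e eqxx in ne.
- by move=> [b [r [_ ->]]]; case: j => [[[] m]|] //= ne; rewrite /upd; case: eqP => // e; rewrite e eqxx in ne.
- by move=> [_ ->].
- by move=> [w _ ->]; case: j => [[[] m]|].
- by move=> [_ ->].
Qed.

Lemma itid2 o : itid (instr2 o) = itid (instr1 o).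
Proof. by case: o. Qed.

Lemma head_nth (T : Type) (d : T) s : head d s = nth d s 0. Proof. by case: s. Qed.

Lemma teq_id t : teq t (t.1, head None t.2 :: behead t.2).
Proof. by split=> // -[|i] /=; rewrite ?head_nth ?nth_behead. Qed.

Lemma op_sound o s t t1 t2 : trep (itid (instr1 o)) t s ->
  istep (instr1 o) t t1 -> istep (instr2 o) t1 t2 ->
  exists2 s', opsem o s s' & trep (itid (instr1 o)) t2 s'.
Proof.
case: o => [k|k|k|k b|k b|k|k|b|] /= ht [a1 /= e1 ->] [a2 /= e2 ->] /=.
- move: e1 e2 => [e1] [e2]; eexists; first by []; rewrite /= /upd eqxx.
  case: ht => h1 h2; split=> -[|i] /=; rewrite -?e1 -?e2 ?head_nth ?nth_behead ?h1 ?h2 //=.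
  + by case: (cnt s k).
  + by case: (cnt s k) => //=; case: i.
  + by case: i => [|[|i]].
- case: ht => h1 h2; move: e1; rewrite head_nth h2 /=; case: (cnt s k) h1 h2 => //= n h1 h2 [e1].
  move: e2 => [e2]; eexists; first by [].
  rewrite /= /upd eqxx /=; split=> i /=; rewrite ?nth_behead ?h1 //=.
    by case: (n) => //=; case: i.
  case: i => [|[|i]] /=; rewrite -?e2 -?e1 /= ?head_nth ?h1 //=.
    by case: n {h1 h2 e2}.
  by rewrite nth_behead h2 /= nth_nil.
- move: e1 e2; rewrite /only; case: eqP => // e [e1] [e2]; exists s.
    case: ht => h1 h2; split=> //.
    by move: e; rewrite head_nth h2 /=; case: (cnt s k).
  rewrite -e2 -e1; exact: (trep_teq (i := tcnt k) (teq_id t) ht).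
- move: e1 e2 => [e1] [e2]; eexists; first by []; rewrite /= /upd eqxx.
  case: ht => h1 h2; split=> -[|i] /=; rewrite -?e1 -?e2 ?head_nth ?nth_behead ?h1 ?h2 //=.
  + by case: (arr s k).1.
  + by case: (arr s k).1 => //=; case: i.
  + by rewrite -behead_map nth_behead.
- case: ht => h1 h2; move: e1 e2 => [e1]; rewrite /only; case: eqP => // e [e2].
  move: e; rewrite head_nth nth_behead h2 /=; case er: (arr s k).2 => [//|c r] /= [e].
  eexists; first by exists r; [rewrite e|].
  rewrite /= /upd eqxx.
  split=> -[|i] /=; rewrite -?e1 -?e2 ?head_nth ?nth_behead ?h1 ?h2 //= ?er //=.
  + by case: (arr s k).1.
  + by case: (arr s k).1 => //=; case: i.
  + by rewrite e.
- case: ht => h1 h2; move: e1; rewrite /nonblank head_nth h2 /=.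
  case el: (arr s k).1 => [//|c l] [e1]; move: e2 => [e2].
  eexists; first by exists c, l.
  rewrite /= /upd eqxx /=; split=> i /=; rewrite ?nth_behead ?h1 ?el //=.
    by rewrite el; case: (l) => //=; case: i.
  case: i => [|[|i]] /=; rewrite -?e2 -?e1 /= ?head_nth ?h1 /= ?el //=.
    by case: (l).
  by rewrite nth_behead h2.
- move: e1 e2; rewrite /only; case: eqP => // e [e1] [e2]; exists s.
    case: ht => h1 h2; split=> //.
    by move: e; rewrite head_nth h2 /=; case: (arr s k).1.
  rewrite -e2 -e1; exact: (trep_teq (i := tarr k) (teq_id t) ht).
- move: e1; rewrite /only; case: eqP => // e [e1]; move: e2 => [e2].
  move: e; rewrite head_nth ht; case ew: (inp s) => [//|c w] [e].
  eexists; first by exists w; [rewrite e|].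
  move=> /= i; case: i => [|i] /=; rewrite -?e2 ?head_nth ?nth_behead ht ew //=.
- move: e1 e2; rewrite /only; case: eqP => // e [e1] [e2]; exists s.
    split=> //; move: e; rewrite head_nth ht; by case: (inp s).
  rewrite -e2 -e1; exact: (trep_teq (i := tinp) (teq_id t) ht).
Qed.

Lemma op_complete o s s' t : trep (itid (instr1 o)) t s -> opsem o s s' ->
  exists t1 t2, istep (instr1 o) t t1 /\ istep (instr2 o) t1 t2.
Proof.
case: o => [k|k|k|k b|k b|k|k|b|] /= ht.
- by move=> _; do 2!eexists; split; [exists (head None t.2)|exists (B true)].
- case: ht => h1 h2 [c0 _]; do 2!eexists; split; [exists None => //=|eexists; [reflexivity|reflexivity]].
  by rewrite head_nth h2 /=; case: (cnt s k) c0.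
- case: ht => h1 h2 [c0 _]; do 2!eexists; split; [exists None => //=|eexists; [reflexivity|reflexivity]].
  by rewrite head_nth h2 /= c0.
- by move=> _; do 2!eexists; split; [exists (head None t.2)|exists (B b)].
- case: ht => h1 h2 [r er _]; do 2!eexists; split; [exists (head None t.2) => //=|exists (B b); [|reflexivity]].
  by rewrite /= head_nth nth_behead h2 /= er /= /only eqxx.
- case: ht => h1 h2 [b [l [el _]]]; do 2!eexists; split; [exists (B b) => //=|eexists; [reflexivity|reflexivity]].
  by rewrite head_nth h2 /= el.
- case: ht => h1 h2 [c0 _]; do 2!eexists; split; [exists None => //=|eexists; [reflexivity|reflexivity]].
  by rewrite head_nth h2 /= c0.
- move=> [w ew _]; do 2!eexists; split; [exists (B b) => //=|eexists; [reflexivity|reflexivity]].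
  by rewrite head_nth ht ew /= /only eqxx.
- move=> [ew _]; do 2!eexists; split; [exists None => //=|eexists; [reflexivity|reflexivity]].
  by rewrite head_nth ht ew.
Qed.

Lemma opsem_fun o s s1 s2 : opsem o s s1 -> opsem o s s2 -> s1 = s2.
Proof.
case: o => [k|k|k|k b|k b|k|k|b|] /=; try by move=> -> ->.
- by move=> [_ ->] [_ ->].
- by move=> [_ ->] [_ ->].
- by move=> [r e ->] [r' e' ->]; move: e; rewrite e' => -[->].
- by move=> [b [l [e ->]]] [b' [l' [e' ->]]]; move: e; rewrite e' => -[-> ->].
- by move=> [_ ->] [_ ->].
- by move=> [r e ->] [r' e' ->]; move: e; rewrite e' => -[->].
- by move=> [_ ->] [_ ->].
Qed.

(** * Compilation of programs to machines *)

Fixpoint St (p : prog) : finType :=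
  match p with
  | Do _ => bool
  | Skip | Stop => unit
  | Seq p q => (St p + St q)%type
  | Alt p q => option (St p + St q)
  | Star p => option (St p)
  end.

Fixpoint entry (p : prog) : St p :=
  match p with
  | Do _ => false
  | Skip | Stop => tt
  | Seq p _ => inl (entry p)
  | Alt _ _ | Star _ => None
  end.

(* The successors of a state; the target [None] is the exit of the program,
   and a missing instruction means that the tapes do not change. *)
Fixpoint succ (p : prog) : St p -> seq (option instr * option (St p)) :=
  match p return St p -> seq (option instr * option (St p)) with
  | Do o => fun x =>
      if x then [:: (Some (instr2 o), None)] else [:: (Some (instr1 o), Some true)]
  | Skip => fun _ => [:: (None, None)]
  | Stop => fun _ => [::]
  | Seq p q => fun x =>
      match x with
      | inl x => [seq (e.1, Some (if e.2 is Some x' then inl x' else inr (entry q))) | e <- succ x]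
      | inr y => [seq (e.1, omap inr e.2) | e <- succ y]
      end
  | Alt p q => fun x =>
      match x with
      | None => [:: (None, Some (Some (inl (entry p)))); (None, Some (Some (inr (entry q))))]
      | Some (inl x) => [seq (e.1, omap (fun x' => Some (inl x')) e.2) | e <- succ x]
      | Some (inr y) => [seq (e.1, omap (fun y' => Some (inr y')) e.2) | e <- succ y]
      end
  | Star p => fun x =>
      match x with
      | None => [:: (None, None); (None, Some (Some (entry p)))]
      | Some x => [seq (e.1, Some e.2) | e <- succ x]
      end
  end.

Fixpoint uses (p : prog) : seq tid :=
  match p with
  | Do o => [:: itid (instr1 o)]
  | Skip | Stop => [::]
  | Seq p q | Alt p q => uses p ++ uses q
  | Star p => uses p
  end.

Section Compile.
Variable others : seq tid.
Let ids : seq tid := tinp :: others.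
Let K : nat := size others.

Definition tapes : Type := K.+1.-tuple ltape.
Definition tget (tp : tapes) (i : tid) : ltape := nth ([::], [::]) tp (index i ids).

Definition crep (tp : tapes) (s : store) : Prop :=
  forall i, i \in ids -> trep i (tget tp i) s.

Definition lrel (lab : option instr) (tp tp' : tapes) : Prop :=
  forall i, i \in ids ->
    match lab with
    | Some ins => if i == itid ins then istep ins (tget tp i) (tget tp' i)
                  else teq (tget tp i) (tget tp' i)
    | None => teq (tget tp i) (tget tp' i)
    end.

Lemma star_snoc R t1 s1 s2 t2 s3 : star R t1 s1 s2 -> R t2 s2 s3 ->
  star R (t1 + t2).+1 s1 s3.
Proof.
elim=> [s|t t' u v w Ruv _ IH] h; first by rewrite addnC; apply: starS h (star0 _ _).
by rewrite addSn -addnA -addnS; apply: starS Ruv _; apply: IH.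
Qed.

(* What is known of the tapes at a state, if the program was entered from [s0]. *)
Fixpoint fden (p : prog) (s0 : store) : St p -> tapes -> Prop :=
  match p return St p -> tapes -> Prop with
  | Do o => fun x tp =>
      if x then exists2 tp0, crep tp0 s0 & lrel (Some (instr1 o)) tp0 tp else crep tp s0
  | Skip | Stop => fun _ tp => crep tp s0
  | Seq p q => fun x tp =>
      match x with
      | inl x => @fden p s0 x tp
      | inr y => exists t s1, exec p t s0 s1 /\ @fden q s1 y tp
      end
  | Alt p q => fun x tp =>
      match x with
      | None => crep tp s0
      | Some (inl x) => @fden p s0 x tp
      | Some (inr y) => @fden q s0 y tp
      end
  | Star p => fun x tp =>
      exists t s1, star (exec p) t s0 s1 /\
        match x with None => crep tp s1 | Some x => @fden p s1 x tp end
  end.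
Arguments fden : clear implicits.

Definition oden (p : prog) (s0 : store) (x : option (St p)) (tp : tapes) : Prop :=
  if x is Some x then fden p s0 x tp
  else exists t s1, exec p t s0 s1 /\ crep tp s1.

Lemma fden_entry p s0 tp : crep tp s0 -> fden p s0 (entry p) tp.
Proof. by elim: p s0 tp => //= p IH s0 tp h; exists 1, s0; split=> //; apply: star0. Qed.

Lemma crep_teq tp tp' s : lrel None tp tp' -> crep tp s -> crep tp' s.
Proof. by move=> h hs i hi; apply: trep_teq (h i hi) (hs i hi). Qed.

Lemma In_map (T U : Type) (f : T -> U) s y :
  List.In y (map f s) <-> exists2 x, List.In x s & y = f x.
Proof.
elim: s => [|x s IH] /=; first by split=> // -[].
split=> [[<-|/IH[z zs ->]]|[z [->|zs] e]]; [by exists x; [left|]|by exists z; [right|]|by left|].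
by right; apply/IH; exists z.
Qed.

(** The invariant is kept along every edge of the program graph, and reaching the exit certifies an
    execution. This gives soundness by induction on the length of a run, although [Star] makes the
    graph cyclic. *)
Lemma fden_step p s0 x tp e tp' : {subset uses p <= ids} ->
  fden p s0 x tp -> List.In e (succ x) -> lrel e.1 tp tp' -> oden s0 e.2 tp'.
Proof.
elim: p s0 x tp e => [o|||p IHp q IHq|p IHp q IHq|p IH] s0 x tp e pids /=.
- case: x => /=.
    move=> [tp0 h0 h1] [<-|//] /= h2; have oi : itid (instr1 o) \in ids by apply: pids; rewrite inE.
    have := h1 _ oi; rewrite eqxx => i1; have := h2 _ oi; rewrite itid2 eqxx => i2.
    have [s1 os1 r1] := op_sound (h0 _ oi) i1 i2.
    exists 2, s1; split=> // j hj; case: (eqVneq j (itid (instr1 o))) => [->//|ne].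
    have := h1 _ hj; have := h2 _ hj; rewrite itid2 (negbTE ne) => e2 e1.
    by apply: trep_teq e2 (trep_teq e1 (opsem_other os1 ne (h0 _ hj))).
  by move=> h [<-|//] /= h'; exists tp.
- by move=> h [<-|//] /= h'; exists 1, s0; split=> //; apply: crep_teq h.
- by [].
- have sp : {subset uses p <= ids} by move=> i hi; apply: pids; rewrite mem_cat hi.
  have sq : {subset uses q <= ids} by move=> i hi; apply: pids; rewrite mem_cat hi orbT.
  case: x => [x|y] /=.
    move=> h /In_map[[l t] he ->] /= hl; have := IHp _ _ _ _ sp h he hl.
    case: t {he} => [x'|] //= [t [s1 [es1 cs1]]].
    by exists t, s1; split=> //; apply: fden_entry.
  move=> [t [s1 [es1 h]]] /In_map[[l u] he ->] /= hl; have := IHq _ _ _ _ sq h he hl.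
  case: u {he} => [x'|] //= h'; first by exists t, s1.
  case: h' => t2 [s2 [es2 cs2]]; exists (t + t2), s2; split=> //.
  by exists t, t2, s1.
- have sp : {subset uses p <= ids} by move=> i hi; apply: pids; rewrite mem_cat hi.
  have sq : {subset uses q <= ids} by move=> i hi; apply: pids; rewrite mem_cat hi orbT.
  case: x => [[x|y]|] /=.
  + move=> h /In_map[[l t] he ->] /= hl; have := IHp _ _ _ _ sp h he hl.
    case: t {he} => [x'|] //= [t [s1 [es1 cs1]]].
    by exists t.+1, s1; split=> //; exists t => //; left.
  + move=> h /In_map[[l t] he ->] /= hl; have := IHq _ _ _ _ sq h he hl.
    case: t {he} => [x'|] //= [t [s1 [es1 cs1]]].
    by exists t.+1, s1; split=> //; exists t => //; right.
  + by move=> h [<-|[<-|//]] /= hl; apply: fden_entry; apply: crep_teq h.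
- move=> [t [s1 [st1 h]]]; case: x h => [x|] /= h.
    move=> /In_map[[l u] he ->] /= hl; have := IH _ _ _ _ pids h he hl.
    case: u {he} => [x'|] /=; first by exists t, s1.
    move=> [t2 [s2 [es2 cs2]]]; exists (t + t2).+1, s2; split=> //.
    exact: star_snoc st1 es2.
  move=> [<-|[<-|//]] /= hl; last by exists t, s1; split=> //; apply: fden_entry; apply: crep_teq h.
  by exists t, s1; split=> //; apply: crep_teq h.
Qed.

Fixpoint walk (S : Type) (sc : S -> seq (option instr * option S)) t (x : option S) tp y tp' : Prop :=
  if t is t'.+1 then
    exists x0 e tp1, [/\ x = Some x0, List.In e (sc x0), lrel e.1 tp tp1 & walk sc t' e.2 tp1 y tp']
  else x = y /\ tp = tp'.

Lemma walk_trans (S : Type) (sc : S -> seq (option instr * option S)) t1 t2 x tp y tp1 z tp2 :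
  walk sc t1 x tp y tp1 -> walk sc t2 y tp1 z tp2 -> walk sc (t1 + t2) x tp z tp2.
Proof.
elim: t1 x tp => [|t IH] x tp /=; first by move=> [-> ->].
by move=> [x0 [e [tp' [? ? ? h]]]] h2; exists x0, e, tp'; split=> //; apply: IH h2.
Qed.

(** The graph of a compound program contains renamed copies of the graphs of its parts, with the
    exit redirected to [o]; walks are transported along the renaming. *)
Lemma walk_map (S S' : Type) (sc : S -> seq (option instr * option S))
    (sc' : S' -> seq (option instr * option S')) (f : S -> S') (o : option S') t x tp y tp' :
  (forall x, sc' (f x) = [seq (e.1, if e.2 is Some x' then Some (f x') else o) | e <- sc x]) ->
  walk sc t x tp y tp' ->
  walk sc' t (if x is Some x' then Some (f x') else o) tp (if y is Some y' then Some (f y') else o) tp'.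
Proof.
move=> h; elim: t x tp => [|t IH] x tp /=; first by move=> [-> ->].
move=> [x0 [e [tp1 [-> he hl hw]]]]; exists (f x0), (e.1, if e.2 is Some x' then Some (f x') else o), tp1.
split=> //; last exact: IH.
by rewrite h; apply/In_map; exists e.
Qed.

Definition tset (tp : tapes) (i : tid) (t : ltape) : tapes :=
  [tuple if j == index i ids :> nat then t else tnth tp j | j < K.+1].

Lemma tgetE (tp : tapes) i (hi : index i ids < K.+1) : tget tp i = tnth tp (Ordinal hi).
Proof. by rewrite /tget (tnth_nth ([::], [::])). Qed.

Lemma ord_eq i m (hi : index i ids < K.+1) : (nat_of_ord (Ordinal hi) == m) = (index i ids == m).
Proof. by []. Qed.

Lemma tget_set tp i t j : i \in ids -> j \in ids ->
  tget (tset tp i t) j = if j == i then t else tget tp j.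
Proof.
move=> hi hj; have hj' : index j ids < K.+1 by rewrite -[K.+1]/(size ids) index_mem.
rewrite !tgetE tnth_mktuple.
rewrite ord_eq.
case: (eqVneq j i) => [ji|ne]; first by subst i; rewrite eqxx.
case: (index j ids =P index i ids) => // e.
have ji : j = i by rewrite -(nth_index tinp hj) e nth_index.
by rewrite ji eqxx in ne.
Qed.

Lemma do_complete o s s' tp : itid (instr1 o) \in ids -> crep tp s -> opsem o s s' ->
  exists tp1 tp2, [/\ lrel (Some (instr1 o)) tp tp1, lrel (Some (instr2 o)) tp1 tp2 & crep tp2 s'].
Proof.
move=> hi hs os; have [t1 [t2 [i1 i2]]] := op_complete (hs _ hi) os.
have [s1 os1 r2] := op_sound (hs _ hi) i1 i2.
pose tp1 := tset tp (itid (instr1 o)) t1; pose tp2 := tset tp1 (itid (instr1 o)) t2.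
exists tp1, tp2; split.
- move=> i hi'; rewrite tget_set //; case: eqP => // ->; exact: i1.
- move=> i hi'; rewrite itid2; case: (eqVneq i (itid (instr1 o))) => [->|ne].
    by rewrite !tget_set // eqxx.
  by rewrite !tget_set // (negbTE ne).
- rewrite -(opsem_fun os1 os) => i hi'; rewrite !tget_set //.
  case: eqP => [->//|/eqP ne]; exact: (opsem_other os1 ne (hs _ hi')).
Qed.

Lemma tnull tp : lrel None tp tp. Proof. by move=> i hi. Qed.

Lemma walk_complete p t s s' tp : {subset uses p <= ids} ->
  exec p t s s' -> crep tp s ->
  exists2 tp', walk (@succ p) t (Some (entry p)) tp None tp' & crep tp' s'.
Proof.
elim: p t s s' tp => [o|||p IHp q IHq|p IHp q IHq|p IH] t s s' tp pids /=.
- move=> [-> os] hs; have [|tp1 [tp2 [l1 l2 h]]] := do_complete _ hs os.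
    by apply: pids; rewrite inE.
  exists tp2 => //; exists false, (Some (instr1 o), Some true), tp1; split=> //; first by left.
  by exists true, (Some (instr2 o), None), tp2; split=> //; left.
- move=> [-> ->] hs; exists tp => //.
  by exists tt, (None, None), tp; split=> //; left.
- by [].
- have sp : {subset uses p <= ids} by move=> i hi; apply: pids; rewrite mem_cat hi.
  have sq : {subset uses q <= ids} by move=> i hi; apply: pids; rewrite mem_cat hi orbT.
  move=> [t1 [t2 [s1 [-> e1 e2]]]] hs.
  have [tp1 w1 h1] := IHp _ _ _ _ sp e1 hs; have [tp2 w2 h2] := IHq _ _ _ _ sq e2 h1.
  exists tp2 => //.
  apply: (walk_trans (walk_map (f := inl) (o := Some (inr (entry q))) _ w1)
    (walk_map (f := inr) (o := None) _ w2)).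
    by move=> x /=; apply: eq_map => -[l [x'|]].
  by move=> y /=; apply: eq_map => -[l [x'|]].
- have sp : {subset uses p <= ids} by move=> i hi; apply: pids; rewrite mem_cat hi.
  have sq : {subset uses q <= ids} by move=> i hi; apply: pids; rewrite mem_cat hi orbT.
  move=> [t' -> [e1|e1]] hs.
    have [tp1 w1 h1] := IHp _ _ _ _ sp e1 hs; exists tp1 => //=.
    exists None, (None, Some (Some (inl (entry p)))), tp; split=> //; first by left.
    apply: (walk_map (f := fun x => Some (inl x)) (o := None) _ w1).
    by move=> x /=; apply: eq_map => -[l [x'|]].
  have [tp1 w1 h1] := IHq _ _ _ _ sq e1 hs; exists tp1 => //=.
  exists None, (None, Some (Some (inr (entry q)))), tp; split=> //; first by right; left.
  apply: (walk_map (f := fun x => Some (inr x)) (o := None) _ w1).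
  by move=> x /=; apply: eq_map => -[l [x'|]].
- move=> st; elim: st tp => [u|t1 t2 s1 s2 s3 e1 _ IH2] tp hs.
    exists tp => //; exists None, (None, None), tp; split=> //; by left.
  have [tp1 w1 h1] := IH _ _ _ _ pids e1 hs; have [tp2 w2 h2] := IH2 _ h1.
  exists tp2 => //=.
  exists None, (None, Some (Some (entry p))), tp; split=> //; first by right; left.
  apply: (walk_trans (walk_map (f := fun x => Some x) (o := Some None) _ w1) w2).
  by move=> x /=; apply: eq_map => -[l [x'|]].
Qed.

Definition moveb (a b : move) : bool :=
  match a, b with MoveL, MoveL | MoveN, MoveN | MoveR, MoveR => true | _, _ => false end.

Lemma movebP a b : moveb a b -> a = b. Proof. by case: a; case: b. Qed.

Definition lab_ok (lab : option instr) (rs ws : K.+1.-tuple sym) (ms : K.+1.-tuple move) : bool :=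
  [forall j : 'I_K.+1,
    if lab is Some ins then
      if j == index (itid ins) ids :> nat then
        (iact ins (tnth rs j) == Some (tnth ws j)) && moveb (tnth ms j) (imove ins)
      else (tnth ws j == tnth rs j) && moveb (tnth ms j) MoveN
    else (tnth ws j == tnth rs j) && moveb (tnth ms j) MoveN].

Variable p : prog.
Hypothesis p_ids : {subset uses p <= ids}.

Definition machine : ntm :=
  @Ntm K (option (St p)) void (Some (entry p)) None
    (fun q rs q' ws ms =>
       if q is Some x then has (fun e => (e.2 == q') && lab_ok e.1 rs ws ms) (succ x)
       else false).

Lemma hasIn (T : Type) (a : pred T) s : has a s <-> exists2 x, List.In x s & a x.
Proof.
elim: s => [|x s IH] /=; first by split=> // -[].
split=> [/orP[ax|/IH[y ys ay]]|[y [<-|ys] ay]]; [by exists x; [left|]|by exists y; [right|]| |].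
  by rewrite ay.
by apply/orP; right; apply/IH; exists y.
Qed.

Lemma step_lrel (x : St p) (tp : tapes) (c : config machine) :
  @step machine (Some x, tp) c -> exists2 e, List.In e (succ x) & lrel e.1 tp c.2 /\ c.1 = e.2.
Proof.
move=> [ws [ms [/= /hasIn [e he /andP[/eqP ec /forallP lab]] c2]]].
exists e => //; split=> // i hi.
have hj : index i ids < K.+1 by rewrite -[K.+1]/(size ids) index_mem.
have := lab (Ordinal hj); rewrite !tgetE c2 !tnth_mktuple tnth_map.
have noop : forall t : ltape, teq t (@tmove machine MoveN (@twrite machine (@tread machine t) t)).
  by move=> t; apply: teq_id.
move: {he ec lab}(e.1) => -[ins|]; last first.
  by move=> /andP[/eqP -> /movebP ->]; apply: noop.
rewrite ord_eq.
case: (eqVneq i (itid ins)) => [<-|ne].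
  rewrite eqxx => /andP[/eqP ha /movebP ->].
  exists (tnth ws (Ordinal hj)); first exact: ha.
  by case: imove.
rewrite ifF; first by move=> /andP[/eqP -> /movebP ->]; apply: noop.
apply/negbTE/eqP => e2.
have hi2 : itid ins \in ids by rewrite -index_mem -e2 index_mem.
have ji : i = itid ins by rewrite -(nth_index tinp hi) e2 nth_index.
by rewrite ji eqxx in ne.
Qed.

Definition wsof (lab : option instr) (tp : tapes) : K.+1.-tuple sym :=
  [tuple if lab is Some ins then
           if j == index (itid ins) ids :> nat then odflt None (iact ins (head None (tnth tp j).2))
           else head None (tnth tp j).2
         else head None (tnth tp j).2 | j < K.+1].

Definition msof (lab : option instr) : K.+1.-tuple move :=
  [tuple if lab is Some ins then
           if j == index (itid ins) ids :> nat then imove ins else MoveN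
         else MoveN | j < K.+1].

(** A step of a walk fixes the other tapes up to trailing blanks only, whereas the machine makes one
    definite step. The tapes of the machine are therefore tracked up to trailing blanks. *)
Lemma lrel_step (x : St p) e (tp tp1 tpm : tapes) : List.In e (succ x) ->
  match e.1 with Some ins => itid ins \in ids | None => true end ->
  lrel e.1 tp tp1 -> lrel None tp tpm ->
  exists2 c, @step machine (Some x, tpm) c & c.1 = e.2 /\ lrel None tp1 c.2.
Proof.
move=> he hid hl hm.
pose c2 : tapes := [tuple tmove (N := machine) (tnth (msof e.1) i)
    (twrite (N := machine) (tnth (wsof e.1 tpm) i) (tnth tpm i)) | i < K.+1].
have hd i : i \in ids -> head None (tget tp i).2 = head None (tget tpm i).2.
  by move=> hi; rewrite !head_nth (hm i hi).2.
exists (e.2, c2).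
  exists (wsof e.1 tpm), (msof e.1); split=> //=.
  apply/hasIn; exists e => //; rewrite eqxx /=; apply/forallP => j.
  rewrite !tnth_mktuple tnth_map.
  case E : e.1 hid hl => [ins|] hid hl; last by rewrite eqxx.
  case: (eqVneq (j : nat) (index (itid ins) ids)) => [ej|_]; last by rewrite eqxx.
  have := hl _ hid; rewrite eqxx => -[b]; rewrite hd // /tget -ej -tnth_nth => hb _.
  by rewrite /tread hb eqxx /=; case: imove.
split=> // i hi; have hj : index i ids < K.+1 by rewrite -[K.+1]/(size ids) index_mem.
rewrite (tgetE c2 hj) !tnth_mktuple.
have := hl i hi; have := hm i hi; have := hd i hi.
rewrite (tgetE tpm hj) => hdi hmi.
have noop : forall u, teq (tget tp i) u ->
    teq u (@tmove machine MoveN (@twrite machine (head None (tnth tpm (Ordinal hj)).2) (tnth tpm (Ordinal hj)))).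
  move=> u [h1 h2]; case: hmi => h3 h4; split=> k; rewrite /= -?h1 ?h3 //.
  by rewrite -h2 h4; case: k => [|k] /=; rewrite ?head_nth ?nth_behead.
case: e.1 hid => [ins|] hid; last exact: noop.
rewrite ord_eq.
case: (eqVneq i (itid ins)) => [e1|ne]; last first.
  suff -> : (index i ids == index (itid ins) ids) = false by exact: noop.
  apply/negbTE/eqP => e2.
  have ji : i = itid ins by rewrite -(nth_index tinp hi) e2 nth_index.
  by rewrite ji eqxx in ne.
have -> : (index i ids == index (itid ins) ids) = true by rewrite e1 eqxx.
move=> [b]; rewrite hdi => -> ->.
case: hmi => h3 h4; case: imove; split=> k /=; rewrite ?nth_behead ?h3 //.
- case: k => [|[|k]] //=; rewrite ?nth_behead ?h4 //.
  by rewrite !head_nth h3.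
- by case: k => [|k] //=; rewrite !nth_behead h4.
- by case: k => [|k] //=; rewrite h3.
Qed.

Lemma succ_ids q (x : St q) e : {subset uses q <= ids} -> List.In e (succ x) ->
  match e.1 with Some ins => itid ins \in ids | None => true end.
Proof.
elim: q x e => [o|||q IHq r IHr|q IHq r IHr|q IH] x e pids /=.
- have oi : itid (instr1 o) \in ids by apply: pids; rewrite inE.
  by case: x => /= -[<-|//] /=; rewrite ?itid2.
- by move=> [<-|//].
- by [].
- have sq : {subset uses q <= ids} by move=> i hi; apply: pids; rewrite mem_cat hi.
  have sr : {subset uses r <= ids} by move=> i hi; apply: pids; rewrite mem_cat hi orbT.
  by case: x => x /In_map[[l t] he ->] /=; [apply: IHq sq he|apply: IHr sr he].
- have sq : {subset uses q <= ids} by move=> i hi; apply: pids; rewrite mem_cat hi.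
  have sr : {subset uses r <= ids} by move=> i hi; apply: pids; rewrite mem_cat hi orbT.
  case: x => [[x|x]|] /=; last by move=> [<-|[<-|//]].
    by move=> /In_map[[l t] he ->] /=; apply: IHq sq he.
  by move=> /In_map[[l t] he ->] /=; apply: IHr sr he.
- case: x => [x|] /=; last by move=> [<-|[<-|//]].
  by move=> /In_map[[l t] he ->] /=; apply: IH pids he.
Qed.

Lemma walk_run t x tp tp' tpm : walk (@succ p) t x tp None tp' -> lrel None tp tpm ->
  exists2 c, @steps machine t (x, tpm) c & c.1 = None.
Proof.
elim: t x tp tpm => [|t IH] x tp tpm /=; first by move=> [-> _] _; exists (None, tpm).
move=> [x0 [e [tp1 [-> he hl hw]]]] hm.
have [[q c2] hs [/= eq hc]] := lrel_step he (succ_ids p_ids he) hl hm.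
rewrite -eq in hw; have [c hc1 hc2] := IH _ _ _ hw hc.
by exists c => //; exists (q, c2).
Qed.

Lemma run_sound t (s0 : store) (x : option (St p)) (tp : tapes) (c : config machine) :
  oden s0 x tp -> @steps machine t (x, tp) c -> c.1 = None ->
  exists t' s1, exec p t' s0 s1.
Proof.
elim: t x tp => [|t IH] x tp h /=.
  by move=> <- /= ex; move: h; rewrite ex => -[t' [s1 []]]; exists t', s1.
move=> [[q c2]] hs hss hc; case: x h hs => [x|] h hs; last by case: hs => ws [ms [/=]].
have [e he [hl /= eq]] := step_lrel hs.
by apply: (IH q c2) hss hc; rewrite eq; apply: fden_step p_ids h he hl.
Qed.

Definition store0 (w : seq bool) : store := Store (fun _ => 0) (fun _ => ([::], [::])) w.

Lemma crep_init w : crep (@init machine w).2 (store0 w).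
Proof.
move=> i hi; have hj : index i ids < K.+1 by rewrite -[K.+1]/(size ids) index_mem.
rewrite (tgetE (@init machine w).2 hj) tnth_mktuple.
have -> : (Ordinal hj == ord0) = (index i ids == 0) by [].
case: (eqVneq i tinp) => [->|ne]; first by [].
rewrite ifF; first by case: i ne {hi hj} => [[[] k]|] //= _; split=> -[|[|j]].
apply/negbTE/eqP => e; have ji : i = tinp by rewrite -(nth_index tinp hi) e.
by rewrite ji eqxx in ne.
Qed.

End Compile.

(** An accepting run yields an execution of some length, an execution yields a run of the same
    length; only the second direction has to respect the clock. *)
Theorem prog_machine p : exists N : ntm, forall w b,
  (accepts_within N b w -> exists t s', exec p t (store0 w) s') /\
  (forall t s', exec p t (store0 w) s' -> t <= b -> accepts_within N b w).
Proof.
pose others := uses p.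
have pids : {subset uses p <= tinp :: others} by move=> i hi; rewrite inE hi orbT.
exists (machine others p) => w b; split.
  move=> [t [c [_ hs hc]]].
  have h : oden (others := others) (store0 w) (Some (entry p)) (@init (machine others p) w).2.
    by apply: fden_entry; apply: crep_init.
  exact: (run_sound pids h hs hc).
move=> t s' he tb.
have [tp' hw _] := walk_complete pids he (@crep_init others p w).
have [c hc ce] := walk_run pids hw (tnull _).
by exists t, c.
Qed.

(** * Exact specifications of nondeterministic programs *)

(** Acceptance needs soundness and completeness, so [P] is exactly the set of results, and each is
    reached in time by some run. An empty [P] says that the program blocks. *)
Definition runs (p : prog) (s : store) (P : store -> Prop) (b : nat) : Prop :=
  (forall t s', exec p t s s' -> P s') /\
  (forall s', P s' -> exists2 t, t <= b & exec p t s s').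

Lemma runs_ext p s P Q b : (forall s', P s' <-> Q s') -> runs p s P b -> runs p s Q b.
Proof.
by move=> PQ [h1 h2]; split=> [t s' /h1 /PQ|s' /PQ /h2].
Qed.

Lemma runs_le p s P b b' : b <= b' -> runs p s P b -> runs p s P b'.
Proof.
move=> bb [h1 h2]; split=> // s' /h2 [t tb he]; exists t => //; exact: leq_trans bb.
Qed.

Lemma runs_do o s : runs (Do o) s (opsem o s) 2.
Proof. by split=> [t s' []//|s' h]; exists 2. Qed.

Lemma runs_skip s : runs Skip s (fun s' => s' = s) 1.
Proof. by split=> [t s' []//|s' h]; exists 1. Qed.

Lemma runs_seq p q s P Q b1 b2 : runs p s P b1 -> (forall s1, P s1 -> runs q s1 (Q s1) b2) ->
  runs (Seq p q) s (fun s' => exists2 s1, P s1 & Q s1 s') (b1 + b2).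
Proof.
move=> [p1 p2] hq; split=> [t s' [t1 [t2 [s1 [_ /p1 h1 h2]]]]|s' [s1 P1 Q1]].
  by exists s1 => //; have [q1 _] := hq _ h1; apply: q1 h2.
have [t1 l1 e1] := p2 _ P1; have [_ /(_ _ Q1) [t2 l2 e2]] := hq _ P1.
by exists (t1 + t2); [apply: leq_add|exists t1, t2, s1].
Qed.

Lemma runs_seq_eq p q s s1 Q b1 b2 : runs p s (fun s' => s' = s1) b1 -> runs q s1 Q b2 ->
  runs (Seq p q) s Q (b1 + b2).
Proof.
move=> hp hq; apply: runs_ext (runs_seq hp (Q := fun _ => Q) _) => [s'|_ ->//].
by split=> [[]//|]; exists s1.
Qed.

Lemma runs_alt p q s P Q b : runs p s P b -> runs q s Q b ->
  runs (Alt p q) s (fun s' => P s' \/ Q s') b.+1.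
Proof.
move=> [p1 p2] [q1 q2]; split=> [t s' [t' _ [/p1|/q1]]|s' [/p2[t tb h]|/q2[t tb h]]];
  [by left|by right| |].
  by exists t.+1 => //; exists t => //; left.
by exists t.+1 => //; exists t => //; right.
Qed.

(* A loop [while p] followed by [q], where [Q i] holds of the states after
   exactly [i] rounds, [p] blocks after [n] rounds and [q] blocks before. *)
Lemma runs_loop p q s0 n (Q : nat -> store -> Prop) (R : store -> store -> Prop) S b b2 :
  (forall s, Q 0 s <-> s = s0) ->
  (forall i s, i < n -> Q i s -> runs p s (R s) b) ->
  (forall i s', i < n -> Q i.+1 s' <-> exists2 s, Q i s & R s s') ->
  (forall s, Q n s -> runs p s (fun _ => False) b) ->
  (forall i s, i < n -> Q i s -> runs q s (fun _ => False) b2) ->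
  (forall s, Q n s -> runs q s (S s) b2) ->
  runs (Seq (Star p) q) s0 (fun s' => exists2 s, Q n s & S s s') ((n * b.+1).+1 + b2).
Proof.
move=> Q0 hp hQ pn qi qn; split.
  move=> t s' [t1 [t2 [s1 [_ st e2]]]].
  have [i ni Qi] : exists2 i, i <= n & Q i s1.
    have : exists2 i, i <= n & Q i s0 by exists 0 => //; apply/Q0.
    elim: st => // t3 t4 u v w e3 _ IH [i]; rewrite leq_eqVlt => /orP[/eqP -> Qu|ni Qu].
      by case: ((pn _ Qu).1 _ _ e3).
    apply: IH; exists i.+1 => //; apply/hQ => //; exists u => //.
    exact: (hp _ _ ni Qu).1 e3.
  move: ni; rewrite leq_eqVlt => /orP[/eqP ein|ni].
    by rewrite ein in Qi; exists s1 => //; apply: (qn _ Qi).1 e2.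
  by case: ((qi _ _ ni Qi).1 _ _ e2).
move=> s' [s Qs Ss]; have [t2 l2 e2] := (qn _ Qs).2 _ Ss.
suff [t1 l1 e1] : exists2 t1, t1 <= (n * b.+1).+1 & star (exec p) t1 s0 s.
  by exists (t1 + t2); [apply: leq_add|exists t1, t2, s].
have : forall i s, i <= n -> Q i s -> exists2 t1, t1 <= (i * b.+1).+1 & star (exec p) t1 s0 s.
  elim=> [|i IH] u iu; first by move/Q0 => ->; exists 1 => //; apply: star0.
  move/(hQ _ _ iu) => [v Qv Rv]; have [t3 l3 e3] := IH _ (ltnW iu) Qv.
  have [t4 l4 e4] := (hp _ _ iu Qv).2 _ Rv.
  by exists (t3 + t4).+1; [rewrite mulSn; lia|apply: star_snoc e3 e4].
by apply.
Qed.

Lemma runs_while p q f n s S b b2 : f 0 = s ->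
  (forall i, i < n -> runs p (f i) (fun s' => s' = f i.+1) b) ->
  runs p (f n) (fun _ => False) b ->
  (forall i, i < n -> runs q (f i) (fun _ => False) b2) ->
  runs q (f n) S b2 ->
  runs (Seq (Star p) q) s S ((n * b.+1).+1 + b2).
Proof.
move=> f0 hp pn qi qn.
apply: runs_ext (runs_loop (Q := fun i s => s = f i) (S := fun _ => S) (n := n)
  (R := fun s s' => exists i, [/\ i < n, s = f i & s' = f i.+1]) (b := b) (b2 := b2) _ _ _ _ _ _).
- by move=> s'; split=> [[]//|]; exists (f n).
- by move=> u; rewrite f0.
- move=> i u ni ->; apply: runs_ext (hp i ni) => s'; split=> [->|]; first by exists i.
  move=> [j [nj e ->]]; have [_ /(_ _ erefl) [t1 _ e1]] := hp j nj.
  by rewrite -e in e1; rewrite ((hp i ni).1 _ _ e1).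
- move=> i s' ni; split=> [->|[u -> [j [nj e ->]]]]; first by exists (f i) => //; exists i.
  have [_ /(_ _ erefl) [t1 _ e1]] := hp j nj.
  by rewrite -e in e1; rewrite ((hp i ni).1 _ _ e1).
- by move=> u ->.
- by move=> i u ni ->; apply: qi.
- by move=> u ->.
Qed.

(** * Counter arithmetic *)

Lemma store_ext s s' : cnt s =1 cnt s' -> arr s =1 arr s' -> inp s = inp s' -> s = s'.
Proof. by case: s => c a w; case: s' => c' a' w' /= /funext -> /funext -> ->. Qed.

Definition addv (s : store) (ys : seq nat) (v : nat) : store :=
  Store (fun j => cnt s j + (if j \in ys then v else 0)) (arr s) (inp s).

Definition incs (ys : seq nat) : prog := foldr (fun y => Seq (Do (Inc y))) Skip ys.

Lemma runs_incs s ys : uniq ys -> runs (incs ys) s (fun s' => s' = addv s ys 1) ((size ys).*2.+1).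
Proof.
elim: ys s => [|y ys IH] s /=.
  move=> _; apply: runs_ext (runs_skip s) => s'; suff -> : addv s [::] 1 = s by [].
  by apply: store_ext => // j /=; rewrite addn0.
move=> /andP[yys uys].
apply: runs_le (runs_seq_eq (runs_do (Inc y) s) (runs_ext _ (IH (setc s y (cnt s y).+1) uys))).
  by rewrite doubleS.
move=> s'; suff -> : addv (setc s y (cnt s y).+1) ys 1 = addv s (y :: ys) 1 by [].
apply: store_ext => //= j; rewrite /upd inE; case: eqP => //= ->.
by rewrite (negbTE yys); lia.
Qed.

Definition mv (x : nat) (ys : seq nat) : prog :=
  Seq (Star (Seq (Do (Dec x)) (incs ys))) (Do (Zero x)).

Lemma runs_mv s x ys : uniq (x :: ys) ->
  runs (mv x ys) s (fun s' => s' = setc (addv s ys (cnt s x)) x 0)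
    ((cnt s x * (size ys).*2.+4).+1 + 2).
Proof.
move=> /= /andP[xys uys]; rewrite /mv.
pose f i := setc (addv s ys i) x (cnt s x - i).
apply: (@runs_while _ _ f (cnt s x) s _ ((size ys).*2.+3)).
- apply: store_ext => //= j; rewrite /upd; case: eqP => [->|_]; first by lia.
  by case: ifP; lia.
- move=> i ix.
  have h1 : runs (Do (Dec x)) (f i) (fun s' => s' = setc (addv s ys i) x (cnt s x - i.+1)) 2.
    apply: runs_ext (runs_do _ _) => s' /=; rewrite /upd eqxx.
    have e : setc (f i) x (cnt s x - i).-1 = setc (addv s ys i) x (cnt s x - i.+1).
      by apply: store_ext => //= j; rewrite /upd; case: eqP => // _; lia.
    by rewrite e; split=> [[]//|->]; split=> //; lia.
  apply: runs_le (runs_seq_eq h1 (runs_ext _ (runs_incs _ uys))); first by lia.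
  move=> s'; suff -> : addv (setc (addv s ys i) x (cnt s x - i.+1)) ys 1 = f i.+1 by [].
  apply: store_ext => //= j; rewrite /upd; case: eqP => [->|_].
    by rewrite (negbTE xys); lia.
  by case: ifP; lia.
- split=> // t s' [t1 [t2 [s1 [_ [_ [/= h _]]]]]].
  by move: h; rewrite /f /= /upd eqxx subnn.
- move=> i ix; apply: runs_ext (runs_do _ _) => s' /=; rewrite /upd eqxx.
  by split=> // -[h _]; lia.
- apply: runs_ext (runs_do _ _) => s' /=; rewrite /upd eqxx subnn.
  suff -> : f (cnt s x) = setc (addv s ys (cnt s x)) x 0 by split=> [[]|->].
  by rewrite /f subnn.
Qed.

Ltac counters := apply: store_ext => //= ?; rewrite /upd ?inE;
  repeat (case: eqP => //= ?); subst; try lia.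

(** Moving destroys the source, so a second copy is kept in counter 4 to restore it. *)
Definition add (x t : nat) : prog := Seq (mv x [:: t; 4]) (mv 4 [:: x]).

Lemma runs_add s x t : x != t -> x != 4 -> t != 4 -> cnt s 4 = 0 ->
  runs (add x t) s (fun s' => s' = setc s t (cnt s t + cnt s x)) (20 * (cnt s x).+1).
Proof.
move=> xt x4 t4 z4; have u1 : uniq [:: x; t; 4] by rewrite /= !inE negb_or xt x4 t4.
have u2 : uniq [:: 4; x] by rewrite /= inE eq_sym x4.
apply: runs_le (runs_seq_eq (runs_mv s u1) (runs_ext _ (runs_mv _ u2))).
  by rewrite /= /upd z4 !inE eqxx orbT eq_sym (negbTE x4); lia.
move=> s'; set u := setc _ _ _; suff -> : u = setc s t (cnt s t + cnt s x) by [].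
rewrite /u; move/eqP: xt => xt; move/eqP: x4 => x4; move/eqP: t4 => t4; counters.
Qed.

Lemma runs_clear s x : runs (mv x [::]) s (fun s' => s' = setc s x 0) (4 * (cnt s x).+1).
Proof.
have u : uniq [:: x] by [].
apply: runs_le (runs_ext _ (runs_mv s u)); first by rewrite /=; lia.
move=> s'; suff -> : addv s [::] (cnt s x) = s by [].
by apply: store_ext => // j /=; rewrite addn0.
Qed.

(** Nothing forces a bare loop to run to its end, so all intermediate stores are results. *)
Lemma runs_star p f n b :
  (forall i, i < n -> runs p (f i) (fun s' => s' = f i.+1) b) ->
  runs p (f n) (fun _ => False) b ->
  runs (Star p) (f 0) (fun s => exists2 i, i <= n & s = f i) (n * b.+1).+1.
Proof.
move=> hp pn; split.
  move=> t s' st; have : exists2 i, i <= n & f 0 = f i by exists 0.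
  elim: st => // t3 t4 u v w e3 _ IH [i]; rewrite leq_eqVlt => /orP[/eqP -> e|ni e].
    by rewrite e in e3; case: (pn.1 _ _ e3).
  by apply: IH; exists i.+1 => //; rewrite e in e3; apply: (hp i ni).1 e3.
move=> s' [i ni ->]; suff [t ti st] : exists2 t, t <= (i * b.+1).+1 & star (exec p) t (f 0) (f i).
  by exists t => //; apply: leq_trans ti _; rewrite ltnS leq_mul2r ni orbT.
elim: i ni => [|i IH] ni; first by exists 1 => //; apply: star0.
have [t3 l3 e3] := IH (ltnW ni); have [t4 l4 e4] := (hp i ni).2 _ erefl.
by exists (t3 + t4).+1; [rewrite mulSn; lia|apply: star_snoc e3 e4].
Qed.

Definition is_test (p : prog) (s : store) (C : Prop) (b : nat) : Prop :=
  runs p s (fun s' => C /\ s' = s) b.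

Lemma test_zero k s : is_test (Do (Zero k)) s (cnt s k = 0) 2.
Proof. exact: runs_do. Qed.

Lemma runs_dec k s : runs (Do (Dec k)) s (fun s' => 0 < cnt s k /\ s' = setc s k (cnt s k).-1) 2.
Proof. exact: runs_do. Qed.

Definition positive (k : nat) : prog := Seq (Do (Dec k)) (Do (Inc k)).

Lemma test_positive k s : is_test (positive k) s (0 < cnt s k) 4.
Proof.
apply: runs_ext (runs_seq (runs_dec k s) (fun s1 _ => runs_do (Inc k) s1)) => s' /=.
split=> [[s1 [h ->]] ->|[h ->]].
  by split=> //; counters.
by exists (setc s k (cnt s k).-1) => //; counters.
Qed.

Lemma test_seq p q s C D b1 b2 : is_test p s C b1 -> is_test q s D b2 ->
  is_test (Seq p q) s (C /\ D) (b1 + b2).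
Proof.
move=> hp hq; apply: runs_ext (runs_seq hp (Q := fun _ s' => D /\ s' = s) _); last by move=> s1 [_ ->].
by move=> s'; split=> [[s1 [? _] [? ->]]|[[? ?] ->]]; [|exists s].
Qed.

Lemma test_alt p q s C D b : is_test p s C b -> is_test q s D b ->
  is_test (Alt p q) s (C \/ D) b.+1.
Proof.
move=> hp hq; apply: runs_ext (runs_alt hp hq) => s'.
by split=> [[[? ->]|[? ->]]|[[?|?] ->]]; tauto.
Qed.

Lemma test_ext p s C D b : (C <-> D) -> is_test p s C b -> is_test p s D b.
Proof. by move=> CD; apply: runs_ext => s'; rewrite CD. Qed.

(* Compares copies of [x] and [y] in the counters 1 and 2, which are decreased
   simultaneously before they are tested. *)
Definition cmp (x y : nat) (q : prog) : prog :=
  Seq (add x 1) (Seq (add y 2) (Seq (Star (Seq (Do (Dec 1)) (Do (Dec 2))))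
    (Seq q (Seq (mv 1 [::]) (mv 2 [::]))))).

(* Counter 0 holds the [m] of the domain [{0, ..., m}]; counters 1, 2 and 4 are
   scratch registers that must be 0 between macros. *)
Definition scratch (s : store) : Prop := [/\ cnt s 1 = 0, cnt s 2 = 0 & cnt s 4 = 0].

Definition variable (x : nat) : bool := [&& x != 1, x != 2 & x != 4].

(** The loop may be left after any number i of common decrements. In the three tests derived from
    it, only the i that exhausts the copy of [x] can pass. *)
Lemma test_cmp s x y q (D : nat -> nat -> Prop) b : variable x -> variable y -> scratch s ->
  (forall u v, is_test q (setc (setc s 1 u) 2 v) (D u v) b) ->
  is_test (cmp x y q) s
    (exists2 i, i <= minn (cnt s x) (cnt s y) & D (cnt s x - i) (cnt s y - i))
    (60 * (cnt s x + cnt s y).+1 + b).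
Proof.
move=> /and3P[x1 x2 x4] /and3P[y1 y2 y4] [z1 z2 z4] hq.
pose f i := setc (setc s 1 (cnt s x - i)) 2 (cnt s y - i).
set n := minn _ _.
have h1 := runs_add x1 x4 (isT : 1 != 4) z4.
rewrite z1 add0n in h1.
have h2 : runs (add y 2) (setc s 1 (cnt s x)) (fun s' => s' = f 0) (20 * (cnt s y).+1).
  have := @runs_add (setc s 1 (cnt s x)) y 2 y2 y4 isT.
  rewrite /= /upd /= (negbTE y1) => /(_ z4); apply: runs_ext => s'.
  suff -> : f 0 = setc (setc s 1 (cnt s x)) 2 (cnt s 2 + cnt s y) by [].
  by rewrite /f !subn0 z2 add0n.
have h3 : runs (Star (Seq (Do (Dec 1)) (Do (Dec 2)))) (f 0)
    (fun s => exists2 i, i <= n & s = f i) (n * 5).+1.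
  apply: runs_star => [i ni|].
    apply: runs_ext (runs_seq (runs_dec 1 (f i)) (fun s1 _ => runs_dec 2 s1)) => s' /=.
    have E : setc (setc (f i) 1 (cnt s x - i).-1) 2 (cnt s y - i).-1 = f i.+1 by rewrite /f; counters.
    rewrite /upd /=; split=> [[s1 [_ ->] [_ ->]]|->] /=; rewrite /upd /= ?E //.
    exists (setc (f i) 1 (cnt s x - i).-1); rewrite /= /upd /= ?E; split=> //; rewrite /n in ni; lia.
  split=> // t s' [t1 [t2 [s1 [_ [_ [/= h ->]] [_ [/= h' _]]]]]].
  by move: h h'; rewrite /f /= /upd /= /n; lia.
have h4 i : runs (Seq q (Seq (mv 1 [::]) (mv 2 [::]))) (f i)
    (fun s' => D (cnt s x - i) (cnt s y - i) /\ s' = s) (b + (4 * (cnt s x).+1 + 4 * (cnt s y).+1)).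
  have := @runs_seq q (Seq (mv 1 [::]) (mv 2 [::])) (f i) _ (fun _ s' => s' = s) b
    (4 * (cnt s x).+1 + 4 * (cnt s y).+1) (hq (cnt s x - i) (cnt s y - i)).
  move=> /(_ _) h; apply: runs_ext (h _) => [s'|s1 [_ ->]].
    by split=> [[s1 [? _] ->]|[? ->]] //; exists (f i).
  apply: runs_le (runs_seq_eq (runs_clear _ 1) (runs_ext _ (runs_clear _ 2))).
    by rewrite /= /upd /=; lia.
  move=> s'; set u := setc _ _ _; suff -> : u = s by [].
  by rewrite /u /f; counters.
apply: runs_le (runs_ext _ (runs_seq_eq h1 (runs_seq_eq h2 (runs_seq h3 (Q := fun s1 s' =>
  exists2 i, i <= n /\ s1 = f i & D (cnt s x - i) (cnt s y - i) /\ s' = s)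
  (b2 := b + (4 * (cnt s x).+1 + 4 * (cnt s y).+1)) _)))).
- have : n <= cnt s x by apply: geq_minl.
  lia.
- move=> s'; split=> [[s1 [i ni _] [j [nj _] [? ?]]]|[[i ni ?] ->]].
    by split=> //; exists j.
  by exists (f i); exists i.
- move=> s1 [i ni ->]; apply: runs_ext (h4 i) => s'.
  split=> [[? ->]|[j [nj e] [hD ->]]]; first by exists i.
  split=> //; suff -> : i = j by [].
  have := congr1 (fun s => cnt s 1) e; rewrite /f /= /upd /=.
  by have := geq_minl (cnt s x) (cnt s y); rewrite -/n; lia.
Qed.

Definition eqt x y := cmp x y (Seq (Do (Zero 1)) (Do (Zero 2))).
Definition let_ x y := cmp x y (Do (Zero 1)).
Definition ltt x y := cmp x y (Seq (Do (Zero 1)) (positive 2)).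

Lemma test_eqt s x y : variable x -> variable y -> scratch s ->
  is_test (eqt x y) s (cnt s x = cnt s y) (70 * (cnt s x + cnt s y).+1).
Proof.
move=> vx vy sc; apply: runs_le (test_ext _ (test_cmp (D := fun u v => u = 0 /\ v = 0) (b := 4) vx vy sc _)).
- lia.
- split=> [[i]|e]; [rewrite leq_min; lia|exists (cnt s x); rewrite ?leq_min; lia].
- by move=> u v; apply: (test_seq (test_zero _ _) (test_zero _ _)).
Qed.

Lemma test_let s x y : variable x -> variable y -> scratch s ->
  is_test (let_ x y) s (cnt s x <= cnt s y) (70 * (cnt s x + cnt s y).+1).
Proof.
move=> vx vy sc; apply: runs_le (test_ext _ (test_cmp (D := fun u v => u = 0) (b := 2) vx vy sc _)).
- lia.
- split=> [[i]|e]; [rewrite leq_min; lia|exists (cnt s x); rewrite ?leq_min; lia].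
- by move=> u v; apply: (test_zero _ _).
Qed.

Lemma test_ltt s x y : variable x -> variable y -> scratch s ->
  is_test (ltt x y) s (cnt s x < cnt s y) (70 * (cnt s x + cnt s y).+1).
Proof.
move=> vx vy sc; apply: runs_le (test_ext _ (test_cmp (D := fun u v => u = 0 /\ 0 < v) (b := 6) vx vy sc _)).
- lia.
- split=> [[i]|e]; [rewrite leq_min; lia|exists (cnt s x); rewrite ?leq_min; lia].
- by move=> u v; apply: (test_seq (test_zero _ _) (test_positive _ _)).
Qed.

Definition mulM : prog :=
  Seq (Star (Seq (Do (Dec 1)) (Seq (add 0 2) (Do (Inc 2)))))
    (Seq (Do (Zero 1)) (mv 2 [:: 1])).

Lemma runs_block p q s b1 b2 : runs p s (fun _ => False) b1 -> runs (Seq p q) s (fun _ => False) b2.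
Proof. by move=> [h _]; split=> // t s' [t1 [t2 [s1 [_ /h]]]]. Qed.

Lemma runs_mulM s : scratch (setc s 1 0) ->
  runs mulM s (fun s' => s' = setc s 1 (cnt s 1 * (cnt s 0).+1)) (60 * (cnt s 1).+1 * (cnt s 0).+1).
Proof.
rewrite /scratch /= /upd /= => -[_ z2 z4].
set c := cnt s 1; set m := cnt s 0.
pose f i := setc (setc s 1 (c - i)) 2 (i * m.+1).
pose b := 20 * m.+1 + 4.
have hb : runs (Seq (Do (Zero 1)) (mv 2 [:: 1])) (f c) (fun s' => s' = setc s 1 (c * m.+1))
    (2 + ((c * m.+1) * 6 + 3)).
  have h1 : runs (Do (Zero 1)) (f c) (fun s' => s' = f c) 2.
    by apply: runs_ext (runs_do _ _) => s' /=; rewrite /upd /= subnn; split=> [[]|].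
  apply: runs_le (runs_seq_eq h1 (runs_ext _ (runs_mv (f c) (isT : uniq [:: 2; 1])))).
    by rewrite /= /upd /=; lia.
  move=> s'; set u := setc _ _ _; suff -> : u = setc s 1 (c * m.+1) by [].
  by rewrite /u /f; counters.
apply: runs_le (@runs_while _ _ f c s _ b (2 + ((c * m.+1) * 6 + 3)) _ _ _ _ hb).
- by rewrite /b -/c; nia.
- by rewrite /f; counters.
- move=> i ic.
  have h1 : runs (Do (Dec 1)) (f i) (fun s' => s' = setc (f i) 1 (c - i.+1)) 2.
    apply: runs_ext (runs_dec _ _) => s' /=; rewrite /upd /=.
    have -> : (c - i).-1 = c - i.+1 by lia.
    by split=> [[]|->] //; split=> //; lia.
  have h2 := @runs_add (setc (f i) 1 (c - i.+1)) 0 2 isT isT isT z4.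
  apply: runs_le (runs_seq_eq h1 (runs_seq_eq h2 (runs_ext _ (runs_do (Inc 2) _)))).
    by rewrite /b /= /upd /= -/m; lia.
  move=> s' /=; set u := setc _ _ _; suff -> : u = f i.+1 by [].
  by rewrite /u /f /= /upd /=; counters.
- apply: (@runs_block _ _ _ 2); apply: runs_ext (runs_dec _ _) => s' /=; rewrite /upd /= subnn.
  by split=> // -[].
- move=> i ic; apply: (@runs_block _ _ _ 2); apply: runs_ext (runs_do _ _) => s' /=; rewrite /upd /=.
  by split=> // -[]; lia.
Qed.

Fixpoint muls (k : nat) : prog := if k is k'.+1 then Seq mulM (muls k') else Skip.

Lemma runs_muls k s : scratch (setc s 1 0) ->
  runs (muls k) s (fun s' => s' = setc s 1 (cnt s 1 * (cnt s 0).+1 ^ k))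
    (60 * k * (cnt s 1).+1 * (cnt s 0).+1 ^ k).+1.
Proof.
elim: k s => [|k IH] s sc /=.
  apply: runs_ext (runs_skip s) => s'; suff -> : setc s 1 (cnt s 1 * (cnt s 0).+1 ^ 0) = s by [].
  by rewrite expn0 muln1; counters.
have sc' : scratch (setc (setc s 1 (cnt s 1 * (cnt s 0).+1)) 1 0).
  by move: sc; rewrite /scratch /= /upd.
apply: runs_le (runs_seq_eq (runs_mulM sc) (runs_ext _ (IH _ sc'))).
  rewrite /= /upd /= expnS; set c := cnt s 1; set m := cnt s 0.
  have : 0 < m.+1 ^ k by rewrite expn_gt0.
  set M := _ ^ _ => M0; nia.
move=> s'; set u := setc _ _ _; suff -> : u = setc s 1 (cnt s 1 * (cnt s 0).+1 ^ k.+1) by [].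
by rewrite /u /= /upd /= expnS mulnA; counters.
Qed.

Definition pow (k : nat) : prog := Seq (Do (Inc 1)) (muls k).

Lemma runs_pow k s : scratch s ->
  runs (pow k) s (fun s' => s' = setc s 1 ((cnt s 0).+1 ^ k)) (120 * k.+1 * (cnt s 0).+1 ^ k).
Proof.
move=> sc; have [z1 _ _] := sc.
have h1 : runs (Do (Inc 1)) s (fun s' => s' = setc s 1 1) 2.
  by apply: runs_ext (runs_do _ _) => s' /=; rewrite z1.
have sc' : scratch (setc (setc s 1 1) 1 0) by move: sc; rewrite /scratch /= /upd => -[].
apply: runs_le (runs_seq_eq h1 (runs_ext _ (runs_muls k sc'))).
  rewrite /= /upd /=; have : 0 < (cnt s 0).+1 ^ k by rewrite expn_gt0.
  by set M := _ ^ _ => M0; nia.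
move=> s'; set u := setc _ _ _; suff -> : u = setc s 1 ((cnt s 0).+1 ^ k) by [].
by rewrite /u /= /upd /= mul1n; counters.
Qed.

(** With counter 1 starting at 0, this is the lexicographic position of a tuple, its entries being
    the digits in base m + 1. *)
Fixpoint horner (xs : seq nat) : prog :=
  if xs is x :: xs' then Seq mulM (Seq (add x 1) (horner xs')) else Skip.

Definition hval (m a : nat) (xs : seq nat) : nat := foldl (fun a x => a * m.+1 + x) a xs.

Lemma runs_horner xs s : all variable xs -> scratch (setc s 1 0) ->
  (forall x, x \in xs -> cnt s x <= cnt s 0) ->
  runs (horner xs) s (fun s' => s' = setc s 1 (hval (cnt s 0) (cnt s 1) (map (cnt s) xs)))
    (80 * size xs * (cnt s 1).+1 * (cnt s 0).+1 ^ size xs).+1.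
Proof.
elim: xs s => [|x xs IH] s /=.
  move=> _ _ _; apply: runs_ext (runs_skip s) => s'; suff -> : setc s 1 (cnt s 1) = s by [].
  by counters.
move=> /andP[/and3P[x1 x2 x4] vxs] sc le.
set c := cnt s 1; set m := cnt s 0.
have h1 := runs_mulM sc; rewrite -/c -/m in h1.
have [_ z2 z4] := sc; rewrite /= /upd /= in z2 z4.
have h2 : runs (add x 1) (setc s 1 (c * m.+1)) (fun s' => s' = setc s 1 (c * m.+1 + cnt s x)) (20 * m.+1).
  apply: runs_le (runs_ext _ (@runs_add (setc s 1 (c * m.+1)) x 1 x1 x4 isT z4)).
    rewrite /= /upd (negbTE x1) leq_mul2l /= ltnS; apply: le; exact: mem_head.
  move=> s'; set u := setc _ _ _; suff -> : u = setc s 1 (c * m.+1 + cnt s x) by [].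
  by rewrite /u /= /upd (negbTE x1) /=; counters.
have sc' : scratch (setc (setc s 1 (c * m.+1 + cnt s x)) 1 0) by rewrite /scratch /= /upd /=.
have xs1 : 1 \notin xs by apply/negP => /(allP vxs).
have le' y : y \in xs -> cnt (setc s 1 (c * m.+1 + cnt s x)) y <= cnt (setc s 1 (c * m.+1 + cnt s x)) 0.
  rewrite /= /upd /=; case: eqP => [->|_ ys]; first by rewrite (negbTE xs1).
  by apply: le; rewrite inE ys orbT.
apply: runs_le (runs_seq_eq h1 (runs_seq_eq h2 (runs_ext _ (IH _ vxs sc' le')))).
  rewrite /= /upd /= expnS -/m; have : 0 < m.+1 ^ size xs by rewrite expn_gt0.
  have : cnt s x <= m by apply: le; rewrite mem_head.
  set M := _ ^ _ => h M0.
  have h3 : (c * m.+1 + cnt s x).+1 <= c.+1 * m.+1 by nia.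
  have h4 : 80 * size xs * (c * m.+1 + cnt s x).+1 * M <= 80 * size xs * (c.+1 * m.+1) * M.
    by rewrite leq_mul2r leq_mul2l h3 !orbT.
  have h5 : m.+1 <= m.+1 * M by nia.
  have h6 : c.+1 * m.+1 <= c.+1 * (m.+1 * M) by rewrite leq_mul2l h5 orbT.
  have h7 : m.+1 <= c.+1 * m.+1 by nia.
  have -> : 80 * (size xs).+1 * c.+1 * (m.+1 * M) = 80 * size xs * (c.+1 * m.+1) * M + 80 * (c.+1 * (m.+1 * M)) by nia.
  have -> : 60 * c.+1 * m.+1 = 60 * (c.+1 * m.+1) by nia.
  lia.
move=> s'; set u := setc _ _ _.
suff -> : u = setc s 1 (hval m (c * m.+1 + cnt s x) (map (cnt s) xs)) by [].
rewrite /u /= /upd /=; have -> : map (fun j => if j == 1 then c * m.+1 + cnt s x else cnt s j) xs = map (cnt s) xs.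
  by apply/eq_in_map => y ys; case: eqP => // e; rewrite e (negbTE xs1) in ys.
by counters.
Qed.

Definition for_ (body : prog) : prog := Seq (Star (Seq (Do (Dec 1)) body)) (Do (Zero 1)).

(* [Q i] describes the stores after [i] rounds, with counter 1 set to 0. *)
Lemma runs_for body s0 N (Q : nat -> store -> Prop) (R : store -> store -> Prop) b :
  (forall s, Q 0 s <-> s = s0) -> (forall i s, Q i s -> cnt s 1 = 0) ->
  (forall i s k, i < N -> Q i s -> runs body (setc s 1 k) (fun s' => exists2 u, R s u & s' = setc u 1 k) b) ->
  (forall i u, i < N -> Q i.+1 u <-> exists2 s, Q i s & R s u) ->
  runs (for_ body) (setc s0 1 N) (Q N) (N * b.+3 + 3).
Proof.
move=> Q0 Q1 hb QS.
have setc10 u k j : setc (setc u 1 k) 1 j = setc u 1 j by counters.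
have setc1z i u : Q i u -> setc u 1 0 = u by move=> /Q1 h; counters.
apply: runs_le (runs_ext _ (runs_loop (n := N) (Q := fun i s => exists2 u, Q i u & s = setc u 1 (N - i))
  (R := fun s s' => exists i u u', [/\ i < N, Q i u, R u u' & s = setc u 1 (N - i) /\ s' = setc u' 1 (N - i.+1)])
  (S := fun s s' => s' = s) (b := b.+2) (b2 := 2) _ _ _ _ _ _)).
- by lia.
- move=> s'; split=> [[s [u Qu ->] ->]|Qs]; first by rewrite subnn (setc1z _ _ Qu).
  by exists s' => //; exists s' => //; rewrite subnn (setc1z _ _ Qs).
- move=> s; rewrite subn0; split=> [[u /Q0 -> ->]|->] //; by exists s0 => //; apply/Q0.
- move=> i s iN [u Qu ->].
  have h1 : runs (Do (Dec 1)) (setc u 1 (N - i)) (fun s' => s' = setc u 1 (N - i.+1)) 2.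
    apply: runs_ext (runs_dec _ _) => s' /=; rewrite /upd /= setc10.
    have -> : (N - i).-1 = N - i.+1 by lia.
    by split=> [[]|->] //; split=> //; lia.
  apply: runs_le (runs_ext _ (runs_seq_eq h1 (hb i u _ iN Qu))); first by lia.
  move=> s'; split=> [[u' Ru ->]|[j [v [v' [jN Qv Rv [e ->]]]]]].
    by exists i, u, u'.
  have ij : i = j by have := congr1 (fun s => cnt s 1) e; rewrite /= /upd /=; lia.
  subst j; have uv : u = v.
    by rewrite -(setc1z _ _ Qu) -(setc1z _ _ Qv) -(setc10 u (N - i)) e setc10.
  by subst v; exists v'.
- move=> i s' iN; split.
    move=> [u' /(QS _ _ iN) [u Qu Ru] ->]; exists (setc u 1 (N - i)); first by exists u.
    by exists i, u, u'.
  move=> [s [w Qw ->] [j [v [v' [jN Qv Rv [e ->]]]]]].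
  have ij : i = j by have := congr1 (fun s => cnt s 1) e; rewrite /= /upd /=; lia.
  by subst j; exists v' => //; apply/(QS _ _ iN); exists v.
- move=> s [u Qu ->]; rewrite subnn; apply: runs_block.
  apply: (@runs_ext _ _ (fun s' => 0 < cnt (setc u 1 0) 1 /\ _)); last exact: runs_dec.
  by move=> s'; rewrite /= /upd /=; split=> // -[].
- move=> i s iN [u Qu ->]; apply: runs_ext (runs_do _ _) => s' /=; rewrite /upd /=.
  by split=> // -[]; lia.
- move=> s [u Qu ->]; rewrite subnn; apply: runs_ext (runs_do _ _) => s' /=; rewrite /upd /=.
  by split=> [[]|].
Qed.

(** * Bit arrays and characteristic strings *)

Definition getany (A : nat) : prog := Alt (Do (Get A true)) (Do (Get A false)).

Lemma runs_getany A s l b r : arr s A = (l, b :: r) ->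
  runs (getany A) s (fun s' => s' = seta s A (b :: l, r)) 3.
Proof.
move=> e; apply: runs_ext (runs_alt (runs_do _ _) (runs_do _ _)) => s' /=; rewrite e /=.
split=> [[[r' [-> ->]]|[r' [-> ->]]] //|->].
by case: b {e}; [left|right]; exists r.
Qed.

Definition rewind (A : nat) : prog := Seq (Star (Do (Back A))) (Do (AtStart A)).

Ltac arrays := apply: store_ext => //= ?; rewrite /upd;
  repeat (case: eqP => //= ?); subst.

Lemma runs_rewind A s l r : arr s A = (l, r) ->
  runs (rewind A) s (fun s' => s' = seta s A ([::], rev l ++ r)) (size l * 3 + 3).
Proof.
move=> e; pose f i := seta s A (drop i l, catrev (take i l) r).
apply: runs_le (@runs_while _ _ f (size l) s _ 2 2 _ _ _ _ _).
- by lia.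
- by rewrite /f drop0 take0 /=; arrays.
- move=> i il; apply: runs_ext (runs_do _ _) => s' /=; rewrite /upd eqxx /=.
  rewrite (drop_nth true il).
  have E : seta (f i) A (drop i.+1 l, nth true l i :: catrev (take i l) r) = f i.+1.
    rewrite /f (take_nth true il); arrays.
    by rewrite !catrevE rev_rcons.
  split=> [[b [l' [[<- <-] ->]]]|->]; first exact: E.
  by exists (nth true l i), (drop i.+1 l); rewrite E.
- apply: runs_ext (runs_do _ _) => s' /=; rewrite /upd eqxx /= drop_size.
  by split=> // -[b [l' []]].
- move=> i il; apply: runs_ext (runs_do _ _) => s' /=; rewrite /upd eqxx /=.
  by rewrite (drop_nth true il); split=> // -[].
- apply: runs_ext (runs_do _ _) => s' /=; rewrite /upd eqxx /= drop_size.
  have -> : f (size l) = seta s A ([::], rev l ++ r).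
    by rewrite /f drop_size take_size catrevE.
  by split=> [[]|].
Qed.

Lemma hval_rcons m a xs x : hval m a (rcons xs x) = hval m a xs * m.+1 + x.
Proof. by rewrite /hval foldl_rcons. Qed.

Lemma hval_lt m xs : all (fun x => x <= m) xs -> hval m 0 xs < m.+1 ^ size xs.
Proof.
elim/last_ind: xs => [|xs x IH]; first by [].
rewrite all_rcons size_rcons hval_rcons expnSr => /andP[xm /IH].
set M := _ ^ _; nia.
Qed.

(** These are the quotients and remainders by which [char_string] turns a position into a tuple; so
    the machine and the encoding number the tuples alike. *)
Lemma hval_digit m xs i : all (fun x => x <= m) xs -> i < size xs ->
  (hval m 0 xs %/ m.+1 ^ (size xs - i.+1)) %% m.+1 = nth 0 xs i.
Proof.
elim/last_ind: xs => [|xs x IH] //; rewrite all_rcons size_rcons hval_rcons => /andP[xm /IH {}IH].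
rewrite ltnS nth_rcons leq_eqVlt => /orP[/eqP ->|ilt].
  by rewrite ltnn eqxx subnn expn0 divn1 modnMDl modn_small // ltnS.
rewrite ilt subSn // expnS divnMA divnMDl // (divn_small (_ : x < m.+1)) ?ltnS // addn0.
exact: IH.
Qed.

Lemma hval_digits m k j : j < m.+1 ^ k ->
  hval m 0 (mkseq (fun i => (j %/ m.+1 ^ (k - i.+1)) %% m.+1) k) = j.
Proof.
elim: k j => [|k IH] j.
  by rewrite expn0 ltnS leqn0 => /eqP ->.
rewrite expnSr => jk; rewrite mkseqS hval_rcons subnn expn0 divn1.
rewrite (_ : mkseq _ k = mkseq (fun i => (j %/ m.+1 %/ m.+1 ^ (k - i.+1)) %% m.+1) k).
  by rewrite IH; [rewrite -divn_eq|rewrite ltn_divLR].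
apply/eq_in_map => i; rewrite mem_iota => /= ik.
by rewrite subSS -divnMA -expnS subnSK.
Qed.

Definition index_of m k (t : k.-tuple 'I_m.+1) : nat := hval m 0 (map val t).

Lemma le_vals m k (t : k.-tuple 'I_m.+1) : all (fun x => x <= m) (map val t).
Proof. by apply/allP => _ /mapP[i _ ->]; rewrite -ltnS ltn_ord. Qed.

Lemma index_of_lt m k (t : k.-tuple 'I_m.+1) : index_of t < m.+1 ^ k.
Proof. by have := hval_lt (le_vals t); rewrite size_map size_tuple. Qed.

Lemma size_char_string m k (R : set (k.+1.-tuple 'I_m.+1)) : size (char_string R) = m.+1 ^ k.+1.
Proof. by rewrite size_mkseq. Qed.

Lemma char_stringP m k (R : set (k.+1.-tuple 'I_m.+1)) t :
  nth false (char_string R) (index_of t) <-> R t.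
Proof.
rewrite nth_mkseq; last exact: index_of_lt.
suff -> : [tuple inord ((index_of t %/ m.+1 ^ (k - i)) %% m.+1) | i < k.+1] = t.
  by split=> [/asboolP|?]; last apply/asboolP.
apply: eq_from_tnth => i; rewrite tnth_mktuple; apply: val_inj.
rewrite /= inordK ?ltn_mod //.
have := hval_digit (le_vals t) (i := i); rewrite size_map size_tuple subSS => -> //.
by rewrite (nth_map ord0) ?size_tuple // -tnth_nth.
Qed.

(** Hence to guess bits is to guess a relation. *)
Lemma char_string_onto m k bits : size bits = m.+1 ^ k.+1 ->
  exists R : set (k.+1.-tuple 'I_m.+1), char_string R = bits.
Proof.
move=> sz; exists [set t | nth false bits (index_of t)].
apply: (@eq_from_nth _ false); rewrite size_char_string ?sz // => j jk.
rewrite nth_mkseq //.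
set t : k.+1.-tuple _ := [tuple _ | _ < _].
suff e : index_of t = j by apply/asboolP/idP => /=; rewrite e.
rewrite /index_of -[RHS](hval_digits (m := m) (k := k.+1)) //; congr hval.
apply: (@eq_from_nth _ 0); rewrite size_map size_tuple ?size_mkseq // => i ik.
rewrite (nth_map ord0) ?size_tuple // nth_mkseq // subSS.
by rewrite -[i]/(val (Ordinal ik)) -tnth_nth tnth_mktuple /= inordK // ltn_mod.
Qed.

Lemma char_string_inj m k : injective (@char_string m k).
Proof.
move=> R S e; rewrite predeqE => t.
by rewrite -(char_stringP R t) e char_stringP.
Qed.

Definition lookup (b : bool) (A : nat) (xs : seq nat) : prog :=
  Seq (horner xs) (Seq (for_ (getany A)) (Seq (Do (Get A b)) (rewind A))).

Lemma test_lookup b A xs s r : all variable xs -> scratch s ->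
  (forall x, x \in xs -> cnt s x <= cnt s 0) -> arr s A = ([::], r) ->
  hval (cnt s 0) 0 (map (cnt s) xs) < size r ->
  is_test (lookup b A xs) s (nth false r (hval (cnt s 0) 0 (map (cnt s) xs)) = b)
    (100 * (size xs).+1 * (cnt s 0).+1 ^ size xs).
Proof.
move=> vxs sc le eA; set j := hval _ _ _ => jr.
have [z1 _ _] := sc.
have sc' : scratch (setc s 1 0) by move: sc; rewrite /scratch /= /upd => -[].
have h1 := runs_horner vxs sc' le; rewrite z1 -/j in h1.
have jM : j < (cnt s 0).+1 ^ size xs.
  rewrite -(size_map (cnt s) xs); apply: hval_lt; apply/allP => _ /mapP[x xx ->].
  exact: le.
pose s1 := seta s A (rev (take j r), drop j r).
have h2 : runs (for_ (getany A)) (setc s 1 j) (fun s' => s' = s1) (j * 6 + 3).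
  apply: runs_ext (runs_for (Q := fun i u => u = seta s A (rev (take i r), drop i r))
    (R := fun u u' => exists i, [/\ i < j, u = seta s A (rev (take i r), drop i r) &
      u' = seta s A (rev (take i.+1 r), drop i.+1 r)]) (b := 3) _ _ _ _) => //.
  - by move=> u; rewrite take0 drop0; suff -> : seta s A (rev [::], r) = s by []; arrays.
  - by move=> i u ->.
  - move=> i u k ij ->; have ir : i < size r by apply: ltn_trans ij jr.
    apply: runs_ext (@runs_getany A (setc (seta s A (rev (take i r), drop i r)) 1 k) (rev (take i r)) (nth false r i) (drop i.+1 r) _).
      have E : seta (setc (seta s A (rev (take i r), drop i r)) 1 k) A (nth false r i :: rev (take i r), drop i.+1 r)
        = setc (seta s A (rev (take i.+1 r), drop i.+1 r)) 1 k.
        by rewrite (take_nth false ir) rev_rcons; arrays.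
      rewrite E => s'; split=> [->|[u' [i' [i'j e ->]] ->]]; first by eexists; [exists i|].
      suff -> : i = i' by [].
      have := congr1 (fun s => size (arr s A).1) e; rewrite /= /upd eqxx /= !size_rev.
      by rewrite !size_takel // ltnW // (ltn_trans i'j).
    by rewrite /= /upd eqxx -drop_nth.
  - move=> i u ij; split=> [->|[v -> [i' [i'j e ->]]]]; first by eexists; [|exists i].
    suff -> : i = i' by [].
    have := congr1 (fun s => size (arr s A).1) e; rewrite /= /upd eqxx /= !size_rev.
    by rewrite !size_takel // ltnW // (ltn_trans _ jr).
have h3 : runs (Do (Get A b)) s1 (fun s' => nth false r j = b /\
    s' = seta s A (rev (take j.+1 r), drop j.+1 r)) 2.
  apply: runs_ext (runs_do _ _) => s' /=; rewrite /upd eqxx /= (drop_nth false jr).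
  have E : nth false r j = b -> seta s1 A (b :: rev (take j r), drop j.+1 r) =
    seta s A (rev (take j.+1 r), drop j.+1 r).
    by move=> <-; rewrite (take_nth false jr) rev_rcons; arrays.
  split=> [[r' [e <-] ->]|[e ->]]; first by rewrite -/s1 E.
  by exists (drop j.+1 r); rewrite ?e // E.
have h4 : runs (rewind A) (seta s A (rev (take j.+1 r), drop j.+1 r)) (fun s' => s' = s) (j.+1 * 3 + 3).
  apply: runs_le (runs_ext _ (runs_rewind (l := rev (take j.+1 r)) (r := drop j.+1 r) _)).
  - by rewrite size_rev size_takel.
  - move=> s'; set u := seta _ _ _; suff -> : u = s by [].
    by rewrite /u revK cat_take_drop; arrays.
  - by rewrite /= /upd eqxx.
apply: runs_le (runs_ext _ (runs_seq_eq (runs_ext _ h1) (runs_seq_eq h2 (runs_seq h3 (Q := fun _ s' => s' = s) (b2 := j.+1 * 3 + 3) _)))).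
- rewrite muln1; move: jM; set M := _ ^ _ => jM.
  have : 0 < M by lia.
  nia.
- by move=> s'; split=> [[s2 [? _] ->]|[? ->]] //; eexists; [split|].
- by [].
- by move=> s2 [_ ->].
Qed.

Definition putany (A : nat) : prog := Alt (Do (Put A true)) (Do (Put A false)).

(** Only an initial segment is overwritten, and what an earlier use left behind it remains. This is
    why arrays will only be required to begin with a characteristic string. *)
Definition guessarr (k A : nat) : prog := Seq (pow k) (Seq (for_ (putany A)) (rewind A)).

Lemma runs_guessarr k A s r : scratch s -> arr s A = ([::], r) ->
  runs (guessarr k A) s
    (fun s' => exists2 bits, size bits = (cnt s 0).+1 ^ k &
       s' = seta s A ([::], bits ++ drop (size bits) r))
    (150 * k.+1 * (cnt s 0).+1 ^ k).
Proof.
move=> sc eA; have [z1 _ _] := sc; set N := _ ^ k.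
pose Q i u := exists2 bits : seq bool, size bits = i & u = seta s A (rev bits, drop i r).
have h2 : runs (for_ (putany A)) (setc s 1 N) (Q N) (N * 6 + 3).
  apply: runs_ext (runs_for (Q := Q)
    (R := fun u u' => exists bits b, u = seta s A (rev bits, drop (size bits) r) /\
      u' = seta s A (rev (rcons bits b), drop (size bits).+1 r)) (b := 3) _ _ _ _) => //.
  - move=> u; have E : seta s A (rev [::], drop 0 r) = s by rewrite drop0; arrays.
    by split=> [[bits /size0nil -> ->]|->] //; exists [::].
  - by move=> i u [bits _ ->].
  - move=> i u c iN [bits <- ->]; apply: runs_ext (runs_alt (runs_do _ _) (runs_do _ _)) => s' /=.
    rewrite /upd eqxx /= -drop1 drop_drop add1n.
    have E b : seta (setc (seta s A (rev bits, drop (size bits) r)) 1 c) A (b :: rev bits, drop (size bits).+1 r) =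
      setc (seta s A (rev (rcons bits b), drop (size bits).+1 r)) 1 c by rewrite rev_rcons; arrays.
    rewrite !E; split=> [[->|->]|[u' [bits' [b [e ->]] ->]]];
      [by eexists; [exists bits, true|]|by eexists; [exists bits, false|]|].
    have {e} e := congr1 (fun s => (arr s A).1) e; rewrite /= /upd eqxx in e.
    have -> : bits = bits' by apply: (can_inj revK); exact: e.
    by case: b; [left|right].
  - move=> i u iN; split=> [[bits]|[v [bits <- ->] [bits' [b [e ->]]]]].
      case/lastP: bits => // bits b; rewrite size_rcons => -[<-] ->.
      by eexists; [exists bits|exists bits, b].
    have {e} e := congr1 (fun s => (arr s A).1) e; rewrite /= /upd eqxx in e.
    have -> : bits = bits' by apply: (can_inj revK); exact: e.
    by exists (rcons bits' b); rewrite ?size_rcons.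
apply: runs_le (runs_ext _ (runs_seq_eq (runs_pow k sc) (runs_seq h2 (Q := fun u s' => s' = seta u A ([::], rev (arr u A).1 ++ (arr u A).2)) (b2 := N * 3 + 3) _))).
- rewrite -/N; have : 0 < N by rewrite expn_gt0.
  nia.
- have E bits : size bits = N -> seta (seta s A (rev bits, drop N r)) A
     ([::], rev (arr (seta s A (rev bits, drop N r)) A).1 ++ (arr (seta s A (rev bits, drop N r)) A).2) =
     seta s A ([::], bits ++ drop (size bits) r).
    by move=> sb; rewrite /= /upd eqxx /= revK sb; arrays.
  move=> s'; split=> [[u [bits sb ->] ->]|[bits sb ->]]; first by exists bits => //; rewrite E.
  by exists (seta s A (rev bits, drop N r)); [exists bits|rewrite E].
- move=> u [bits sb ->]; apply: runs_le (runs_rewind (surjective_pairing _)).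
  by rewrite /= /upd eqxx /= size_rev sb.
Qed.

Definition readarr (k A : nat) : prog :=
  Seq (pow k) (Seq (for_ (Alt (Seq (Do (InGet true)) (Do (Put A true)))
    (Seq (Do (InGet false)) (Do (Put A false))))) (rewind A)).

Lemma runs_readarr k A s r : scratch s -> arr s A = ([::], r) ->
  runs (readarr k A) s
    (fun s' => (cnt s 0).+1 ^ k <= size (inp s) /\
       s' = seti (seta s A ([::], take ((cnt s 0).+1 ^ k) (inp s) ++ drop ((cnt s 0).+1 ^ k) r))
              (drop ((cnt s 0).+1 ^ k) (inp s)))
    (150 * k.+1 * (cnt s 0).+1 ^ k).
Proof.
move=> sc eA; have [z1 _ _] := sc; set N := _ ^ k; set w := inp s.
pose f i := seti (seta s A (rev (take i w), drop i r)) (drop i w).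
pose Q i u := i <= size w /\ u = f i.
have fsz i j : i <= size w -> j <= size w -> f i = f j -> i = j.
  move=> iw jw /(congr1 (fun s => size (arr s A).1)); rewrite /= /upd eqxx /= !size_rev.
  by rewrite !size_takel.
have h2 : runs (for_ (Alt (Seq (Do (InGet true)) (Do (Put A true)))
    (Seq (Do (InGet false)) (Do (Put A false))))) (setc s 1 N) (Q N) (N * 8 + 3).
  apply: runs_ext (runs_for (Q := Q)
    (R := fun u u' => exists i, [/\ i < size w, u = f i & u' = f i.+1]) (b := 5) _ _ _ _) => //.
  - move=> u; have E : f 0 = s by rewrite /f take0 !drop0; arrays.
    by rewrite /Q E; split=> [[]|].
  - by move=> i u [_ ->].
  - move=> i u c iN [iw ->].
    apply: runs_ext (runs_alt (runs_seq (runs_do _ _) (fun s1 _ => runs_do _ s1))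
      (runs_seq (runs_do _ _) (fun s1 _ => runs_do _ s1))) => s' /=.
    have key b w' : drop i w = b :: w' -> [/\ i < size w, drop i.+1 w = w' &
        seta (seti (setc (f i) 1 c) w') A (b :: rev (take i w), drop i.+1 r) = setc (f i.+1) 1 c].
      move=> e; have iw' : i < size w.
        by rewrite ltnNge; apply/negP => h; rewrite drop_oversize in e.
      have e2 : drop i.+1 w = w' by rewrite -add1n -drop_drop e /= drop0.
      split=> //; rewrite /f e2 (take_nth true iw') rev_rcons.
      have -> : nth true w i = b by rewrite -[i]addn0 -nth_drop e.
      by arrays.
    split.
      by move=> [[s1 [w' /key [h1 h2 h3] ->] ->]|[s1 [w' /key [h1 h2 h3] ->] ->]];
        rewrite /= /upd eqxx /= -drop1 drop_drop add1n h3; (eexists; [exists i|]).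
    move=> [u' [j [jw /(fsz _ _ iw (ltnW jw)) ij ->]] ->]; subst j.
    have e := drop_nth true jw.
    case: (nth true w i) e => e; [left|right]; have [h1 h2 h3] := key _ _ e;
      (eexists; [exists (drop i.+1 w) => //|]);
      by rewrite /= /upd eqxx /= -drop1 drop_drop add1n h3.
  - move=> i u iN; split=> [[iw ->]|[v [iw ->] [j [jw /(fsz _ _ iw (ltnW jw)) ij ->]]]].
      by exists (f i); [split=> //; apply: ltnW|exists i].
    by subst j.
apply: runs_le (runs_ext _ (runs_seq_eq (runs_pow k sc) (runs_seq h2 (Q := fun u s' => s' = seta u A ([::], rev (arr u A).1 ++ (arr u A).2)) (b2 := N * 3 + 3) _))).
- rewrite -/N; have : 0 < N by rewrite expn_gt0.
  nia.
- have E : seta (f N) A ([::], rev (arr (f N) A).1 ++ (arr (f N) A).2) =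
     seti (seta s A ([::], take N w ++ drop N r)) (drop N w).
    by rewrite /= /upd eqxx /= revK /f; arrays.
  move=> s'; split=> [[u [Nw ->] ->]|[Nw ->]]; first by rewrite E.
  by exists (f N).
- move=> u [Nw ->]; apply: runs_le (runs_rewind (surjective_pairing _)).
  by rewrite /= /upd eqxx /= size_rev size_takel.
Qed.

Definition inany : prog := Alt (Do (InGet true)) (Do (InGet false)).

Lemma runs_inany s : runs inany s (fun s' => 0 < size (inp s) /\ s' = seti s (behead (inp s))) 3.
Proof.
apply: runs_ext (runs_alt (runs_do _ _) (runs_do _ _)) => s' /=.
case: (inp s) => [|b w] /=; first by split=> [[[]|[]]|[]].
split=> [[[w' [_ ->] ->]|[w' [_ ->] ->]]|[_ ->]] //.
by case: b; [left|right]; exists w.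
Qed.

Definition tooshort (k : nat) : prog :=
  Seq (pow k) (Seq (Star (Seq (Do (Dec 1)) inany)) (Seq (positive 1) (Do InEnd))).

(** Each round takes one bit of input and one unit of the counter, so an exhausted input with a
    positive counter shows the lack. The final store is left unspecified, as nothing is executed
    after this test. *)
Lemma runs_tooshort k s : scratch s ->
  exists u, runs (tooshort k) s (fun s' => size (inp s) < (cnt s 0).+1 ^ k /\ s' = u)
    (150 * k.+1 * (cnt s 0).+1 ^ k).
Proof.
move=> sc; have [z1 _ _] := sc; set N := _ ^ k; set w := inp s.
pose f i := seti (setc s 1 (N - i)) (drop i w).
exists (f (size w)).
have hbody i : runs (Seq (Do (Dec 1)) inany) (f i) (fun s' => (i < N /\ i < size w) /\ s' = f i.+1) 5.
  apply: runs_ext (runs_seq (runs_dec 1 (f i)) (fun s1 _ => runs_inany s1)) => s' /=.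
  have bd : behead (drop i w) = drop i.+1 w by rewrite -drop1 drop_drop add1n.
  have E : seti (setc (f i) 1 (N - i).-1) (drop i.+1 w) = f i.+1.
    rewrite /f; apply: store_ext => //= ?; rewrite /upd; case: eqP => //=; lia.
  rewrite /upd /=; split=> [[s1 [h ->]]|[[h h'] ->]] /=.
    rewrite bd E size_drop => -[h' ->]; split=> //.
    by rewrite subn_gt0 in h; rewrite subn_gt0 in h'.
  exists (setc (f i) 1 (N - i).-1); first by rewrite subn_gt0.
  by rewrite /= bd E size_drop subn_gt0.
have hq i : is_test (Seq (positive 1) (Do InEnd)) (f i) (i < N /\ size w <= i) 6.
  apply: test_ext (test_seq (test_positive 1 (f i)) (_ : is_test (Do InEnd) (f i) (size w <= i) 2)).
    by rewrite /= /upd /= subn_gt0.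
  apply: runs_ext (runs_do _ _) => s' /=.
  by rewrite -subn_eq0 -size_drop; case: (drop i w) => //; split=> // -[].
have h2 : runs (Seq (Star (Seq (Do (Dec 1)) inany)) (Seq (positive 1) (Do InEnd))) (setc s 1 N)
    (fun s' => size w < N /\ s' = f (size w)) (N * 6 + 10).
  have f0 : f 0 = setc s 1 N by rewrite /f subn0 drop0.
  pose n := minn N (size w).
  have nN : n <= N by apply: geq_minl.
  apply: runs_le (@runs_while _ _ f n _ _ 5 6 f0 _ _ _ _); first by lia.
  - move=> i; rewrite leq_min => /andP[i1 i2]; apply: runs_ext (hbody i) => s'.
    by split=> [[]|].
  - apply: runs_ext (hbody n) => s'; split=> // -[[h1 h2] _].
    by move: h1 h2; rewrite /n; lia.
  - move=> i; rewrite leq_min => /andP[i1 i2]; apply: runs_ext (hq i) => s'.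
    by split=> // -[[_ h] _]; lia.
  - apply: runs_ext (hq n) => s'; split=> [[[h1 h2] ->]|[h ->]].
      have e : n = size w by rewrite /n in h1 h2 *; lia.
      by rewrite e in h1 *.
    have e : n = size w by rewrite /n; lia.
    by rewrite e.
apply: runs_le (runs_seq_eq (runs_pow k sc) h2).
rewrite -/N; have : 0 < N by rewrite expn_gt0.
nia.
Qed.

Definition guess (x : nat) : prog := Star (Seq (ltt x 0) (Do (Inc x))).

Lemma runs_guess x s : variable x -> x != 0 -> scratch s -> cnt s x = 0 ->
  runs (guess x) s (fun s' => exists2 v, v <= cnt s 0 & s' = setc s x v)
    (1000 * (cnt s 0).+1 ^ 2).
Proof.
move=> vx x0 sc zx; have /and3P[x1 x2 x4] := vx.
pose f v := setc s x v.
have scf v : scratch (f v).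
  by case: sc => ? ? ?; rewrite /scratch /f /= /upd !ifN 1?eq_sym.
have hb v : runs (Seq (ltt x 0) (Do (Inc x))) (f v) (fun s' => v < cnt s 0 /\ s' = f v.+1)
    (70 * (v + cnt s 0).+1 + 2).
  have h := test_ltt vx (isT : variable 0) (scf v).
  rewrite /= /upd eqxx (eq_sym 0) (negbTE x0) in h.
  apply: runs_ext (runs_seq h (fun s1 _ => runs_do (Inc x) s1)) => s' /=.
  have E : setc (f v) x (cnt (f v) x).+1 = f v.+1 by rewrite /f /= /upd eqxx; counters.
  by split=> [[s1 [? ->] ->]|[? ->]]; [rewrite E|exists (f v)].
have f0 : s = f 0 by rewrite /f -zx; counters.
(* A comparison with m costs at most 140(m + 1) and the increment 2; there are at most m rounds. *)
rewrite [in runs _ s]f0; apply: runs_le (runs_ext _ (@runs_star _ f (cnt s 0) (140 * (cnt s 0).+1 + 2) _ _)).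
- by rewrite expnS expn1; nia.
- by [].
- move=> i ic; apply: runs_le (runs_ext _ (hb i)); first by lia.
  by move=> s'; split=> [[]|].
- apply: runs_le (runs_ext _ (hb _)); first by lia.
  by move=> s'; rewrite ltnn; split=> // -[].
Qed.

(** * Polynomial bounds, and tests that may alter scratch arrays *)

Definition poly (f : nat -> nat) : Prop := exists c k, forall m, f m <= c * m.+1 ^ k.

Lemma poly_le f g : (forall m, f m <= g m) -> poly g -> poly f.
Proof. by move=> fg [c [k h]]; exists c, k => m; apply: leq_trans (h m). Qed.

Lemma poly_pow c k : poly (fun m => c * m.+1 ^ k).
Proof. by exists c, k. Qed.

Lemma poly_const c : poly (fun _ => c).
Proof. by exists c, 0 => m; rewrite expn0 muln1. Qed.

Lemma poly_add f g : poly f -> poly g -> poly (fun m => f m + g m).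
Proof.
move=> [c [k hf]] [c' [k' hg]]; exists (c + c'), (k + k') => m.
rewrite mulnDl; apply: leq_add.
  by apply: leq_trans (hf m) _; rewrite leq_mul2l leq_pexp2l ?leq_addr ?orbT.
by apply: leq_trans (hg m) _; rewrite leq_mul2l leq_pexp2l ?leq_addl ?orbT.
Qed.

Lemma poly_mul f g : poly f -> poly g -> poly (fun m => f m * g m).
Proof.
move=> [c [k hf]] [c' [k' hg]]; exists (c * c'), (k + k') => m.
by rewrite expnD mulnACA leq_mul.
Qed.

(** Counters below 5 are set aside for m and for scratch work. *)
Definition reg (d : nat) : nat := d + 5.

Lemma variable_reg d : variable (reg d).
Proof. by rewrite /variable /reg !addnS. Qed.

(* The arrays from [d] on are scratch space, but their heads stay at the start. *)
Definition eqv (d : nat) (s s' : store) : Prop :=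
  [/\ cnt s =1 cnt s', inp s = inp s', forall k, k < d -> arr s k = arr s' k &
      forall k, (arr s' k).1 = [::]].

Lemma eqv_trans d s1 s2 s3 : eqv d s1 s2 -> eqv d s2 s3 -> eqv d s1 s3.
Proof.
move=> [c1 i1 a1 _] [c2 i2 a2 p2]; split=> //; first by move=> k; rewrite c1 c2.
- by rewrite i1 i2.
- by move=> k kd; rewrite a1 // a2.
Qed.

Lemma eqv_weaken d s s' : eqv d.+1 s s' -> eqv d s s'.
Proof. by move=> [? ? h ?]; split=> // k kd; apply: h; apply: ltnW. Qed.

Lemma eqv_setc d s s' k v : eqv d s s' -> eqv d (setc s k v) (setc s' k v).
Proof. by move=> [h ? ? ?]; split=> // j; rewrite /= /upd; case: ifP. Qed.

(** A weakening of [is_test]: guessed relations are not erased, so the store is restored only up to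
    the arrays from [d] on, and one successful run is enough. *)
Definition checks (d : nat) (p : prog) (s : store) (C : Prop) (b : nat) : Prop :=
  (forall t s', exec p t s s' -> C /\ eqv d s s') /\
  (C -> exists t s', [/\ t <= b, exec p t s s' & eqv d s s']).

Lemma checks_test d p s C b : (forall k, (arr s k).1 = [::]) -> is_test p s C b -> checks d p s C b.
Proof.
move=> sp [h1 h2]; split=> [t s' /h1 [? ->]|hC]; first by split.
by have [|t tb e] := h2 s; [|exists t, s].
Qed.

Lemma checks_le d p s C b b' : b <= b' -> checks d p s C b -> checks d p s C b'.
Proof.
move=> bb [h1 h2]; split=> // /h2 [t [s' [tb e q]]]; exists t, s'; split=> //.
exact: leq_trans bb.
Qed.

Lemma checks_ext d p s C D b : (C <-> D) -> checks d p s C b -> checks d p s D b.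
Proof. by move=> CD [h1 h2]; split=> [t s' /h1|/CD]; rewrite -?CD. Qed.

Lemma checks_stop d s C b : ~ C -> checks d Stop s C b.
Proof. by move=> nC; split=> [t s' []|/nC]. Qed.

Lemma checks_seq d p q s C D b1 b2 : checks d p s C b1 ->
  (forall s1, eqv d s s1 -> checks d q s1 D b2) -> checks d (Seq p q) s (C /\ D) (b1 + b2).
Proof.
move=> [p1 p2] hq; split=> [t s' [t1 [t2 [s1 [_ /p1 [hC e1] h2]]]]|[/p2 [t1 [s1 [l1 e1 v1]]] hD]].
  have [hD e2] := (hq _ e1).1 _ _ h2; by split=> //; apply: eqv_trans e2.
have [t2 [s2 [l2 e2 v2]]] := (hq _ v1).2 hD.
by exists (t1 + t2), s2; split; [apply: leq_add|exists t1, t2, s1|apply: eqv_trans v2].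
Qed.

Lemma checks_alt d p q s C D b1 b2 : checks d p s C b1 -> checks d q s D b2 ->
  checks d (Alt p q) s (C \/ D) (b1 + b2).+1.
Proof.
move=> [p1 p2] [q1 q2]; split=> [t s' [t' _ [/p1|/q1] []]|[/p2|/q2] [t [s' [tb e v]]]].
- by split=> //; left.
- by split=> //; right.
- by exists t.+1, s'; split=> //; [rewrite ltnS (leq_trans tb) // leq_addr|exists t => //; left].
- by exists t.+1, s'; split=> //; [rewrite ltnS (leq_trans tb) // leq_addl|exists t => //; right].
Qed.

(** * Evaluation of formulas *)

Section Evaluation.
Variable L : signature.

(** Identity of relations is replaced by coextensiveness, which lookups can evaluate; being
    first-order, this respects [sigma] in both polarities. *)
Fixpoint elim_veq (p : formula L) : formula L :=
  match p with
  | FVEq n X Y => FNot (foldr (@FEx L)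
      (FNot (FIff (FVar X (idt L n)) (FVar Y (idt L n)))) (iota 0 n.+1))
  | FNot p => FNot (elim_veq p)
  | FAnd p q => FAnd (elim_veq p) (elim_veq q)
  | FEx x p => FEx x (elim_veq p)
  | SEx n X p => SEx n X (elim_veq p)
  | _ => p
  end.

Fixpoint no_veq (p : formula L) : bool :=
  match p with
  | FVEq _ _ _ => false
  | FNot p => no_veq p
  | FAnd p q => no_veq p && no_veq q
  | FEx _ p => no_veq p
  | SEx _ _ p => no_veq p
  | _ => true
  end.

Lemma elim_veq_no_veq p : no_veq (elim_veq p).
Proof. by elim: p => //= [n X Y|p -> q ->] //; elim: (iota 1 n). Qed.

Lemma elim_veq_sigma p b : sigma b p -> sigma b (elim_veq p).
Proof.
elim: p b => [s t|n X Y|n X ts|C ts|p IH|p IHp q IHq|x p IH|n X p IH] b //=.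
- by elim: (iota 1 n).
- exact: IH.
- by move=> /andP[/IHp -> /IHq ->].
- exact: IH.
- by move=> /andP[-> /IH ->].
Qed.

Lemma sat_FExs_inv A (M : henkin L A) rv p xs iv :
  sat M iv rv (foldr (@FEx L) p xs) -> exists iv', sat M iv' rv p.
Proof. by elim: xs iv => [|x xs IH] iv /=; [exists iv|move=> [a /IH]]. Qed.

Lemma elim_veq_sat p A (M : henkin L A) iv rv : sat M iv rv (elim_veq p) <-> sat M iv rv p.
Proof.
elim: p iv rv => [s t|n X Y|n X ts|C ts|p IH|p IHp q IHq|x p IH|n X p IH] iv rv; try by [].
- cbn [elim_veq sat]; split=> [h|e].
    rewrite predeqE => t; apply: contrapT => ht; apply: h; apply: sat_FExs.
    exists (fun x => nth (iv x) t x).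
      move=> x hx; have : x \notin iota 0 n.+1 by exact: hx.
      rewrite mem_iota -leqNgt => xn.
      by rewrite nth_default ?size_tuple.
    have Et : map_tuple (teval M (fun x => nth (iv x) t x)) (idt L n) = t.
      apply: val_inj; rewrite idt_map -[RHS](mkseq_nth (iv 0)) size_tuple.
      apply/eq_in_map => i; rewrite mem_iota => hi; apply: set_nth_default.
      by rewrite size_tuple.
    move=> /=; rewrite Et => -[h1 h2]; apply: ht.
    by split=> ? ; apply: contrapT => ?; [apply: h1|apply: h2].
  move=> /sat_FExs_inv [iv' /=]; rewrite e => h; apply: h.
  by split=> -[h1 h2]; apply: h2.
- by move=> /=; rewrite IH.
- by move=> /=; rewrite IHp IHq.
- by split=> -[a /IH]; exists a.
- by split=> -[S ? /IH]; exists S.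
Qed.

Definition updT (eT : term L -> nat) x k : term L -> nat :=
  fun t => if t is TVar y then if y == x then k else eT t else eT t.

Definition updE (e2 : nat -> nat -> nat) n X k : nat -> nat -> nat :=
  fun m Y => if (m, Y) == (n, X) then k else e2 m Y.

(* The values of terms are in the counters [eT], those of relation variables
   and symbols in the arrays [e2] and [e3]. *)
Fixpoint ev (b : bool) (eT : term L -> nat) (e2 : nat -> nat -> nat) (e3 : psym L -> nat)
    (d : nat) (p : formula L) : prog :=
  match p with
  | FEq s t => if b then eqt (eT s) (eT t) else Alt (ltt (eT s) (eT t)) (ltt (eT t) (eT s))
  | FVEq _ _ _ => Stop
  | FVar n X ts => lookup b (e2 n X) (map eT ts)
  | FSym C ts =>
      if C is Some D then lookup b (e3 D) (map eT ts)
      else let x := nth 0 (map eT ts) 0 in let y := nth 0 (map eT ts) 1 in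
           if b then let_ x y else ltt y x
  | FNot p => ev (~~ b) eT e2 e3 d p
  | FAnd p q => if b then Seq (ev b eT e2 e3 d p) (ev b eT e2 e3 d q)
                else Alt (ev b eT e2 e3 d p) (ev b eT e2 e3 d q)
  | FEx x p =>
      let body := ev b (updT eT x (reg d)) e2 e3 d.+1 p in
      if b then Seq (guess (reg d)) (Seq body (mv (reg d) [::]))
      else Seq body (Seq (Star (Seq (ltt (reg d) 0) (Seq (Do (Inc (reg d))) body)))
             (Seq (eqt (reg d) 0) (mv (reg d) [::])))
  | SEx n X p =>
      if b then Seq (guessarr n.+1 d) (ev b eT (updE e2 n X d) e3 d.+1 p) else Stop
  end.

Definition holds_array m k (s : store) (A : nat) (R : set (k.+1.-tuple 'I_m.+1)) : Prop :=
  exists tail, (arr s A).2 = char_string R ++ tail.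

(** The depth [d] is at once the number of the first free register and of the first free array. A
    term without a register of its own reads counter 0. *)
Record represents (m : nat) (M : henkin L 'I_m.+1) (iv : nat -> 'I_m.+1)
    (rv : forall n, nat -> set (n.+1.-tuple 'I_m.+1))
    (eT : term L -> nat) (e2 : nat -> nat -> nat) (e3 : psym L -> nat) (d : nat)
    (p : formula L) (s : store) : Prop := Represents {
  rep_scratch : scratch s;
  rep_m : cnt s 0 = m;
  rep_free : forall r, d <= r -> cnt s (reg r) = 0;
  rep_parked : forall k, (arr s k).1 = [::];
  rep_eT : forall t, eT t = 0 \/ 5 <= eT t < reg d;
  rep_var : forall x, cnt s (eT (TVar x)) = iv x;
  rep_csym : forall c, c \in csyms p -> cnt s (eT (TCst c)) = cI M c;
  rep_frv : forall n X, (n, X) \in frv p -> e2 n X < d /\ holds_array s (e2 n X) (rv n X);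
  rep_psym : forall C, C \in psyms p -> e3 C < d /\ holds_array s (e3 C) (rI M (Some C))
}.

Lemma represents_eqv m (M : henkin L 'I_m.+1) iv rv eT e2 e3 d p s s' :
  eqv d s s' -> represents M iv rv eT e2 e3 d p s -> represents M iv rv eT e2 e3 d p s'.
Proof.
move=> [c i a pk] [h1 h2 h3 h4 h5 h6 h7 h8 h9]; split=> //.
- by move: h1; rewrite /scratch !c.
- by rewrite -c.
- by move=> r; rewrite -c; apply: h3.
- by move=> x; rewrite -c.
- by move=> x; rewrite -c; apply: h7.
- by move=> n X /h8 [ed [tl e]]; split=> //; exists tl; rewrite -a.
- by move=> C /h9 [ed [tl e]]; split=> //; exists tl; rewrite -a.
Qed.

Lemma represents_sub m (M : henkin L 'I_m.+1) iv rv eT e2 e3 d p q s :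
  {subset csyms q <= csyms p} -> {subset frv q <= frv p} -> {subset psyms q <= psyms p} ->
  represents M iv rv eT e2 e3 d p s -> represents M iv rv eT e2 e3 d q s.
Proof.
move=> cq fq pq [h1 h2 h3 h4 h5 h6 h7 h8 h9]; split=> //.
- by move=> c /cq /h7.
- by move=> n X /fq /h8.
- by move=> C /pq /h9.
Qed.

Section Terms.
Variables (m : nat) (M : henkin L 'I_m.+1) (iv : nat -> 'I_m.+1)
  (rv : forall n, nat -> set (n.+1.-tuple 'I_m.+1))
  (eT : term L -> nat) (e2 : nat -> nat -> nat) (e3 : psym L -> nat) (d : nat)
  (p : formula L) (s : store).
Hypothesis rep : represents M iv rv eT e2 e3 d p s.

Lemma variable_eT t : variable (eT t).
Proof. by case: (rep_eT rep t) => [->//|]; rewrite /variable; lia. Qed.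

Lemma cnt_eT t : {subset tcsyms t <= csyms p} -> cnt s (eT t) = teval M iv t.
Proof.
case: t => [x|c] h; first exact: (rep_var rep).
by apply: (rep_csym rep); apply: h; rewrite inE.
Qed.

Lemma cnt_eT_map (ts : seq (term L)) : {subset flatten [seq tcsyms t | t <- ts] <= csyms p} ->
  map (cnt s) (map eT ts) = map val (map (teval M iv) ts).
Proof.
elim: ts => //= t ts IH h; rewrite IH; last by move=> c hc; apply: h; rewrite mem_cat hc orbT.
by rewrite cnt_eT // => c hc; apply: h; rewrite mem_cat hc.
Qed.

Lemma checks_lookup b k (R : set (k.+1.-tuple 'I_m.+1)) A (ts : k.+1.-tuple (term L)) :
  {subset flatten [seq tcsyms t | t <- ts] <= csyms p} -> holds_array s A R ->
  checks d (lookup b A (map eT ts)) s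
    (if b then R (map_tuple (teval M iv) ts) else ~ R (map_tuple (teval M iv) ts))
    (100 * k.+2 * m.+1 ^ k.+1).
Proof.
move=> hts [tl hA]; apply: checks_test; first exact: (rep_parked rep).
have hm := cnt_eT_map hts.
have hh : hval (cnt s 0) 0 (map (cnt s) (map eT ts)) = index_of (map_tuple (teval M iv) ts).
  by rewrite hm (rep_m rep).
have := @test_lookup b A (map eT ts) s (char_string R ++ tl).
rewrite hh (rep_m rep) size_map size_tuple => h; apply: test_ext (h _ (rep_scratch rep) _ _ _).
- rewrite nth_cat size_char_string index_of_lt.
  have := char_stringP R (map_tuple (teval M iv) ts).
  case: nth => -[h1 h2]; [have hR := h1 isT|have hR : ~ R (map_tuple (teval M iv) ts) by move=> /h2];
    by case: (b); split.
- by apply/allP => x; elim: (ts : seq _) => //= t ts' IH; rewrite inE => /orP[/eqP ->|/IH //]; apply: variable_eT.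
- move=> x xs; have : cnt s x \in map (cnt s) (map eT ts) by apply: map_f.
  by rewrite hm => /mapP[i _ ->]; rewrite -ltnS ltn_ord.
- by rewrite -hA -(rep_parked rep A) -surjective_pairing.
- by rewrite size_cat size_char_string ltn_addr // index_of_lt.
Qed.

End Terms.

Lemma eqv_refl d s : (forall k, (arr s k).1 = [::]) -> eqv d s s.
Proof. by []. Qed.

Section Quantifiers.
Variables (m : nat) (M : henkin L 'I_m.+1) (iv : nat -> 'I_m.+1)
  (rv : forall n, nat -> set (n.+1.-tuple 'I_m.+1))
  (eT : term L -> nat) (e2 : nat -> nat -> nat) (e3 : psym L -> nat) (d : nat) (s : store).

Lemma represents_FEx x p (a : 'I_m.+1) : represents M iv rv eT e2 e3 d (FEx x p) s ->
  represents M (fun y => if y == x then a else iv y) rv (updT eT x (reg d)) e2 e3 d.+1 p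
    (setc s (reg d) a).
Proof.
move=> [h1 h2 h3 h4 h5 h6 h7 h8 h9].
have ne t : eT t != reg d by case: (h5 t) => [->|]; rewrite /reg; lia.
split=> //=.
- by move: h1; rewrite /scratch /= /upd /reg !addnS.
- by rewrite /upd /reg addnS.
- move=> r dr; rewrite /upd ifN; first by apply: h3; apply: ltnW.
  by rewrite /reg; lia.
- move=> t; have H : eT t = 0 \/ 5 <= eT t < reg d.+1.
    by case: (h5 t) => h; [left|right; move: h; rewrite /reg; lia].
  by case: t H => [y|c] //= H; case: eqP => // _; right; rewrite /reg; lia.
- by move=> y; case: (y =P x) => _; rewrite /upd ?eqxx // (negbTE (ne _)) h6.
- by move=> c hc; rewrite /upd (negbTE (ne _)) h7.
- by move=> n X /h8 [ed H]; split=> //; apply: ltnW.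
- by move=> C /h9 [ed H]; split=> //; apply: ltnW.
Qed.

Lemma represents_SEx n X p r (S : set (n.+1.-tuple 'I_m.+1)) :
  represents M iv rv eT e2 e3 d (SEx n X p) s ->
  represents M iv (rupd rv X S) eT (updE e2 n X d) e3 d.+1 p
    (seta s d ([::], char_string S ++ r)).
Proof.
move=> [h1 h2 h3 h4 h5 h6 h7 h8 h9]; split=> //=.
- by move=> k dk; apply: h3; apply: ltnW.
- by move=> k; rewrite /upd; case: eqP.
- by move=> t; case: (h5 t) => [|h]; [left|right; move: h; rewrite /reg; lia].
- move=> k Y kY; rewrite /updE; case: (eqVneq (k, Y) (n, X)) => [[-> ->]|ne].
    by rewrite rupd_same; split=> //; exists r; rewrite /= /upd eqxx.
  rewrite rupd_other //; have [|ed [tl H]] := h8 k Y; first by rewrite /= mem_filter ne.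
  by split; [apply: ltnW|exists tl; rewrite /= /upd ltn_eqF].
- move=> C /h9 [ed [tl H]]; by split; [apply: ltnW|exists tl; rewrite /= /upd ltn_eqF].
Qed.

End Quantifiers.

Lemma checks_exists d x p (s : store) (C : nat -> Prop) m b : variable x -> x != 0 ->
  scratch s -> cnt s x = 0 -> cnt s 0 = m -> (forall k, (arr s k).1 = [::]) ->
  (forall v, v <= m -> checks d p (setc s x v) (C v) b) ->
  checks d (Seq (guess x) (Seq p (mv x [::]))) s (exists2 v, v <= m & C v)
    (1010 * m.+1 ^ 2 + b).
Proof.
move=> vx x0 sc zx sm pk hp; have := runs_guess vx x0 sc zx; rewrite sm => -[g1 g2].
have back v s2 : eqv d (setc s x v) s2 -> eqv d s (setc s2 x 0).
  move=> [c i a k]; split=> // j; rewrite /= /upd; case: eqP => [->//|/eqP ne].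
  by rewrite -c /= /upd (negbTE ne).
split.
  move=> t s' [t1 [t2 [s1 [_ /g1 [v vm ->] [t3 [t4 [s2 [_ e3 e4]]]]]]]].
  have [hC v2] := (hp v vm).1 _ _ e3; split; first by exists v.
  by rewrite ((runs_clear s2 x).1 _ _ e4); apply: back v2.
move=> [v vm hC]; have [t1 l1 e1] := g2 (setc s x v) (ex_intro2 _ _ v vm erefl).
have [t2 [s2 [l2 e2 v2]]] := (hp v vm).2 hC.
have [t3 l3 e3] := (runs_clear s2 x).2 _ erefl.
have cx : cnt s2 x = v by case: v2 => <- _ _ _; rewrite /= /upd eqxx.
exists (t1 + (t2 + t3)), (setc s2 x 0); split; last exact: back v2.
  move: l3; rewrite cx expnS expn1 in l1 *; move: l1; nia.
by exists t1, (t2 + t3), (setc s x v); split=> //; exists t2, t3, s2.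
Qed.

(** The value 0 is checked before the loop and each further value after an increment; the final
    comparison blocks every run that leaves the loop before m. The checks may guess different
    relations for different values. *)
Lemma checks_forall d x p (s : store) (C : nat -> Prop) m b : variable x -> x != 0 ->
  scratch s -> cnt s x = 0 -> cnt s 0 = m -> (forall k, (arr s k).1 = [::]) ->
  (forall v s1, v <= m -> eqv d (setc s x v) s1 -> checks d p s1 (C v) b) ->
  checks d (Seq p (Seq (Star (Seq (ltt x 0) (Seq (Do (Inc x)) p)))
             (Seq (eqt x 0) (mv x [::])))) s (forall v, v <= m -> C v)
    (b + ((m * (b + 200 * m.+1)).+1 + 300 * m.+1)).
Proof.
move=> vx x0 sc zx sm pk hp; set body := Seq (ltt x 0) _.
have /and3P[x1 x2 x4] := vx.
pose In i u := eqv d (setc s x i) u.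
have s0 : eqv d (setc s x 0) s.
  by split=> // j; rewrite /= /upd; case: eqP => [->|].
have cx i u : In i u -> [/\ cnt u x = i, cnt u 0 = m & scratch u].
  move=> [c _ _ _]; rewrite /scratch -!c /= /upd eqxx (eq_sym 0) (eq_sym 1) (eq_sym 2) (eq_sym 4).
  by rewrite (negbTE x0) (negbTE x1) (negbTE x2) (negbTE x4).
have lt_test i u : In i u -> is_test (ltt x 0) u (i < m) (70 * (i + m).+1).
  by move=> Iu; have [c1 c2 su] := cx _ _ Iu; have := test_ltt vx (isT : variable 0) su; rewrite c1 c2.
have inc i u : In i u -> In i.+1 (setc u x (cnt u x).+1).
  move=> Iu; have [-> _ _] := cx _ _ Iu; have := eqv_setc x i.+1 Iu.
  suff -> : setc (setc s x i) x i.+1 = setc s x i.+1 by [].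
  by apply: store_ext => // j; rewrite /= /upd; case: eqP.
have fin u : In m u -> runs (Seq (eqt x 0) (mv x [::])) u (fun s' => s' = setc u x 0)
    (70 * (m + m).+1 + 4 * m.+1).
  move=> Iu; have [c1 c2 su] := cx _ _ Iu; have h := test_eqt vx (isT : variable 0) su.
  rewrite c1 c2 in h; have h1 : runs (eqt x 0) u (fun s' => s' = u) (70 * (m + m).+1).
    by apply: runs_ext h => s'; split=> [[]|].
  by apply: runs_seq_eq h1 _; have := runs_clear u x; rewrite c1.
have back i u : In i u -> eqv d s (setc u x 0).
  move=> [c w a k]; split=> // j; rewrite /= /upd; case: eqP => [->//|/eqP ne].
  by rewrite -c /= /upd (negbTE ne).
have round i u : In i u -> i < m -> forall t u', exec body t u u' -> C i.+1 /\ In i.+1 u'.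
  move=> Iu im t u' [t1 [t2 [u1 [_ /(lt_test _ _ Iu).1 [_ ->] [t3 [t4 [u2 [_ [_ ->] e4]]]]]]]].
  have [hC v] := (hp i.+1 _ im (inc _ _ Iu)).1 _ _ e4.
  by split=> //; apply: eqv_trans (inc _ _ Iu) v.
have stuck i u : In i u -> m <= i -> forall t u', ~ exec body t u u'.
  move=> Iu mi t u' [t1 [t2 [u1 [_ /(lt_test _ _ Iu).1 [h _] _]]]].
  by move: h; rewrite ltnNge mi.
split.
  move=> t s' [t1 [t2 [s1 [_ e1 [t3 [t4 [s2 [_ st e4]]]]]]]].
  have [C0 v1] := (hp 0 s (leq0n _) s0).1 _ _ e1.
  have : exists i, [/\ i <= m, In i s2 & forall v, v <= i -> C v].
    have : exists i, [/\ i <= m, In i s1 & forall v, v <= i -> C v].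
      exists 0; split=> //; first exact: eqv_trans s0 v1.
      by move=> v; rewrite leqn0 => /eqP ->.
    elim: st {e4 v1 e1} => // t5 t6 u v w e5 _ IH [i [im Iu hC]]; apply: IH.
    move: im; rewrite leq_eqVlt => /orP[/eqP im|im].
      by case: (stuck i u Iu _ _ _ e5); rewrite im.
    have [Ci Iv] := round _ _ Iu im _ _ e5; exists i.+1; split=> // k.
    by rewrite leq_eqVlt => /orP[/eqP ->|/hC].
  move=> [i [im Iu hC]].
  have {im} im : i = m.
    have [c1 c2 su] := cx _ _ Iu; have h := test_eqt vx (isT : variable 0) su.
    by case: e4 => t5 [t6 [s3 [_ /h.1 [h' _] _]]]; rewrite c1 c2 in h'.
  rewrite im in Iu hC; rewrite ((fin _ Iu).1 _ _ e4); split=> //.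
  exact: back Iu.
move=> hC; have [t1 [s1 [l1 e1 v1]]] := (hp 0 s (leq0n _) s0).2 (hC 0 (leq0n _)).
have : forall i, i <= m -> exists2 t, t <= (i * (b + 200 * m.+1)).+1 &
    exists2 u, star (exec body) t s1 u & In i u.
  elim=> [|i IH] im; first by exists 1 => //; exists s1; [apply: star0|apply: eqv_trans s0 v1].
  have [t2 l2 [u st Iu]] := IH (ltnW im).
  have [t3 l3 e3] := (lt_test _ _ Iu).2 _ (conj im erefl).
  have [t4 [u' [l4 e4 v4]]] := (hp i.+1 _ im (inc _ _ Iu)).2 (hC _ im).
  exists (t2 + (t3 + (2 + t4))).+1.
    by rewrite mulSn; lia.
  exists u'; last exact: eqv_trans (inc _ _ Iu) v4.
  apply: star_snoc st _; exists t3, (2 + t4), u; split=> //.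
  by exists 2, t4, (setc u x (cnt u x).+1).
move=> /(_ m (leqnn _)) [t2 l2 [u st Iu]].
have [t3 l3 e3] := (fin _ Iu).2 _ erefl.
exists (t1 + (t2 + t3)), (setc u x 0); split; last exact: back Iu.
  by lia.
by exists t1, (t2 + t3), s1; split=> //; exists t2, t3, u.
Qed.

(** The program and the bound depend on the formula and the layout alone and are the same for all m,
    as one machine with a polynomial clock requires. Relations are guessed where their quantifiers
    are met, so quantifiers of both orders may be nested freely. *)
Theorem checks_ev (p : formula L) b eT e2 e3 d : sigma b p -> no_veq p ->
  exists2 f, poly f & forall m (M : henkin L 'I_m.+1) iv rv s,
    standard M -> usual_order M -> represents M iv rv eT e2 e3 d p s ->
    checks d (ev b eT e2 e3 d p) s (if b then sat M iv rv p else ~ sat M iv rv p) (f m).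
Proof.
elim: p b eT e2 e3 d => [t u|n X Y|n X ts|C ts|p IH|p IHp q IHq|x p IH|n X p IH] b eT e2 e3 d //= sp np.
- exists (fun m => 300 * m.+1 ^ 1); first exact: poly_pow.
  move=> m M iv rv s stM uM rep.
  have ht : cnt s (eT t) = teval M iv t by apply: (cnt_eT rep) => c hc; rewrite /= mem_cat hc.
  have hu : cnt s (eT u) = teval M iv u by apply: (cnt_eT rep) => c hc; rewrite /= mem_cat hc orbT.
  have lt := ltn_ord (teval M iv t); have lu := ltn_ord (teval M iv u).
  have vt := variable_eT rep t; have vu := variable_eT rep u; have sc := rep_scratch rep.
  apply: checks_test; first exact: (rep_parked rep).
  case: b {sp}.
    apply: runs_le (test_ext _ (test_eqt vt vu sc)); first by rewrite ht hu expn1; lia.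
    by rewrite ht hu; split=> [/val_inj|->].
  apply: runs_le (test_ext _ (test_alt (b := 150 * m.+1) (runs_le _ (test_ltt vt vu sc)) (runs_le _ (test_ltt vu vt sc)))).
  + by rewrite expn1; lia.
  + rewrite ht hu; split=> [ne e|ne]; first by move: ne; rewrite e ltnn => -[].
    by apply/orP; rewrite -neq_ltn; apply/eqP => /val_inj.
  + by rewrite ht hu; lia.
  + by rewrite ht hu; lia.
- exists (fun m => 100 * n.+2 * m.+1 ^ n.+1); first exact: poly_pow.
  move=> m M iv rv s stM uM rep; have [|_ hA] := rep_frv rep (n := n) (X := X); first by rewrite /= mem_head.
  exact: (checks_lookup rep).
- case: C ts => [D|] ts /=.
    exists (fun m => 100 * (par D).+2 * m.+1 ^ (par D).+1); first exact: poly_pow.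
    move=> m M iv rv s stM uM rep; have [|_ hA] := rep_psym rep (C := D); first by rewrite /= mem_head.
    exact: (checks_lookup rep b (R := rI M (Some D))).
  exists (fun m => 300 * m.+1 ^ 1); first exact: poly_pow.
  move=> m M iv rv s stM uM rep.
  case: ts rep => -[|t [|u [|v ts]]] //= hts rep.
  have ht : cnt s (eT t) = teval M iv t by apply: (cnt_eT rep) => c hc; rewrite /= mem_cat hc.
  have hu : cnt s (eT u) = teval M iv u.
    by apply: (cnt_eT rep) => c hc; rewrite /= !mem_cat hc orbT.
  have lt := ltn_ord (teval M iv t); have lu := ltn_ord (teval M iv u).
  have vt := variable_eT rep t; have vu := variable_eT rep u; have sc := rep_scratch rep.
  have hs : rI M None (map_tuple (teval M iv) (@Tuple 2 _ [:: t; u] hts)) <-> teval M iv t <= teval M iv u.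
    rewrite -uM /hle; suff -> : map_tuple (teval M iv) (@Tuple 2 _ [:: t; u] hts) = [tuple teval M iv t; teval M iv u] by [].
    exact: val_inj.
  apply: checks_test; first exact: (rep_parked rep).
  case: b {sp}.
    apply: runs_le (test_ext _ (test_let vt vu sc)); first by rewrite ht hu expn1; lia.
    by rewrite ht hu hs.
  apply: runs_le (test_ext _ (test_ltt vu vt sc)); first by rewrite ht hu expn1; lia.
  rewrite ht hu hs ltnNge; by split=> [/negP|/negP].
- have [f pf hf] := IH (~~ b) eT e2 e3 d sp np; exists f => // m M iv rv s stM uM rep.
  have repp : represents M iv rv eT e2 e3 d p s by apply: represents_sub rep.
  have := hf m M iv rv s stM uM repp.
  by apply: checks_ext; case: (b) => //=; rewrite not_notE.
- move/andP: sp => [sp sq]; move/andP: np => [np nq].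
  have [f pf hf] := IHp b eT e2 e3 d sp np; have [g pg hg] := IHq b eT e2 e3 d sq nq.
  exists (fun m => f m + g m + 1); first by apply: poly_add; [apply: poly_add|apply: poly_const].
  move=> m M iv rv s stM uM rep.
  have repp : represents M iv rv eT e2 e3 d p s.
    by apply: represents_sub rep => /= c hc; rewrite mem_cat hc.
  have repq : represents M iv rv eT e2 e3 d q s.
    by apply: represents_sub rep => /= c hc; rewrite mem_cat hc orbT.
  have h1 := hf m M iv rv s stM uM repp; have h2 := hg m M iv rv s stM uM repq.
  case: (b) h1 h2 hg => /= h1 h2 hg.
    apply: (@checks_le _ _ _ _ (f m + g m)); first exact: leq_addr.
    apply: checks_seq h1 _ => s1 v1; apply: hg => //; exact: represents_eqv v1 repq.
  rewrite addn1; apply: checks_ext (checks_alt h1 h2); by rewrite not_andE.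
- have [f pf hf] := IH b (updT eT x (reg d)) e2 e3 d.+1 sp np.
  exists (fun m => 1010 * m.+1 ^ 2 + f m + (m.+1 * (f m + 200 * m.+1) + 302 * m.+1)).
    have p1 c : poly (fun m => c * m.+1) by apply: poly_le (poly_pow c 1) => m; rewrite expn1.
    have p2 : poly (fun m => m.+1) by apply: poly_le (p1 1) => m; rewrite mul1n.
    apply: poly_add; first by apply: poly_add => //; apply: poly_pow.
    apply: poly_add => //; apply: poly_mul => //; exact: poly_add.
  move=> m M iv rv s stM uM rep.
  have r0 : reg d != 0 by rewrite /reg addnS.
  have zr := rep_free rep (leqnn d); have sc := rep_scratch rep; have pk := rep_parked rep.
  have hm := rep_m rep.
  pose C v := if b then sat M (fun y => if y == x then inord v else iv y) rv p
     else ~ sat M (fun y => if y == x then inord v else iv y) rv p.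
  have hC v s1 : v <= m -> eqv d (setc s (reg d) v) s1 ->
      checks d (ev b (updT eT x (reg d)) e2 e3 d.+1 p) s1 (C v) (f m).
    move=> vm [c1 i1 a1 p1].
    (* With the register of the quantifier reset, the store is equivalent to [s] again and thus
       represents the quantified formula. *)
    have e0 : eqv d s (setc s1 (reg d) 0).
      split=> // j; rewrite /= /upd; case: eqP => [-> //|/eqP ne].
      by rewrite -c1 /= /upd (negbTE ne).
    have E : setc (setc s1 (reg d) 0) (reg d) v = s1.
      apply: store_ext => // j; rewrite /= /upd; case: eqP => // ->.
      by rewrite -c1 /= /upd eqxx.
    have rep1 := represents_FEx (inord v) (represents_eqv e0 rep).
    rewrite inordK // E in rep1.
    have [k1 k2] := hf m M _ rv s1 stM uM rep1.
    split=> [t s' /k1 [? /eqv_weaken ?] //|/k2 [t [s' [? ? /eqv_weaken ?]]]].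
    by exists t, s'.
  have sval_inord (a : 'I_m.+1) : (fun y => if y == x then inord a else iv y) = (fun y => if y == x then a else iv y).
    by rewrite inord_val.
  case: b {sp hf IH} @C hC => C hC.
    apply: checks_le (checks_ext _ (checks_exists (b := f m) (variable_reg d) r0 sc zr hm pk
      (fun v vm => hC v _ vm (eqv_refl _ (s := setc s (reg d) v) pk)))); first exact: leq_addr.
    split=> [[v vm hv]|[a ha]]; first by exists (inord v).
    by exists a; [rewrite -ltnS ltn_ord|rewrite /C sval_inord].
  apply: checks_le (checks_ext _ (checks_forall (b := f m) (variable_reg d) r0 sc zr hm pk hC)).
    by nia.
  split=> [h [a ha]|h v vm hv]; last by apply: h; exists (inord v).
  by apply: (h a); [rewrite -ltnS ltn_ord|rewrite sval_inord].
- move/andP: sp => [bt sp]; rewrite bt in sp *.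
  have [f pf hf] := IH true eT (updE e2 n X d) e3 d.+1 sp np.
  exists (fun m => 150 * n.+2 * m.+1 ^ n.+1 + f m); first by apply: poly_add => //; apply: poly_pow.
  move=> m M iv rv s stM uM rep; have sc := rep_scratch rep; have pk := rep_parked rep.
  have hm := rep_m rep.
  have eA : arr s d = ([::], (arr s d).2) by rewrite -(pk d) -surjective_pairing.
  have [g1 g2] := runs_guessarr n.+1 sc eA; rewrite hm in g1 g2.
  have back (S : set (n.+1.-tuple 'I_m.+1)) r s2 : eqv d.+1 (seta s d ([::], char_string S ++ r)) s2 -> eqv d s s2.
    move=> [c i a k]; split=> // j jd; rewrite -a ?ltnS 1?ltnW //= /upd ltn_eqF //.
  split.
    move=> t s' [t1 [t2 [s1 [_ /g1 [bits sb ->] e2']]]].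
    have [S eS] := char_string_onto sb; rewrite -eS in e2'.
    have [hp v] := (hf m M iv _ _ stM uM (represents_SEx _ S rep)).1 _ _ e2'.
    by split; [exists S => //; rewrite stM|apply: back v].
  move=> [S _ hp].
  have [|t1 l1 e1] := g2 (seta s d ([::], char_string S ++ drop (size (char_string S)) (arr s d).2)).
    by exists (char_string S) => //; rewrite size_char_string.
  have [t2 [s2 [l2 e2' v2]]] := (hf m M iv _ _ stM uM
    (represents_SEx (drop (size (char_string S)) (arr s d).2) S rep)).2 hp.
  exists (t1 + t2), s2; split; [exact: leq_add| |apply: back v2].
  by exists t1, t2, (seta s d ([::], char_string S ++ drop (size (char_string S)) (arr s d).2)).
Qed.

End Evaluation.

(** * Instances *)

Section Encoding.
Variable L : signature.

(* The characteristic strings in an encoding: those of the displayed relation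
   variables, of relation symbols, and of the singletons of constants. *)
Definition block : Type := ((nat * nat) + (psym L + csym L))%type.

Definition bar (b : block) : nat :=
  match b with inl Y => Y.1 | inr (inl C) => par C | inr (inr _) => 0 end.

Definition interp (m : nat) : Type := forall b : block, set ((bar b).+1.-tuple 'I_m.+1).

Definition bset m (M : henkin L 'I_m.+1) (rv : forall n, nat -> set (n.+1.-tuple 'I_m.+1)) :
    interp m := fun b =>
  match b with
  | inl Y => rv Y.1 Y.2
  | inr (inl C) => rI M (Some C)
  | inr (inr c) => [set t : 1.-tuple 'I_m.+1 | thead t = cI M c]
  end.

Definition fin_model m (S : interp m) (v : csym L -> 'I_m.+1) : henkin L 'I_m.+1 :=
  @Henkin L 'I_m.+1 (inhabits ord0) (fun n => setT) (fun n => ex_intro _ set0 I) v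
    (fun C => match C return set ((rar C).+1.-tuple 'I_m.+1) with
              | Some D => S (inr (inl D))
              | None => [set t : 2.-tuple 'I_m.+1 | tnth t ord0 <= tnth t (lift ord0 ord0)]
              end).

Definition fin_env m (S : interp m) : forall n, nat -> set (n.+1.-tuple 'I_m.+1) :=
  fun n X => S (inl (n, X)).

Lemma fin_model_standard m (S : interp m) v : standard (fin_model S v).
Proof. by []. Qed.

Lemma fin_model_order m (S : interp m) v : usual_order (fin_model S v).
Proof. by []. Qed.

Definition body m (bl : seq block) (S : interp m) : seq bool :=
  flatten [seq char_string (S b) | b <- bl].

Definition word m (bl : seq block) (S : interp m) : seq bool :=
  nseq m true ++ false :: body bl S.

Definition blocks_size m (bl : seq block) : nat := sumn [seq m.+1 ^ (bar b).+1 | b <- bl].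

Lemma size_body m bl (S : interp m) : size (body bl S) = blocks_size m bl.
Proof.
rewrite /body size_flatten /shape -map_comp /blocks_size; congr sumn.
by apply: eq_map => b; rewrite /= size_char_string.
Qed.

Lemma body_onto m bl u : uniq bl -> size u = blocks_size m bl -> exists S : interp m, u = body bl S.
Proof.
elim: bl u => [|b bl IH] u /=.
  by move=> _ /size0nil ->; exists (fun _ => set0).
move=> /andP[bbl ubl]; rewrite /blocks_size /= -/(blocks_size m bl) => su.
set N := _ ^ _ in su.
have [|R eR] := @char_string_onto m (bar b) (take N u); first by rewrite size_takel // su leq_addr.
have [|S eS] := IH (drop N u) ubl; first by rewrite size_drop su addKn.
(* The type of a value depends on the block, so [R] is put in place at [b] by a cast along the
   decided equality. *)
exists (fun b' => match b =P b' with ReflectT e => ecast x (set ((bar x).+1.-tuple 'I_m.+1)) e R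
                  | _ => S b' end).
rewrite /body /= -[LHS](cat_take_drop N) -eR eS; congr (_ ++ _).
  by case: eqP => // e; rewrite eq_axiomK.
congr flatten; apply/eq_in_map => b' hb'; case: eqP => // e; by rewrite e hb' in bbl.
Qed.

Lemma body_inj m bl (S S' : interp m) : body bl S = body bl S' -> {in bl, forall b, S b = S' b}.
Proof.
elim: bl => //= b bl IH /eqP; rewrite eqseq_cat ?size_char_string // => /andP[/eqP /char_string_inj e /eqP /IH h].
by move=> b'; rewrite inE => /orP[/eqP ->|/h].
Qed.

Lemma nseq_false_inj m u m' u' :
  nseq m true ++ false :: u = nseq m' true ++ false :: u' -> m = m' /\ u = u'.
Proof.
elim: m m' => [|m IH] [|m'] //=; first by move=> [].
by move=> [/IH [-> ->]].
Qed.

Lemma split_ones (w : seq bool) : exists k u, w = nseq k true ++ u /\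
  (u = [::] \/ exists u', u = false :: u').
Proof.
elim: w => [|[] w [k [u [-> h]]]]; first by exists 0, [::]; split=> //; left.
  by exists k.+1, u.
by exists 0, (false :: nseq k true ++ u); split=> //; right; eexists.
Qed.

(** The closing test enforces m >= 1. *)
Definition header : prog :=
  Seq (Star (Seq (Do (InGet true)) (Do (Inc 0)))) (Seq (Do (InGet false)) (positive 0)).

Definition store1 (m : nat) (u : seq bool) : store :=
  Store (upd (fun _ => 0) 0 m) (fun _ => ([::], [::])) u.

Lemma runs_header k u : (u = [::] \/ exists u', u = false :: u') ->
  runs header (store0 (nseq k true ++ u))
    (fun s' => (0 < k /\ u != [::]) /\ s' = store1 k (behead u)) (20 * k.+1).
Proof.
move=> hu; pose f i := Store (upd (fun _ => 0) 0 i) (fun _ => ([::], [::])) (nseq (k - i) true ++ u).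
have hq i : runs (Seq (Do (InGet false)) (positive 0)) (f i)
    (fun s' => (exists2 u', nseq (k - i) true ++ u = false :: u' & s' = store1 i u') /\ 0 < i) 6.
  apply: runs_ext (runs_seq (runs_do (InGet false) (f i)) (fun s1 _ => test_positive 0 s1)) => s' /=.
  split=> [[s1 [u' e ->] [h ->]]|[[u' e ->] h]]; first by split=> //; exists u'.
  by exists (seti (f i) u') => //; exists u'.
apply: runs_le (@runs_while _ _ f k _ _ 4 6 _ _ _ _ _); first by lia.
- by rewrite /f subn0; apply: store_ext => // j; rewrite /= /upd; case: eqP.
- move=> i ik; apply: runs_ext (runs_seq (runs_do _ _) (fun s1 _ => runs_do _ s1)) => s' /=.
  have -> : k - i = (k - i.+1).+1 by lia.
  have E : setc (seti (f i) (nseq (k - i.+1) true ++ u)) 0 (upd (fun _ => 0) 0 i 0).+1 = f i.+1.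
    by apply: store_ext => //= j; rewrite /upd; case: eqP.
  split=> [[s1 [w [<-] ->] ->]|->]; first exact: E.
  by eexists; [eexists; [reflexivity|reflexivity]|rewrite /= E].
- apply: runs_ext (runs_seq (runs_do _ _) (fun s1 _ => runs_do _ s1)) => s' /=.
  rewrite subnn /=; split=> // -[s1 [w e _] _].
  by case: hu => [hu|[u' hu]]; rewrite hu in e.
- move=> i ik; apply: runs_ext (hq i) => s'; have -> : k - i = (k - i.+1).+1 by lia.
  by split=> // -[[u' //]].
- apply: runs_ext (hq k) => s'; rewrite subnn /=.
  case: hu => [->|[u' ->]]; first by split=> [[[]]|[[]]].
  by split=> [[[u'' [<-] ->] ?]|[[? _] ->]] //; split=> //; exists u'.
Qed.

Lemma header_sound t w s' : exec header t (store0 w) s' ->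
  exists m u, [/\ 0 < m, w = nseq m true ++ false :: u & s' = store1 m u].
Proof.
have [k [u [-> hu]]] := split_ones w; move=> /(runs_header k hu).1 [[k0 nu] ->].
case: hu nu => [->//|[u' ->]] _; by exists k, u'.
Qed.

Lemma header_complete m u : 0 < m ->
  exists2 t, t <= 20 * m.+1 & exec header t (store0 (nseq m true ++ false :: u)) (store1 m u).
Proof.
move=> m0; have hu : false :: u = [::] \/ exists u', false :: u = false :: u' by right; exists u.
by have [_ h] := runs_header m hu; apply: h.
Qed.

Definition loadable (m d : nat) (s : store) : Prop :=
  [/\ scratch s, cnt s 0 = m, (forall k, (arr s k).1 = [::]) &
      forall r, d <= r -> cnt s (reg r) = 0].

Definition filled m (S : interp m) (j : nat) (bl : seq block) (s s' : store) : Prop :=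
  [/\ cnt s =1 cnt s', forall k, (arr s' k).1 = [::], forall k, k < j -> arr s k = arr s' k &
      forall i b, i < size bl -> nth b bl i = b -> holds_array s' (j + i) (S b)].

Fixpoint readall (j : nat) (bl : seq block) : prog :=
  if bl is b :: bl' then Seq (readarr (bar b).+1 j) (readall j.+1 bl') else Skip.

Fixpoint guessall (j : nat) (bl : seq block) : prog :=
  if bl is b :: bl' then Seq (guessarr (bar b).+1 j) (guessall j.+1 bl') else Skip.

Definition cost (bl : seq block) (m : nat) : nat :=
  sumn [seq 150 * (bar b).+2 * m.+1 ^ (bar b).+1 | b <- bl] + 1.

Lemma poly_cost bl : poly (cost bl).
Proof.
apply: poly_add; last exact: poly_const.
elim: bl => [|b bl IH] /=; first exact: poly_const.
by apply: poly_add => //; apply: poly_pow.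
Qed.

Lemma loadable_filled m d (S : interp m) j bl s s' :
  filled S j bl s s' -> loadable m d s -> loadable m d s'.
Proof.
move=> [c p _ _] [sc m0 _ fr]; split=> //; first by move: sc; rewrite /scratch !c.
  by rewrite -c.
by move=> r /fr; rewrite c.
Qed.

Lemma filled_nil m (S : interp m) j s : (forall k, (arr s k).1 = [::]) -> filled S j [::] s s.
Proof. by []. Qed.

Lemma filled_cons m (S : interp m) j b bl s s1 s' : 
  (forall k, (arr s1 k).1 = [::]) -> cnt s =1 cnt s1 -> (forall k, k < j -> arr s k = arr s1 k) ->
  holds_array s1 j (S b) -> filled S j.+1 bl s1 s' -> filled S j (b :: bl) s s'.
Proof.
move=> p1 c1 a1 h1 [c p a h]; split=> //.
- by move=> k; rewrite c1 c.
- by move=> k kj; rewrite a1 // a // ltnW.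
- move=> [|i] b' /=; last by rewrite ltnS => ib e; rewrite addnS -addSn; apply: h.
  by move=> _ <-; case: h1 => tl e; exists tl; rewrite addn0 -a.
Qed.

(** The bits come first and [S] is any interpretation that they encode, so that one interpretation
    can later be chosen for the blocks read and the blocks guessed together. *)
Lemma readall_sound m d j bl t s s' : uniq bl -> loadable m d s -> exec (readall j bl) t s s' ->
  exists u, [/\ inp s = u ++ inp s', size u = blocks_size m bl &
    forall S : interp m, u = body bl S -> filled S j bl s s'].
Proof.
elim: bl j t s => [|b bl IH] j t s /=.
  move=> _ [_ _ pk _] [_ ->]; exists [::]; split=> // S _; exact: filled_nil.
move=> /andP[bbl ubl] ls [t1 [t2 [s1 [_ e1 e2]]]]; have [sc m0 pk fr] := ls.
have eA : arr s j = ([::], (arr s j).2) by rewrite -(pk j) -surjective_pairing.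
have [Nw es1] := (runs_readarr (bar b).+1 sc eA).1 _ _ e1; rewrite m0 in Nw es1.
have pk1 k : (arr s1 k).1 = [::] by rewrite es1 /= /upd; case: eqP.
have ls1 : loadable m d s1 by rewrite es1; split=> // k; move: (pk1 k); rewrite es1.
have [u [eu su hu]] := IH _ _ _ ubl ls1 e2.
exists (take (m.+1 ^ (bar b).+1) (inp s) ++ u); split.
- by rewrite -catA -eu es1 /= cat_take_drop.
- by rewrite size_cat size_takel // su.
- move=> S; rewrite /body /= => /eqP; rewrite eqseq_cat ?size_char_string ?size_takel // => /andP[/eqP eb /eqP /hu h].
  apply: filled_cons h => //; first by rewrite es1.
    by move=> k kj; rewrite es1 /= /upd ltn_eqF.
  by rewrite es1; eexists; rewrite /= /upd eqxx /= eb.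
Qed.

Lemma readall_complete m d j bl s (S : interp m) rest : loadable m d s ->
  inp s = body bl S ++ rest ->
  exists t s', [/\ t <= cost bl m, exec (readall j bl) t s s', inp s' = rest & filled S j bl s s'].
Proof.
elim: bl j s => [|b bl IH] j s ls /=.
  by move=> e; exists 1, s; split=> //; apply: filled_nil; case: ls.
rewrite /body /= -catA -/(body bl S) => e; have [sc m0 pk fr] := ls.
have eA : arr s j = ([::], (arr s j).2) by rewrite -(pk j) -surjective_pairing.
have := (runs_readarr (bar b).+1 sc eA).2 _ (conj _ erefl); rewrite m0 => /(_ _)[].
  by rewrite e size_cat size_char_string leq_addr.
rewrite e -(size_char_string (S b)) take_size_cat // drop_size_cat // => t1 l1 e1.
set s1 := seti _ _ in e1.
have pk1 k : (arr s1 k).1 = [::] by rewrite /= /upd; case: eqP.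
have [|t2 [s' [l2 e2 i2 f2]]] := IH j.+1 s1 _ erefl; first by [].
exists (t1 + t2), s'; split=> //.
- by rewrite size_char_string in l1; rewrite /cost /= -addnA leq_add.
- by exists t1, t2, s1.
- apply: filled_cons f2 => //; first by move=> k kj; rewrite /= /upd ltn_eqF.
  by eexists; rewrite /= /upd eqxx.
Qed.

Lemma guessall_sound m d j bl t s s' : uniq bl -> loadable m d s -> exec (guessall j bl) t s s' ->
  exists u, [/\ inp s = inp s', size u = blocks_size m bl &
    forall S : interp m, u = body bl S -> filled S j bl s s'].
Proof.
elim: bl j t s => [|b bl IH] j t s /=.
  move=> _ [_ _ pk _] [_ ->]; exists [::]; split=> // S _; exact: filled_nil.
move=> /andP[bbl ubl] ls [t1 [t2 [s1 [_ e1 e2]]]]; have [sc m0 pk fr] := ls.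
have eA : arr s j = ([::], (arr s j).2) by rewrite -(pk j) -surjective_pairing.
have [bits sb es1] := (runs_guessarr (bar b).+1 sc eA).1 _ _ e1; rewrite m0 in sb.
have pk1 k : (arr s1 k).1 = [::] by rewrite es1 /= /upd; case: eqP.
have ls1 : loadable m d s1 by rewrite es1; split=> // k; move: (pk1 k); rewrite es1.
have [u [eu su hu]] := IH _ _ _ ubl ls1 e2.
exists (bits ++ u); split.
- by rewrite -eu es1.
- by rewrite size_cat su sb.
- move=> S; rewrite /body /= => /eqP; rewrite eqseq_cat ?size_char_string // => /andP[/eqP eb /eqP /hu h].
  apply: filled_cons h => //; first by rewrite es1.
    by move=> k kj; rewrite es1 /= /upd ltn_eqF.
  by rewrite es1; eexists; rewrite /= /upd eqxx /= eb.
Qed.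

Lemma guessall_complete m d j bl s (S : interp m) : loadable m d s ->
  exists t s', [/\ t <= cost bl m, exec (guessall j bl) t s s', inp s' = inp s & filled S j bl s s'].
Proof.
elim: bl j s => [|b bl IH] j s ls /=.
  by exists 1, s; split=> //; apply: filled_nil; case: ls.
have [sc m0 pk fr] := ls.
have eA : arr s j = ([::], (arr s j).2) by rewrite -(pk j) -surjective_pairing.
have [_ /(_ (seta s j ([::], char_string (S b) ++ drop (size (char_string (S b))) (arr s j).2)))] :=
  runs_guessarr (bar b).+1 sc eA.
rewrite m0 => -[|t1 l1 e1]; first by exists (char_string (S b)) => //; rewrite size_char_string.
set s1 := seta _ _ _ in e1.
have pk1 k : (arr s1 k).1 = [::] by rewrite /= /upd; case: eqP.
have [|t2 [s' [l2 e2 i2 f2]]] := IH j.+1 s1; first by [].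
exists (t1 + t2), s'; split=> //.
- by rewrite /cost /= -addnA leq_add.
- by exists t1, t2, s1.
- apply: filled_cons f2 => //; first by move=> k kj; rewrite /= /upd ltn_eqF.
  by eexists; rewrite /= /upd eqxx.
Qed.

(** The length is wrong if the input ends inside a block or goes on after the last one. *)
Fixpoint badlen (j : nat) (bl : seq block) : prog :=
  if bl is b :: bl' then
    Alt (tooshort (bar b).+1) (Seq (readarr (bar b).+1 j) (badlen j.+1 bl'))
  else inany.

Lemma badlen_checks m d j bl s : loadable m d s ->
  (forall t s', exec (badlen j bl) t s s' -> size (inp s) <> blocks_size m bl) /\
  (size (inp s) <> blocks_size m bl -> exists t s',
     t <= 2 * cost bl m + size bl + 3 /\ exec (badlen j bl) t s s').
Proof.
elim: bl j s => [|b bl IH] j s ls /=.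
  have [h1 h2] := runs_inany s; split.
    by move=> t s' /h1 [h _] e; rewrite e in h.
  move=> h; have [|t l e] := h2 (seti s (behead (inp s))).
    by split=> //; rewrite lt0n; apply/eqP.
  by eexists; eexists; split; [|exact: e]; lia.
have [sc m0 pk fr] := ls.
have eA : arr s j = ([::], (arr s j).2) by rewrite -(pk j) -surjective_pairing.
have [v [a1 a2]] := runs_tooshort (bar b).+1 sc.
have [b1 b2] := runs_readarr (bar b).+1 sc eA.
rewrite m0 in a1 a2 b1 b2; rewrite /blocks_size /= -/(blocks_size m bl); set N := m.+1 ^ _ in a1 a2 b1 b2 *.
have ls1 z w : loadable m d (seti (seta s j ([::], z)) w).
  by split=> // k; rewrite /= /upd; case: eqP.
split.
  move=> t s' [t' _ [/a1 [h _] e|[t1 [t2 [s1 [_ /b1 [h ->] e2]]]] e]].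
    by move: h; rewrite e ltnNge leq_addr.
  apply: ((IH j.+1 _ (ls1 _ _)).1 _ _ e2); by rewrite /= size_drop e addKn.
move=> ne; case: (ltnP (size (inp s)) N) => hN.
  have [|t l e] := a2 v; first by [].
  exists t.+1, v; split; last by exists t => //; left.
  by rewrite /cost /=; lia.
have [t1 l1 e1] := b2 _ (conj hN erefl).
have [_ h2] := IH j.+1 _ (ls1 (take N (inp s) ++ drop N (arr s j).2) (drop N (inp s))).
have [|t2 [s' [l2 e2]]] := h2; first by rewrite /= size_drop; lia.
exists (t1 + t2).+1, s'; split; first by rewrite /cost /= in l2 *; lia.
by eexists; [reflexivity|right; eexists; eexists; eexists; split; [reflexivity|exact: e1|exact: e2]].
Qed.

Fixpoint guessconsts (r k : nat) : prog :=
  if k is k'.+1 then Seq (guess (reg r)) (guessconsts r.+1 k') else Skip.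

Lemma reg_neq0 r : reg r != 0.
Proof. by rewrite /reg addnS. Qed.

Lemma reg_inj r r' : (reg r == reg r') = (r == r').
Proof. by rewrite /reg eqn_add2r. Qed.

Lemma scratch_setreg s r v : scratch s -> scratch (setc s (reg r) v).
Proof. by rewrite /scratch /= /upd /reg !addnS. Qed.

Lemma loadable_setreg m d s v : v <= m -> loadable m d s -> loadable m d.+1 (setc s (reg d) v).
Proof.
move=> vm [sc m0 pk fr]; split=> //; first exact: scratch_setreg.
  by rewrite /= /upd /reg addnS.
by move=> r dr; rewrite /= /upd reg_inj gtn_eqF // fr // ltnW.
Qed.

Definition chosen (m r k : nat) (v : nat -> nat) (s s' : store) : Prop :=
  [/\ inp s = inp s', arr s =1 arr s', forall x, (forall i, i < k -> x <> reg (r + i)) -> cnt s x = cnt s' x &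
      forall i, i < k -> cnt s' (reg (r + i)) = v (r + i)].

Lemma guessconsts_sound m r k t s s' : loadable m r s -> exec (guessconsts r k) t s s' ->
  loadable m (r + k) s' /\ exists2 v, (forall i, v i <= m) & chosen m r k v s s'.
Proof.
elim: k r t s => [|k IH] r t s ls /=.
  by move=> [_ ->]; rewrite addn0; split=> //; exists (fun _ => 0).
have [sc m0 pk fr] := ls.
move=> [t1 [t2 [s1 [_ e1 e2]]]].
have [v1 v1m es1] := (runs_guess (variable_reg r) (reg_neq0 r) sc (fr r (leqnn r))).1 _ _ e1.
rewrite m0 in v1m; have ls1 : loadable m r.+1 s1 by rewrite es1; apply: loadable_setreg.
have [ls' [v vm [iv av xv cv]]] := IH _ _ _ ls1 e2.
rewrite addnS -addSn; split=> //; exists (fun i => if i == r then v1 else v i).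
  by move=> i; case: eqP.
split.
- by rewrite -iv es1.
- by move=> x; rewrite -av es1.
- move=> x hx; rewrite -xv; last by move=> i ik; rewrite addSnnS; apply: hx.
  by rewrite es1 /= /upd; case: eqP => // e; case: (hx 0) => //; rewrite addn0.
- move=> [|i] ik; last by rewrite addnS -addSn cv // ifN // gtn_eqF // ltn_addr.
  rewrite addn0 eqxx -xv; first by rewrite es1 /= /upd eqxx.
  by move=> i _ /eqP; rewrite reg_inj ltn_eqF // ltn_addr.
Qed.

Lemma guessconsts_complete m r k s v : loadable m r s -> (forall i, v i <= m) ->
  exists t s', [/\ t <= k * (1000 * m.+1 ^ 2) + 1, exec (guessconsts r k) t s s', chosen m r k v s s' &
    loadable m (r + k) s'].
Proof.
elim: k r s => [|k IH] r s ls vm /=.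
  by exists 1, s; rewrite addn0.
have [sc m0 pk fr] := ls.
have [_ /(_ (setc s (reg r) (v r)))] := runs_guess (variable_reg r) (reg_neq0 r) sc (fr r (leqnn r)).
rewrite m0 => -[|t1 l1 e1]; first by exists (v r).
have [t2 [s' [l2 e2 [iv av xv cv] ls']]] := IH r.+1 _ (loadable_setreg (vm r) ls) vm.
exists (t1 + t2), s'; split; last by rewrite addnS -addSn.
- by rewrite mulSn -addnA leq_add.
- by exists t1, t2, (setc s (reg r) (v r)).
split=> //.
- move=> x hx; rewrite -xv; last by move=> i ik; rewrite addSnnS; apply: hx.
  by rewrite /= /upd; case: eqP => // e; case: (hx 0) => //; rewrite addn0.
- move=> [|i] ik; last by rewrite addnS -addSn cv.
  rewrite addn0 -xv; first by rewrite /= /upd eqxx.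
  by move=> i _ /eqP; rewrite reg_inj ltn_eqF // ltn_addr.
Qed.

End Encoding.

(** Time is measured in m. As m is written in unary, it is at most the length of the word. *)
Definition recognizes (p : prog) (P : set (seq bool)) : Prop :=
  exists2 f, poly f &
    (forall w t s', exec p t (store0 w) s' -> P w) /\
    (forall w, P w -> exists t s' m, [/\ m <= size w, t <= f m & exec p t (store0 w) s']).

Lemma recognizes_alt p q P R : recognizes p P -> recognizes q R -> recognizes (Alt p q) (P `|` R).
Proof.
move=> [f pf [p1 p2]] [g pg [q1 q2]]; exists (fun m => f m + g m + 1).
  by apply: poly_add (poly_const 1); apply: poly_add.
split=> w; first by move=> t s' [t' _ [/p1|/q1] ?]; [left|right].
move=> [/p2|/q2] [t [s' [m [mw tf e]]]]; exists t.+1, s', m.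
  by split=> //; [rewrite addn1 ltnS (leq_trans tf) // leq_addr|exists t => //; left].
by split=> //; [rewrite addn1 ltnS (leq_trans tf) // leq_addl|exists t => //; right].
Qed.

Lemma recognizes_inNP p P : recognizes p P -> inNP P.
Proof.
move=> [f [c [k hf]] [p1 p2]]; have [N hN] := prog_machine p.
(* For a nonempty word m + 1 is at most twice its length, whence the factor; the additive constant
   covers the empty word. *)
exists N, (c * 2 ^ k), k => w; split.
  move=> /p2 [t [s' [m [mw tf e]]]]; apply: (hN w _).2 e _; apply: leq_trans tf _.
  apply: leq_trans (hf m) _; case: (posnP (size w)) => w0.
    have -> : m = 0 by move: mw; rewrite w0 leqn0 => /eqP.
    by rewrite exp1n muln1 (leq_trans _ (leq_addl _ _)) // leq_pmulr // expn_gt0.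
  rewrite (leq_trans _ (leq_addr _ _)) // -mulnA leq_mul2l -expnMn.
  by case: k {hf} => [|k]; rewrite ?expn0 ?orbT // leq_exp2r ?orbT //; lia.
by move=> /(hN w _).1 [t [s' /p1]].
Qed.

(** * Recognition of the words that encode a model of a formula *)

Section Recognition.
Variable L : signature.

(** Written as a formula so that [ev] can check the blocks of constants as well. *)
Definition sing (t : term L) : formula L :=
  FAll 0 (FIff (FVar 0 [tuple TVar 0]) (FEq (TVar 0) t)).

Lemma sat_sing A (M : henkin L A) iv rv t : t <> TVar 0 ->
  sat M iv rv (sing t) <-> rv 0 0 = [set x : 1.-tuple A | thead x = teval M iv t].
Proof.
move=> t0; have E a : teval M (fun y => if y == 0 then a else iv y) t = teval M iv t.
  by case: t t0 => //= -[].
have Ea a : map_tuple (teval M (fun y => if y == 0 then a else iv y)) [tuple TVar 0] = [tuple a].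
  exact: val_inj.
split=> [/= h|e /= [a]].
  rewrite predeqE => x; have -> : x = [tuple thead x] by rewrite [LHS]tuple_eta; apply: val_inj; case: x => -[|? []].
  rewrite /mkset theadE; apply: contrapT => hx; apply: h; exists (thead x); rewrite Ea E => -[h1 h2].
  by apply: hx; split=> ?; apply: contrapT => ?; [apply: h1|apply: h2].
by rewrite Ea E e /mkset theadE => h; apply: h; split=> -[].
Qed.

Lemma sat_ex_sing A (M : henkin L A) iv rv :
  sat M iv rv (FEx 1 (sing (TVar 1))) <-> exists a, rv 0 0 = [set x : 1.-tuple A | thead x = a].
Proof.
have t1 : TVar 1 <> TVar 0 :> term L by [].
have h a := sat_sing M (fun y => if y == 1 then a else iv y) rv t1.
by split=> -[a]; [move=> /h|move=> e]; exists a => //; apply/h.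
Qed.

Variables (q : formula L) (its0 : seq (block L)) (cs0 : seq (csym L)).
Hypotheses (sq : sigma true q) (nq : no_veq q) (u0 : uniq its0).
Hypothesis cs0E : forall c, (inr (inr c) \in its0) = (c \in cs0).

(** Free individual variables are read from counter 0, which holds m; this is evaluation under the
    constant assignment [ord_max]. *)
Definition language : set (seq bool) :=
  [set w | exists m (M : henkin L 'I_m.+1) rv,
     [/\ 0 < m, standard M, usual_order M, sat M (fun _ => ord_max) rv q
       & w = word its0 (bset M rv)]].

(** An interpolant may mention relation variables and symbols on which the word is silent. These
    blocks are guessed, in accordance with the existential form of [language]. *)
Definition its1 : seq (block L) :=
  undup [seq b <- [seq inl Y | Y <- frv q] ++ [seq inr (inl C) | C <- psyms q] | b \notin its0].

Definition its : seq (block L) := its0 ++ its1.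

(** The values of all constants are guessed; for those in [cs0] the guess is then compared with the
    singleton in the word. *)
Definition cs : seq (csym L) := undup (cs0 ++ csyms q).

Definition depth : nat := size its + size cs.

Definition tcnt_ (t : term L) : nat :=
  match t with
  | TVar _ => 0
  | TCst c => if c \in cs then reg (size its + index c cs) else 0
  end.

Definition arr_of (b : block L) : nat := index b its.

Definition loaded m (S : interp L m) (v : nat -> nat) (s : store) : Prop :=
  [/\ loadable m depth s, {in its, forall b, holds_array s (arr_of b) (S b)} &
      {in cs, forall c, cnt s (reg (size its + index c cs)) = v (size its + index c cs)}].

Lemma loaded_eqv m S v s s' : eqv depth s s' -> @loaded m S v s -> @loaded m S v s'.
Proof.
move=> [c i a pk] [[h1 h2 h3 h4] h5 h6]; split.
- split=> //; first by move: h1; rewrite /scratch !c.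
    by rewrite -c.
  by move=> r; rewrite -c; apply: h4.
- move=> b hb; have [tl e] := h5 b hb; exists tl; rewrite -a //.
  by rewrite ltn_addr // index_mem.
- by move=> x /h6; rewrite c.
Qed.

Lemma loaded_represents m S v s (M : henkin L 'I_m.+1) rv e2 p : @loaded m S v s ->
  {in cs, forall c, cI M c = v (size its + index c cs) :> nat} ->
  {subset csyms p <= cs} -> {in psyms p, forall C, inr (inl C) \in its /\ rI M (Some C) = S (inr (inl C))} ->
  (forall n X, (n, X) \in frv p -> e2 n X < depth /\ holds_array s (e2 n X) (rv n X)) ->
  represents M (fun _ => ord_max) rv tcnt_ e2 (fun C => arr_of (inr (inl C))) depth p s.
Proof.
move=> [[h1 h2 h3 h4] h5 h6] hv hc hp hr; split=> //.
- case=> [x|c] /=; first by left.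
  case: ifP => hcs; last by left.
  by right; move: hcs; rewrite -index_mem /depth /reg; lia.
- by move=> c /hc hcs; rewrite /= hcs h6 // hv.
- move=> C /hp [hC e]; split; last by rewrite e; exact: h5 hC.
  by rewrite ltn_addr // index_mem.
Qed.

Definition check_const (c : csym L) : prog :=
  ev true tcnt_ (fun _ _ => arr_of (inr (inr c))) (fun C => arr_of (inr (inl C))) depth (sing (TCst c)).

Definition check_consts (l : seq (csym L)) : prog := foldr (fun c p => Seq (check_const c) p) Skip l.

Lemma checks_consts l : {subset l <= cs0} -> exists2 f, poly f &
  forall m S v s (M : henkin L 'I_m.+1), standard M -> usual_order M -> @loaded m S v s ->
    {in cs, forall c, cI M c = v (size its + index c cs) :> nat} ->
    checks depth (check_consts l) s
      {in l, forall c, S (inr (inr c)) = [set t : 1.-tuple 'I_m.+1 | thead t = cI M c]} (f m).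
Proof.
elim: l => [|c l IH] hl.
  exists (fun _ => 1); first exact: poly_const.
  move=> m S v s M _ _ [[_ _ pk _] _ _] _; split=> [t s' [_ ->]|_]; first by split.
  by exists 1, s.
have [|f pf hf] := IH; first by move=> c' hc'; apply: hl; rewrite inE hc' orbT.
have ss : sigma true (sing (TCst c)) by [].
have [g pg hg] := checks_ev tcnt_ (fun _ _ => arr_of (inr (inr c)))
  (fun C => arr_of (inr (inl C))) depth ss isT.
exists (fun m => g m + f m); first exact: poly_add.
have c0 : c \in cs0 by apply: hl; rewrite inE eqxx.
have cits : inr (inr c) \in its by rewrite mem_cat cs0E c0.
move=> m S v s M stM uM ls hv.
pose rv0 : forall n, nat -> set (n.+1.-tuple 'I_m.+1) := fun _ _ => set0.
pose rv := rupd rv0 0 (S (inr (inr c)) : set (1.-tuple 'I_m.+1)).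
have rep s1 : loaded S v s1 -> represents M (fun _ => ord_max) rv tcnt_ (fun _ _ => arr_of (inr (inr c)))
    (fun C => arr_of (inr (inl C))) depth (sing (TCst c)) s1.
  move=> l1; have [_ hl1 _] := l1; apply: loaded_represents l1 hv _ _ _ => //.
  - by move=> c'; rewrite /= !inE orbb => /eqP ->; rewrite mem_undup mem_cat c0.
  - move=> n X; rewrite /= !inE orbb => /eqP[-> ->]; rewrite /rv rupd_same; split.
      by rewrite ltn_addr // index_mem.
    exact: (hl1 _ cits).
have E : sat M (fun _ => ord_max) rv (sing (TCst c)) <->
    S (inr (inr c)) = [set t : 1.-tuple 'I_m.+1 | thead t = cI M c].
  by rewrite sat_sing // /rv rupd_same.
apply: checks_ext (checks_seq (hg m M _ rv s stM uM (rep s ls)) (fun s1 e1 =>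
  hf m S v s1 M stM uM (loaded_eqv e1 ls) hv)).
split=> [[/E h1 h2] c'|h]; last first.
  by split=> [|c' hc']; [apply/E|]; apply: h; rewrite inE ?eqxx // hc' orbT.
by rewrite inE => /orP[/eqP ->|/h2].
Qed.

Definition front : prog :=
  Seq header (Seq (readall 0 its0) (Seq (Do InEnd)
    (Seq (guessall (size its0) its1) (guessconsts (size its) (size cs))))).

Definition front_cost (m : nat) : nat :=
  20 * m.+1 ^ 1 + (cost its0 m + (2 + (cost its1 m + (size cs * (1000 * m.+1 ^ 2) + 1)))).

Lemma poly_front_cost : poly front_cost.
Proof.
apply: poly_add; first exact: poly_pow.
apply: poly_add; first exact: poly_cost.
apply: poly_add; first exact: poly_const.
apply: poly_add; first exact: poly_cost.
apply: poly_add; last exact: poly_const.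
by apply: poly_mul; [apply: poly_const|apply: poly_pow].
Qed.

Lemma loadable_store1 m d u : loadable m d (store1 m u).
Proof. by split=> // r _; rewrite /= /upd /reg addnS. Qed.

Lemma uniq_its : uniq its.
Proof.
rewrite cat_uniq u0 undup_uniq andbT /=; apply/hasPn => b.
by rewrite mem_undup mem_filter => /andP[].
Qed.

Lemma filled_loaded m (S : interp L m) v s s1 s2 s3 :
  filled S 0 its0 s s1 -> filled S (size its0) its1 s1 s2 ->
  chosen m (size its) (size cs) v s2 s3 -> loadable m depth s3 -> loaded S v s3.
Proof.
move=> [_ _ _ f0] [_ _ a1 f1] [_ a3 _ c3] ls; split=> // [b|c hc].
  rewrite mem_cat /arr_of /its index_cat; case: ifP => [b0 _|_ b1].
    have [|tl e] := f0 (index b its0) b _ (nth_index b b0); first by rewrite index_mem.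
    by exists tl; rewrite -a3 -a1 ?index_mem.
  have [|tl e] := f1 (index b its1) b _ (nth_index b b1); first by rewrite index_mem.
  by exists tl; rewrite -a3.
by rewrite c3 // index_mem.
Qed.

Lemma body_cat m bl bl' (S : interp L m) : body (bl ++ bl') S = body bl S ++ body bl' S.
Proof. by rewrite /body map_cat flatten_cat. Qed.

Lemma front_sound t w s' : exec front t (store0 w) s' -> exists m (S : interp L m) v,
  [/\ 0 < m, w = word its0 S, forall i, v i <= m & loaded S v s'].
Proof.
move=> [? [? [s1 [_ /header_sound[m [u [m0 -> ->]]] [? [t2 [s2 [_ e2 [? [? [s3 [_ [_ [i3 ->]] e3]]]]]]]]]]]].
have [a [ea sa ha]] := readall_sound u0 (loadable_store1 m depth u) e2.
rewrite i3 cats0 /= in ea; have [S0 aS0] := body_onto u0 sa.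
have ls2 d : loadable m d s2 := loadable_filled (ha _ aS0) (loadable_store1 m d u).
move: e3 => [? [? [s4 [_ e4 e5]]]].
have [b [_ sb hb]] := guessall_sound (undup_uniq _ : uniq its1) (ls2 0) e4.
have [|S eS] := @body_onto L m its (a ++ b) uniq_its.
  by rewrite size_cat sa sb /blocks_size /its map_cat sumn_cat.
move: eS; rewrite body_cat => /eqP; rewrite eqseq_cat ?size_body // => /andP[/eqP aS /eqP bS].
have [ls' [v vm hv]] := guessconsts_sound (loadable_filled (hb _ bS) (ls2 (size its))) e5.
exists m, S, v; split=> //; first by rewrite ea aS.
exact: filled_loaded (ha _ aS) (hb _ bS) hv ls'.
Qed.

Lemma front_complete m (S : interp L m) v : 0 < m -> (forall i, v i <= m) ->
  exists t s', [/\ t <= front_cost m, exec front t (store0 (word its0 S)) s' & loaded S v s'].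
Proof.
move=> m0 vm; have [t1 l1 e1] := header_complete (body its0 S) m0.
have ls1 d := loadable_store1 m d (body its0 S).
have [|t2 [s2 [l2 e2 i2 f2]]] := @readall_complete L m depth 0 its0 _ S [::] (ls1 _).
  by rewrite cats0.
have ls2 d : loadable m d s2 := loadable_filled f2 (ls1 d).
have [t3 [s3 [l3 e3 i3 f3]]] := guessall_complete (size its0) its1 S (ls2 depth).
have [t4 [s4 [l4 e4 c4 ls4]]] := guessconsts_complete (size cs) (loadable_filled f3 (ls2 (size its))) vm.
exists (t1 + (t2 + (2 + (t3 + t4)))), s4; split; last exact: filled_loaded f2 f3 c4 ls4.
  by rewrite /front_cost expn1 !leq_add.
exists t1, (t2 + (2 + (t3 + t4))), (store1 m (body its0 S)); split=> //.
exists t2, (2 + (t3 + t4)), s2; split=> //.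
by exists 2, (t3 + t4), s2; split=> //; exists t3, t4, s3.
Qed.

Definition recognizer : prog :=
  Seq front (Seq (check_consts cs0)
    (ev true tcnt_ (fun n X => arr_of (inl (n, X))) (fun C => arr_of (inr (inl C))) depth q)).

Lemma its_frv n X : (n, X) \in frv q -> inl (n, X) \in its.
Proof.
move=> h; rewrite mem_cat mem_undup mem_filter mem_cat; case: (boolP (inl _ \in its0)) => //= _.
by rewrite map_f.
Qed.

Lemma its_psyms C : C \in psyms q -> inr (inl C) \in its.
Proof.
move=> h; rewrite mem_cat mem_undup mem_filter mem_cat; case: (boolP (inr _ \in its0)) => //= _.
by rewrite (map_f (fun C => inr (inl C) : block L)) ?orbT.
Qed.

Lemma recognizes_language : recognizes recognizer language.
Proof.
have [|g pg hg] := @checks_consts cs0; first by [].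
have [h ph hh] := checks_ev tcnt_ (fun n X => arr_of (inl (n, X)))
  (fun C => arr_of (inr (inl C))) depth sq nq.
have chk m S v s (M : henkin L 'I_m.+1) rv : standard M -> usual_order M -> loaded S v s ->
    {in cs, forall c, cI M c = v (size its + index c cs) :> nat} ->
    (forall C, rI M (Some C) = S (inr (inl C))) -> (forall n X, rv n X = S (inl (n, X))) ->
    checks depth (Seq (check_consts cs0)
      (ev true tcnt_ (fun n X => arr_of (inl (n, X))) (fun C => arr_of (inr (inl C))) depth q)) s
      ({in cs0, forall c, S (inr (inr c)) = [set t : 1.-tuple 'I_m.+1 | thead t = cI M c]} /\
       sat M (fun _ => ord_max) rv q) (g m + h m).
  move=> stM uM ls hv hC hX; apply: checks_seq (hg _ _ _ _ _ stM uM ls hv) _ => s1 e1.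
  have l1 := loaded_eqv e1 ls; have [_ a1 _] := l1.
  apply: (hh m M _ rv s1 stM uM); apply: loaded_represents l1 hv _ _ _.
  - by move=> c hc; rewrite mem_undup mem_cat hc orbT.
  - by move=> C /its_psyms.
  - move=> n X /its_frv hX'; split; first by rewrite ltn_addr // index_mem.
    by rewrite hX; apply: (a1 _ hX').
exists (fun m => front_cost m + (g m + h m)).
  by apply: poly_add poly_front_cost _; apply: poly_add.
split=> [w t s' [t1 [t2 [s1 [_ /front_sound[m [S [v [m0 -> vm ls]]]] e2]]]]|w [m [M [rv [m0 stM uM hq ->]]]]].
  pose M := fin_model S (fun c => inord (v (size its + index c cs))).
  have hv : {in cs, forall c, cI M c = v (size its + index c cs) :> nat} by move=> c _; rewrite /= inordK // ltnS.
  have [[hc hq] _] := (chk m S v s1 M (fin_env S) (@fin_model_standard _ _ _ _)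
    (@fin_model_order _ _ _ _) ls hv (fun=> erefl) (fun _ _ => erefl)).1 _ _ e2.
  exists m, M, (fin_env S); split=> //; congr (_ ++ _ :: flatten _).
  apply/eq_in_map => -[[n X]|[C|c]] hb //=; congr char_string; apply: hc.
  by rewrite -cs0E.
(* The constants occupy the registers from [size its] on, in the order of [cs]. *)
pose v i := nth 0 [seq val (cI M c) | c <- cs] (i - size its).
have vm i : v i <= m.
  rewrite /v; case: (ltnP (i - size its) (size cs)) => hi; last by rewrite nth_default ?size_map.
  by have /mapP[c _ ->] := mem_nth 0 (s := [seq val (cI M c) | c <- cs]) (etrans (congr1 _ (size_map _ _)) hi); rewrite -ltnS ltn_ord.
have hv : {in cs, forall c, cI M c = v (size its + index c cs) :> nat}.
  by move=> c hc; rewrite /v addKn (nth_map c) ?index_mem // nth_index.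
have [t1 [s1 [l1 e1 ls]]] := front_complete (bset M rv) m0 vm.
have [|t2 [s2 [l2 e2 _]]] := (chk m (bset M rv) v s1 M rv stM uM ls hv (fun=> erefl) (fun _ _ => erefl)).2.
  by split=> // c _.
exists (t1 + t2), s2, m; split; first by rewrite /word size_cat size_nseq leq_addr.
  exact: leq_add.
by exists t1, t2, s1.
Qed.

End Recognition.

(** * Words that encode no instance *)

Section Malformed.
Variables (L : signature) (its0 : seq (block L)) (cs0 : seq (csym L)).
Hypothesis u0 : uniq its0.
Hypothesis cs0E : forall c, (inr (inr c) \in its0) = (c \in cs0).

Definition malformed : set (seq bool) :=
  [set w | ~ exists m (S : interp L m), [/\ 0 < m, w = word its0 S &
     {in cs0, forall c, exists a, S (inr (inr c)) = [set t : 1.-tuple 'I_m.+1 | thead t = a]}]].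

Definition check_bad (c : csym L) : prog :=
  ev false (fun _ : term L => 0) (fun _ _ => index (inr (inr c)) its0) (fun _ => 0) (size its0)
    (FEx 1 (sing (TVar 1))).

Definition check_bads (l : seq (csym L)) : prog := foldr (fun c p => Alt (check_bad c) p) Stop l.

Definition holding m (S : interp L m) (s : store) : Prop :=
  loadable m (size its0) s /\ {in its0, forall b, holds_array s (index b its0) (S b)}.

Lemma checks_bads l : {subset l <= cs0} -> exists2 f, poly f &
  forall m S s, @holding m S s ->
    checks (size its0) (check_bads l) s
      (~ {in l, forall c, exists a, S (inr (inr c)) = [set t : 1.-tuple 'I_m.+1 | thead t = a]}) (f m).
Proof.
elim: l => [|c l IH] hl.
  exists (fun _ => 0); first exact: poly_const.
  by move=> m S s _; apply: checks_stop; apply.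
have [|f pf hf] := IH; first by move=> c' hc'; apply: hl; rewrite inE hc' orbT.
have ss : sigma false (FEx 1 (sing (TVar 1)) : formula L) by [].
have [g pg hg] := checks_ev (fun _ => 0) (fun _ _ => index (inr (inr c)) its0) (fun _ => 0) (size its0) ss isT.
exists (fun m => (g m + f m) + 1).
  by apply: poly_add (poly_const 1); apply: poly_add.
have cits : inr (inr c) \in its0 by rewrite cs0E hl // inE eqxx.
move=> m S s hs; have [[h1 h2 h3 h4] h5] := hs.
pose M := fin_model S (fun _ => ord_max).
pose rv : forall n, nat -> set (n.+1.-tuple 'I_m.+1) := rupd (fun _ _ => set0) 0 (S (inr (inr c)) : set (1.-tuple _)).
have rep : represents M (fun _ => ord_max) rv (fun _ => 0) (fun _ _ => index (inr (inr c)) its0)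
    (fun _ => 0) (size its0) (FEx 1 (sing (TVar 1))) s.
  split=> //; first by move=> t; left.
  move=> n X; rewrite /= !inE orbb => /eqP[-> ->]; rewrite /rv rupd_same index_mem; split=> //.
  exact: (h5 _ cits).
have E : sat M (fun _ => ord_max) rv (FEx 1 (sing (TVar 1))) <->
    exists a, S (inr (inr c)) = [set t : 1.-tuple 'I_m.+1 | thead t = a].
  by rewrite sat_ex_sing /rv rupd_same.
rewrite addn1; apply: checks_ext (checks_alt (hg m M _ rv s (@fin_model_standard _ _ _ _)
  (@fin_model_order _ _ _ _) rep) (hf m S s hs)).
split=> [[h /(_ c (mem_head _ _))/E //|h hc]|h].
  by apply: h => c' hc'; apply: hc; rewrite inE hc' orbT.
apply: contrapT => /not_orP[/contrapT /E hc /contrapT hl']; apply: h => c'.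
by rewrite inE => /orP[/eqP ->|/hl'].
Qed.

(** A word is malformed if it has no delimiter, if m = 0, if its blocks have the wrong total length,
    or if the block of some constant is not a singleton. *)
Definition rejecter : prog :=
  Alt (Seq (Star (Do (InGet true))) (Do InEnd))
  (Alt (Do (InGet false))
    (Seq header (Alt (badlen 0 its0)
      (Seq (readall 0 its0) (Seq (Do InEnd) (check_bads cs0)))))).

Lemma runs_ones k u : (u = [::] \/ exists u', u = false :: u') ->
  runs (Seq (Star (Do (InGet true))) (Do InEnd)) (store0 (nseq k true ++ u))
    (fun s' => u = [::] /\ s' = store0 [::]) (10 * k.+1).
Proof.
move=> hu; pose f i := store0 (nseq (k - i) true ++ u).
apply: runs_le (@runs_while _ _ f k _ _ 2 2 _ _ _ _ _); first by lia.
- by rewrite /f subn0.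
- move=> i ik; apply: runs_ext (runs_do _ _) => s' /=; rewrite /f.
  have -> : k - i = (k - i.+1).+1 by lia.
  by split=> [[w [<-] ->]|->] //; eexists.
- apply: runs_ext (runs_do _ _) => s' /=; rewrite subnn /=; split=> // -[w e _].
  by case: hu => [hu|[u' hu]]; rewrite hu in e.
- move=> i ik; apply: runs_ext (runs_do _ _) => s' /=; have -> : k - i = (k - i.+1).+1 by lia.
  by split=> // -[].
- apply: runs_ext (runs_do _ _) => s'; rewrite /f subnn /=.
  by split=> -[h ->]; rewrite h.
Qed.

Lemma ones_not_word k m (S : interp L m) : nseq k true <> word its0 S.
Proof.
move=> e; have : false \in nseq k true by rewrite e mem_cat mem_head orbT.
by rewrite mem_nseq andbF.
Qed.

Lemma recognizes_malformed : recognizes rejecter malformed.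
Proof.
have [|g pg hg] := @checks_bads cs0; first by [].
exists (fun m => 20 * m.+1 ^ 1 + (3 * cost its0 m + (g m + (size its0 + 10)))).
  apply: poly_add; first exact: poly_pow.
  apply: poly_add; first by apply: poly_mul (poly_const 3) (poly_cost _).
  by apply: poly_add pg (poly_const _).
split=> w.
  move=> t s' [? _ [e|[? _ [[_ [w' /= -> _]]|e]]]].
  - have [k [u [ew hu]]] := split_ones w; rewrite ew in e *.
    have [-> _] := (runs_ones k hu).1 _ _ e; rewrite cats0 => -[m [S [_ /ones_not_word]]] //.
  - by move=> [[|m] [S [//]]].
  - move: e => [? [? [s1 [_ /header_sound[m [u [m0 -> ->]]] [? _ e]]]]].
    move=> [m' [S [_ /nseq_false_inj[em]]]]; subst m' => eu hc.
    case: e => [/(badlen_checks 0 its0 (loadable_store1 m 0 u)).1|].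
      by apply; rewrite /= eu size_body.
    move=> [? [? [s2 [_ e2 [? [? [s3 [_ [_ [i3 ->]] e3]]]]]]]].
    have [a [ea sa ha]] := readall_sound u0 (loadable_store1 m (size its0) u) e2.
    rewrite i3 cats0 /= eu in ea.
    have fS := ha S (esym ea).
    have hs : holding S s2.
      split; first exact: loadable_filled fS (loadable_store1 _ _ _).
      move=> b hb; have [_ _ _ f] := fS; apply: (f (index b its0)); last exact: nth_index.
      by rewrite index_mem.
    by have [] := (hg m S s2 hs).1 _ _ e3.
move=> hw; have [k [u [ew hu]]] := split_ones w.
have kw : k <= size w by rewrite ew size_cat size_nseq leq_addr.
have [eu|[u' eu]] := hu.
  have [_ /(_ (store0 [::]) (conj eu erefl)) [t lt e]] := runs_ones k hu.
  exists t.+1, (store0 [::]), k; split=> //; first by rewrite expn1; lia.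
  by exists t => //; left; rewrite ew.
have [k0|k0] := posnP k.
  exists 4, (store0 u'), k; split=> //; first by rewrite expn1; lia.
  exists 3 => //; right; exists 2 => //; left; split=> //; exists u' => //.
  by rewrite /= ew k0 eu.
have [t1 l1 e1] := header_complete u' k0.
suff [t2 [s2 [l2 e2]]] : exists t2 s2, t2 <= 3 * cost its0 k + (g k + (size its0 + 7)) /\
    exec (Alt (badlen 0 its0) (Seq (readall 0 its0) (Seq (Do InEnd) (check_bads cs0)))) t2 (store1 k u') s2.
  exists (t1 + t2).+2, s2, k; split=> //; first by rewrite expn1; lia.
  exists (t1 + t2).+1 => //; right; exists (t1 + t2) => //; right.
  by exists t1, t2, (store1 k u'); rewrite ew eu.
have [su|/eqP su] := eqVneq (size u') (blocks_size k its0); last first.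
  have [t2 [s2 [l2 e2]]] := (badlen_checks 0 its0 (loadable_store1 k 0 u')).2 su.
  exists t2.+1, s2; split; first by lia.
  by exists t2 => //; left.
have [S eS] := body_onto u0 su.
have [|t2 [s2 [l2 e2 i2 f2]]] := @readall_complete L k (size its0) 0 its0 _ S [::] (loadable_store1 k _ u').
  by rewrite cats0 -eS.
have hs : holding S s2.
  split; first exact: loadable_filled f2 (loadable_store1 _ _ _).
  move=> b hb; have [_ _ _ f] := f2; apply: (f (index b its0)); last exact: nth_index.
  by rewrite index_mem.
have [|t3 [s3 [l3 e3 _]]] := (hg k S s2 hs).2.
  by move=> hc; apply: hw; exists k, S; split=> //; rewrite ew eu eS.
exists (t2 + (2 + t3)).+1, s3; split; first by lia.
exists (t2 + (2 + t3)) => //; right; exists t2, (2 + t3), s2; split=> //.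
by exists 2, t3, s2.
Qed.

End Malformed.

(** * The membership problem *)

Section Membership.
Variables (L : signature) (T : set (formula L)) (l : nat) (n : 'I_l -> nat) (Q : formula L).
Hypothesis modelsT : forall m (M : henkin L 'I_m.+1),
  1 <= m -> standard M -> usual_order M -> models M T.
Hypotheses (genQ : gen_quantifier n Q) (indQ : domain_independent T n Q).

Definition encoded_blocks : seq (block L) :=
  [seq inl (n i, val i) | i <- enum 'I_l] ++ [seq inr (inl C) | C <- undup (psyms Q)]
  ++ [seq inr (inr c) | c <- undup (csyms Q)].

Lemma uniq_encoded_blocks : uniq encoded_blocks.
Proof.
have [u1 u2 u3] : [/\ injective (fun i : 'I_l => inl (n i, val i) : block L),
    injective (fun C => inr (inl C) : block L) & injective (fun c => inr (inr c) : block L)].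
  by split=> [i j [_ /val_inj]|C C' []|c c' []].
have ue : uniq (enum 'I_l) by exact: enum_uniq.
rewrite !cat_uniq (map_inj_uniq u1) (map_inj_uniq u2) (map_inj_uniq u3) !undup_uniq ue andbT.
rewrite !andTb; apply/andP; split; apply/hasPn => b.
  by rewrite mem_cat => /orP[] /mapP[x _ ->]; apply/mapP => -[].
by move=> /mapP[x _ ->]; apply/mapP => -[].
Qed.

Lemma encoded_const c : (inr (inr c) \in encoded_blocks) = (c \in undup (csyms Q)).
Proof.
rewrite !mem_cat; apply/idP/idP => [/or3P[] /mapP[x hx //] [-> //]|h].
by rewrite (map_f (fun c => inr (inr c) : block L)) ?orbT.
Qed.

Lemma encodeE m (M : henkin L 'I_m.+1) R rv : (forall i, rv (n i) (val i) = R i) ->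
  encode M Q R = word encoded_blocks (bset M rv).
Proof.
move=> h; rewrite /encode /word /body /encoded_blocks !map_cat !flatten_cat -!map_comp.
by congr (_ ++ _ :: flatten _ ++ _); apply: eq_map => i; rewrite /= h.
Qed.

Lemma membershipE w : membership_problem T n Q w <->
  exists m (M : henkin L 'I_m.+1) rv, [/\ 0 < m, standard M, usual_order M,
    sat M (fun _ => ord_max) rv Q & w = word encoded_blocks (bset M rv)].
Proof.
split=> [[m [M [R [m0 stM uM MT [hQ ->]]]]]|[m [M [rv [m0 stM uM hQ ->]]]]].
  have [|rv rvM e] := @display_exists L _ l n M R; first by move=> i; rewrite stM.
  by exists m, M, rv; split; [| | |apply/(satQE genQ _ rvM e)|apply: encodeE].
have rvM : rvalid M rv := standard_valid _ stM.
exists m, M, (fun i => rv (n i) (val i)); split=> //; first exact: modelsT.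
by split; [apply/(satQE genQ (fun _ => ord_max) rvM (fun=> erefl))|rewrite (@encodeE m M _ rv)].
Qed.

Lemma inNP_membership : inNP (membership_problem T n Q).
Proof.
have [p sp hp] := interpolation genQ indQ.
apply: (@recognizes_inNP (recognizer (elim_veq p) encoded_blocks (undup (csyms Q)))).
have -> : membership_problem T n Q = language (elim_veq p) encoded_blocks.
  rewrite predeqE => w; rewrite membershipE.
  split=> -[m [M [rv [m0 stM uM hq ->]]]]; exists m, M, rv; split=> //; move: hq;
    by rewrite elim_veq_sat hp //; [apply: modelsT|apply: standard_valid].
apply: recognizes_language; [exact: elim_veq_sigma|exact: elim_veq_no_veq|
  exact: uniq_encoded_blocks|exact: encoded_const].
Qed.

(** A word outside the problem is malformed or encodes an instance of the negation, which has an
    interpolant of its own. These cases exclude membership because a word determines m and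
    everything on which [Q] depends. *)
Lemma incoNP_membership : incoNP (membership_problem T n Q).
Proof.
have genN : gen_quantifier n (FNot Q) := genQ.
have [p sp hp] := interpolation genN (domain_independent_FNot genQ indQ).
rewrite /incoNP; apply: (@recognizes_inNP (Alt (rejecter encoded_blocks (undup (csyms Q)))
  (recognizer (elim_veq p) encoded_blocks (undup (csyms Q))))).
have -> : ~` membership_problem T n Q = malformed encoded_blocks (undup (csyms Q))
    `|` language (elim_veq p) encoded_blocks.
  rewrite predeqE => w; rewrite /setC /setU /mkset membershipE; split=> [nw|[bad|[m [M [rv [m0 stM uM hq ->]]]]]].
  - apply: contrapT => /not_orP[/contrapT[m [S [m0 ew hS]]] nl].
    (* The blocks of a well-formed word give a model once the constants are read off from their
       singletons. *)
    have /choice[v hv] : forall c, exists a : 'I_m.+1, c \in undup (csyms Q) ->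
        S (inr (inr c)) = [set t : 1.-tuple 'I_m.+1 | thead t = a].
      move=> c; case: (boolP (c \in undup (csyms Q))) => [/hS[a]|_]; first by exists a.
      by exists ord0.
    pose M := fin_model S v.
    have ewM : w = word encoded_blocks (bset M (fin_env S)).
      rewrite ew; congr (_ ++ _ :: flatten _); apply/eq_in_map => -[[k X]|[C|c]] //= hc.
      by rewrite hv // -encoded_const.
    have [hQ|hQ] := pselect (sat M (fun _ => ord_max) (fin_env S) Q).
      by apply: nw; exists m, M, (fin_env S).
    apply: nl; exists m, M, (fin_env S); split=> //; apply/elim_veq_sat.
    have MT : models M T by exact: modelsT.
    exact: (hp _ M _ _ MT (standard_valid _ _)).1 hQ.
  - move=> [m [M [rv [m0 _ _ _ ew]]]]; apply: bad; exists m, (bset M rv); split=> // c _.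
    by exists (cI M c).
  - move=> [m' [M' [rv' [_ stM' uM' hQ]]]] /nseq_false_inj[em]; subst m' => /body_inj eb.
    have : sat M (fun _ => ord_max) rv (FNot Q).
      by apply/hp; [apply: modelsT|apply: standard_valid|apply/elim_veq_sat].
    apply; apply: (sat_agree _ _ _ _ _ _).1 hQ.
    + by move=> k; rewrite stM stM'.
    + rewrite predeqE => t; have -> : t = [tuple tnth t ord0; tnth t (lift ord0 ord0)].
        by apply: eq_from_tnth => -[[|[|i]] hi] //; congr tnth; apply: val_inj.
      by rewrite -/(hle M' _ _) -/(hle M _ _) uM uM'.
    + move=> c hc; have := eb (inr (inr c)); rewrite encoded_const mem_undup => /(_ hc).
      by rewrite predeqE => /(_ [tuple cI M c]) [/(_ erefl)].
    + move=> C hC; symmetry; apply: (eb (inr (inl C))).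
      by rewrite !mem_cat (map_f (fun C => inr (inl C) : block L)) ?orbT // mem_undup.
    + by rewrite genQ.1.
    + move=> k X /(genQ.2)[i [-> ->]]; symmetry; apply: (eb (inl (n i, val i))).
      by rewrite mem_cat (map_f (fun i => inl (n i, val i) : block L)) // mem_enum.
apply: recognizes_alt; first exact: recognizes_malformed uniq_encoded_blocks encoded_const.
apply: recognizes_language; [exact: elim_veq_sigma|exact: elim_veq_no_veq|
  exact: uniq_encoded_blocks|exact: encoded_const].
Qed.

End Membership.

Local Open Scope card_scope.

Theorem corollary13p1 :
  (forall (L : signature) (T : set (formula L))
      (l : nat) (n : 'I_l -> nat) (Q : formula L),
    (forall p, sigma11_ac0 p -> entails T p) ->
    entails T (wo_axiom L) ->
    (forall (A : Type) (M : henkin L A),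
      standard M -> [set: A] #= [set: nat] ->
      well_ordered M -> models M T) ->
    gen_quantifier n Q ->
    domain_independent T n Q ->
    forall (A : Type) (M : henkin L A),
      standard M -> [set: A] #= [set: nat] ->
      well_ordered M -> models M T ->
      borel (quantifier_set M n Q))
  /\
  (forall (L : signature) (T : set (formula L))
      (l : nat) (n : 'I_l -> nat) (Q : formula L),
    (forall p, sigma11_ac0 p -> entails T p) ->
    entails T (wo_axiom L) ->
    (forall (m : nat) (M : henkin L 'I_m.+1),
      1 <= m -> standard M -> usual_order M -> models M T) ->
    gen_quantifier n Q ->
    domain_independent T n Q ->
    inNP (membership_problem T n Q) /\ incoNP (membership_problem T n Q)).
Proof.
split=> [L T l n Q _ _ _ genQ indQ A M stM|L T l n Q _ _ modelsT genQ indQ].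
  rewrite card_eq_le => /andP[/pcard_leTP[f] _] _ MT.
  have f_inj : injective f by move=> x y; apply: inj; rewrite in_setT.
  exact (borel_quantifier_set f_inj genQ indQ stM MT).
by split; [apply: inNP_membership|apply: incoNP_membership].
Qed.
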